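(* Let $\Phi_\lambda$ be the Gelfand-Cetlin system on the co-adjoint orbit $(\mathcal{O}_\lambda,\omega_\lambda)$ of $U(n)$ and let $\Delta_\lambda$ be the corresponding Gelfand-Cetlin polytope. For any point $\mathbf{u}\in\Delta_\lambda$, the fiber $\Phi_\lambda^{-1}(\mathbf{u})$ is an isotropic submanifold of $(\mathcal{O}_\lambda,\omega_\lambda)$ and is the total space of an iterated bundle \[ \Phi_\lambda^{-1}(\mathbf{u})=E_{n-1}\xrightarrow{p_{n-1}}E_{n-2}\xrightarrow{p_{n-2}}\cdots\xrightarrow{p_2}E_1\xrightarrow{p_1}E_0=\mathrm{point} \] such that the fiber at each stage is either a point or a product of odd dimensional spheres. Two fibers $\Phi_\lambda^{-1}(\mathbf{u}_1)$ and $\Phi_\lambda^{-1}(\mathbf{u}_2)$ are diffeomorphic if the two points $\mathbf{u}_1$ and $\mathbf{u}_2$ are contained in the relative interior of the same face of $\Delta_\lambda$.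
   Context: Fix integers $0=n_0<n_1<\cdots<n_r<n_{r+1}=n$ with $r\ge 1$ and a non-increasing real sequence $\lambda=(\lambda_1,\dots,\lambda_n)$ with $\lambda_1=\cdots=\lambda_{n_1}>\lambda_{n_1+1}=\cdots=\lambda_{n_2}>\cdots>\lambda_{n_r+1}=\cdots=\lambda_n$. $\mathcal{O}_\lambda$ is the set of $n\times n$ Hermitian matrices with spectrum $\lambda$ (with multiplicities), i.e. the orbit of $\mathrm{diag}(\lambda_1,\dots,\lambda_n)$ under conjugation by $U(n)$; under a $U(n)$-equivariant identification of Hermitian matrices with $\mathfrak{u}(n)^*$ it is a co-adjoint orbit, diffeomorphic to the partial flag manifold $\mathcal{F}(n_1,\dots,n_r;n)$. The Kirillov-Kostant-Souriau symplectic form $\omega_\lambda$ is $(\omega_\lambda)_h([X,h],[Y,h])=\mathrm{tr}(ih[X,Y])$ for $h\in\mathcal{O}_\lambda$ and $X,Y\in\mathfrak{u}(n)$ (skew-Hermitian matrices). For $i,j\ge 1$ with $i+j\le n+1$, $\Phi_\lambda^{i,j}(x)$ is the $i$-th largest eigenvalue of the leading principal $(i+j-1)\times(i+j-1)$ submatrix of $x\in\mathcal{O}_\lambda$; so $\Phi_\lambda^{i,n+1-i}=\lambda_i$. Let $\mathcal{I}_\lambda$ be the set of $(i,j)$ for which $\Phi_\lambda^{i,j}$ is not constant on $\mathcal{O}_\lambda$; then $|\mathcal{I}_\lambda|=\dim_{\mathbb{C}}\mathcal{O}_\lambda$. The Gelfand-Cetlin system is $\Phi_\lambda=(\Phi_\lambda^{i,j})_{(i,j)\in\mathcal{I}_\lambda}:\mathcal{O}_\lambda\to\mathbb{R}^{|\mathcal{I}_\lambda|}$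 and the Gelfand-Cetlin polytope $\Delta_\lambda$ is its image, equivalently the set of $(u_{i,j})$ with $u_{i,j+1}\ge u_{i,j}\ge u_{i+1,j}$ for all $i,j\ge1$, $i+j\le n$, where $u_{i,n+1-i}=\lambda_i$ (coordinates outside $\mathcal{I}_\lambda$ are forced to be constant). An iterated bundle is a tower in which each $p_k:E_k\to E_{k-1}$ is a fiber bundle. A submanifold is isotropic if the symplectic form restricts to zero on it. *)

(* Defs.v *)
From HB Require Import structures.
From mathcomp Require Import all_boot all_order all_algebra.
From mathcomp Require Import spectral sesquilinear.
From mathcomp Require Import complex.
From mathcomp Require Import boolp classical_sets functions reals.
From mathcomp Require Import topology normedtype derive.

Set Implicit Arguments.
Unset Strict Implicit.
Unset Printing Implicit Defensive.

Import Order.TTheory GRing.Theory Num.Theory.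
Import numFieldNormedType.Exports.

Local Open Scope classical_set_scope.
Local Open Scope ring_scope.
Local Open Scope sesquilinear_scope.

(* Smooth manifolds are subsets of Euclidean spaces, as in Guillemin-Pollack
   and Milnor: every notion below depends only on the subset.  By Whitney's
   theorem this loses no generality. *)

(* [Ck_on k U f] is only meant for open [U] and finite-dimensional [V], [W],
   where it is the usual C^k condition on partial derivatives. *)
Fixpoint Ck_on (R : realType) (V W : normedModType R) (k : nat)
    (U : set V) (f : V -> W) : Prop :=
  (forall x, U x -> {for x, continuous f}) /\
  (if k is k'.+1 then
     forall v, (forall x, U x -> derivable f x v) /\ Ck_on k' U ('D_v f)
   else True).

Definition smooth_on (R : realType) (V W : normedModType R)
    (U : set V) (f : V -> W) : Prop :=
  forall k, Ck_on k U f.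

(* On an arbitrary subset [A], a map is smooth when it extends locally to a
   smooth map on an open set; values of [f] outside [A] are irrelevant. *)
Definition smooth_map (R : realType) (m n : nat) (A : set 'rV[R]_m)
    (f : 'rV[R]_m -> 'rV[R]_n) : Prop :=
  forall x, A x -> exists (U : set 'rV[R]_m) (g : 'rV[R]_m -> 'rV[R]_n),
    [/\ open U, U x, smooth_on U g & forall y, A y -> U y -> f y = g y].

Definition diffeo_pair (R : realType) (m n : nat)
    (A : set 'rV[R]_m) (B : set 'rV[R]_n)
    (f : 'rV[R]_m -> 'rV[R]_n) (g : 'rV[R]_n -> 'rV[R]_m) : Prop :=
  [/\ smooth_map A f, smooth_map B g,
      forall x, A x -> B (f x) /\ g (f x) = x
    & forall y, B y -> A (g y) /\ f (g y) = y].

Definition diffeomorphic (R : realType) (m n : nat)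
    (A : set 'rV[R]_m) (B : set 'rV[R]_n) : Prop :=
  exists f g, diffeo_pair A B f g.

Definition manifold (R : realType) (m : nat) (S : set 'rV[R]_m) : Prop :=
  exists d : nat, forall x, S x ->
    exists (U : set 'rV[R]_m) (W : set 'rV[R]_d),
      [/\ open U, U x, open W & diffeomorphic (S `&` U) W].

(* Both sets carry the smooth structure induced from the ambient Euclidean
   space, so the inclusion is automatically a smooth embedding. *)
Definition submanifold (R : realType) (m : nat) (S M : set 'rV[R]_m) : Prop :=
  [/\ manifold S, manifold M & S `<=` M].

Definition tangent (R : realType) (m : nat) (S : set 'rV[R]_m)
    (x v : 'rV[R]_m) : Prop :=
  exists (e : R) (c : R -> 'rV[R]_m),
    [/\ 0 < e, smooth_on (ball (0 : R) e) c,
        forall t, ball (0 : R) e t -> S (c t), c 0 = x & 'D_1 c 0 = v].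

Record eucl_set (R : realType) :=
  EuclSet { eset_dim : nat; eset_set : set 'rV[R]_eset_dim }.
Arguments eset_set {R} e.

Definition prod_eset (R : realType) (A B : eucl_set R) : eucl_set R :=
  EuclSet [set z : 'rV[R]_(eset_dim A + eset_dim B) |
           eset_set A (lsubmx z) /\ eset_set B (rsubmx z)].

Definition is_point (R : realType) (A : eucl_set R) : Prop :=
  exists x, eset_set A = [set x].

Definition sphere (R : realType) (d : nat) : eucl_set R :=
  EuclSet [set x : 'rV[R]_d.+1 | \sum_i x 0 i ^+ 2 = 1].

Fixpoint prod_spheres (R : realType) (d : nat) (ds : seq nat) : eucl_set R :=
  if ds is d' :: ds' then prod_eset (sphere R d) (prod_spheres R d' ds')
  else sphere R d.

Definition point_or_odd_spheres (R : realType) (F : eucl_set R) : Prop :=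
  is_point F \/
  exists (d : nat) (ds : seq nat), all odd (d :: ds) /\ F = prod_spheres R d ds.

Definition fiber_bundle (R : realType) (E B F : eucl_set R)
    (p : 'rV[R]_(eset_dim E) -> 'rV[R]_(eset_dim B)) : Prop :=
  [/\ [/\ manifold (eset_set E), manifold (eset_set B) &
          manifold (eset_set F)],
      smooth_map (eset_set E) p,
      p @` eset_set E = eset_set B
    & forall b, eset_set B b ->
        exists (U : set 'rV[R]_(eset_dim B))
               (phi : 'rV[R]_(eset_dim E) ->
                      'rV[R]_(eset_dim B + eset_dim F))
               (psi : 'rV[R]_(eset_dim B + eset_dim F) ->
                      'rV[R]_(eset_dim E)),
          [/\ open U, U b,
              diffeo_pair (eset_set E `&` p @^-1` U)
                [set z | (eset_set B `&` U) (lsubmx z) /\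
                         eset_set F (rsubmx z)] phi psi
            & forall x, eset_set E x -> U (p x) -> lsubmx (phi x) = p x]].

(* M = E_l -> E_(l-1) -> ... -> E_1 -> E_0 = point *)
Definition iterated_odd_sphere_bundle (R : realType) (l : nat) (M : eucl_set R) :
    Prop :=
  exists E : nat -> eucl_set R,
    [/\ is_point (E 0), E l = M
      & forall k, (k < l)%N ->
          exists (F : eucl_set R)
                 (p : 'rV[R]_(eset_dim (E k.+1)) -> 'rV[R]_(eset_dim (E k))),
            fiber_bundle F p /\ point_or_odd_spheres F].

Definition affine_hull (R : realType) (m : nat) (A : set 'rV[R]_m) :
    set 'rV[R]_m :=
  [set y | exists (l : nat) (a : 'I_l -> R) (x : 'I_l -> 'rV[R]_m),
     [/\ forall i, A (x i), \sum_i a i = 1 & y = \sum_i a i *: x i]].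

Definition relative_interior (R : realType) (m : nat) (A : set 'rV[R]_m) :
    set 'rV[R]_m :=
  [set x | A x /\ exists U : set 'rV[R]_m,
     [/\ open U, U x & U `&` affine_hull A `<=` A]].

(* [c = 0] gives the improper face [P]. *)
Definition is_face (R : realType) (m : nat) (P F : set 'rV[R]_m) : Prop :=
  exists c : 'cV[R]_m,
    F = [set x | P x /\ forall y, P y -> (y *m c) 0 0 <= (x *m c) 0 0].

(* Real coordinates on complex matrices: real parts, then imaginary parts. *)
Definition mx_coord (R : realType) (n : nat) (A : 'M[R[i]]_n) :
    'rV[R]_(n * n + n * n) :=
  row_mx (mxvec (map_mx (@complex.Re R) A)) (mxvec (map_mx (@complex.Im R) A)).

Definition char_roots (R : realType) (n : nat) (A : 'M[R[i]]_n) : seq R[i] :=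
  sval (closed_field_poly_normal (char_poly A)).

Lemma char_rootsE (R : realType) (n : nat) (A : 'M[R[i]]_n) :
  char_poly A = \prod_(z <- char_roots A) ('X - z%:P).
Proof.
rewrite /char_roots; case: closed_field_poly_normal => s /= {1}->.
by rewrite (monicP (char_poly_monic A)) scale1r.
Qed.

(* Eigenvalues with multiplicity, in non-increasing order; taking real parts
   is harmless because it is only used for Hermitian [A]. *)
Definition eigenvalues (R : realType) (n : nat) (A : 'M[R[i]]_n) : seq R :=
  sort (fun x y => y <= x) (map (@complex.Re R) (char_roots A)).

(* [k = minn k n] as soon as [k <= n], the only case that is used. *)
Definition leading (R : realType) (n k : nat) (x : 'M[R[i]]_n) :
    'M[R[i]]_(minn k n) :=
  mxsub (widen_ord (geq_minr k n)) (widen_ord (geq_minr k n)) x.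

Definition coadjoint_orbit (R : realType) (n : nat) (lam : 'I_n -> R) :
    set 'M[R[i]]_n :=
  [set x | x \is hermsymmx /\
           char_poly x = \prod_(i < n) ('X - ((lam i)%:C%C)%:P)].

Definition commutator (R : realType) (n : nat) (X Y : 'M[R[i]]_n) :
    'M[R[i]]_n :=
  X *m Y - Y *m X.

Definition skew_hermitian (R : realType) (n : nat) (X : 'M[R[i]]_n) : Prop :=
  X ^t* = - X.

(* Every tangent vector [v] of a conjugation orbit at [h] is a commutator
   [X, h]; the default value 0 is irrelevant. *)
Definition generator (R : realType) (n : nat) (h v : 'M[R[i]]_n) : 'M[R[i]]_n :=
  xget 0 [set X | skew_hermitian X /\ commutator X h = v].

(* The Kirillov-Kostant-Souriau form; [kksE] shows that it does not depend on
   the chosen generators of the tangent vectors. *)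
Definition kks (R : realType) (n : nat) (h v w : 'M[R[i]]_n) : R[i] :=
  \tr ('i%C *: (h *m commutator (generator h v) (generator h w))).

Lemma mxtraceB (R : pzRingType) (n : nat) (A B : 'M[R]_n) :
  \tr (A - B) = \tr A - \tr B.
Proof. exact: raddfB. Qed.

Lemma kksE (R : realType) (n : nat) (h X Y : 'M[R[i]]_n) :
  skew_hermitian X -> skew_hermitian Y ->
  kks h (commutator X h) (commutator Y h) =
  \tr ('i%C *: (h *m commutator X Y)).
Proof.
move=> sX sY; rewrite /kks !linearZ /=; congr (_ * _).
have gP Z : skew_hermitian Z ->
    commutator (generator h (commutator Z h)) h = commutator Z h.
  by move=> sZ; rewrite /generator; case: xgetP => [X' -> []|/(_ Z)[]].
have trl A B : \tr (h *m commutator A B) = - \tr (commutator A h *m B).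
  rewrite /commutator mulmxBr mulmxBl !mxtraceB opprB !mulmxA.
  by rewrite [\tr (h *m B *m A)]mxtrace_mulC !mulmxA.
have trr A B : \tr (h *m commutator A B) = \tr (commutator B h *m A).
  rewrite /commutator mulmxBr mulmxBl !mxtraceB !mulmxA.
  by rewrite [\tr (h *m A *m B)]mxtrace_mulC !mulmxA.
by rewrite trl gP // -trl trr gP // -trr.
Qed.

Definition isotropic (R : realType) (n : nat) (S : set 'M[R[i]]_n) : Prop :=
  forall h v w, S h ->
    tangent (@mx_coord R n @` S) (mx_coord h) (mx_coord v) ->
    tangent (@mx_coord R n @` S) (mx_coord h) (mx_coord w) ->
    kks h v w = 0.

(* Indices start from 0: [gc_entry i j] is the (i+1)-st largest eigenvalue of
   the leading principal submatrix of size i+j+1. *)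
Definition gc_entry (R : realType) (n i j : nat) (x : 'M[R[i]]_n) : R :=
  nth 0 (eigenvalues (leading (i + j).+1 x)) i.

Definition gc_index (R : realType) (n : nat) (lam : 'I_n -> R) :
    {set 'I_n * 'I_n} :=
  [set ij : 'I_n * 'I_n | (ij.1 + ij.2 < n)%N &&
     ~~ `[< exists c, forall x, coadjoint_orbit lam x ->
              gc_entry ij.1 ij.2 x = c >] ]%SET.

Definition gc_system (R : realType) (n : nat) (lam : 'I_n -> R)
    (x : 'M[R[i]]_n) : 'rV[R]_#|gc_index lam| :=
  \row_k (let ij := enum_val (k : 'I_#|gc_index lam|) in gc_entry ij.1 ij.2 x).

Definition gc_polytope (R : realType) (n : nat) (lam : 'I_n -> R) :
    set 'rV[R]_#|gc_index lam| :=
  gc_system lam @` coadjoint_orbit lam.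
Arguments gc_polytope {R n} lam.

Definition gc_fiber (R : realType) (n : nat) (lam : 'I_n -> R)
    (u : 'rV[R]_#|gc_index lam|) : set 'M[R[i]]_n :=
  coadjoint_orbit lam `&` gc_system lam @^-1` [set u].
Arguments gc_fiber {R n} lam u.

(* Main.v *)
(* A Gelfand-Cetlin fiber is the set of Hermitian matrices whose leading principal
   submatrices x_1, x_2, ... all have prescribed spectra.  Write x_(k+1) as x_k
   bordered by a column b and a corner c.  Comparing the characteristic polynomials
   through partial fractions, prescribing the spectrum of x_(k+1) fixes c and the
   squared norms of the projections of b to the eigenspaces of x_k.  Hence the
   (k+1)-st level fibers over the k-th one, with fiber the product of the spheres of
   these radii in the eigenspaces, and the bundle is trivialized locally by unitaries
   intertwining the spectral projections of x_k with those of a base point.  All maps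
   involved are compositions of field operations and square roots.

   The vanishing of a squared norm is read off from multiplicities, that is, from
   which interlacing inequalities are equalities.  On the relative interior of a face
   these are the same, so that rescaling the projections of b level by level, while
   carrying along an intertwining unitary, maps one fiber onto the other.

   Along a curve in a fiber the spectral projections of x_k are rotated by a
   skew-Hermitian matrix and the squared norms above are constant; isotropy follows
   by induction on k.  Charts of the orbit come from block LU coordinates of the flag
   of sums of eigenspaces. *)
From HB Require Import structures.
From mathcomp Require Import all_boot all_order all_algebra.
From mathcomp Require Import fingroup perm spectral sesquilinear complex.
From mathcomp Require Import boolp classical_sets functions reals.
From mathcomp Require Import topology normedtype derive realfun.
Require Import Defs.

Set Implicit Arguments.
Unset Strict Implicit.
Unset Printing Implicit Defensive.

Import Order.TTheory GRing.Theory Num.Theory.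
Import numFieldNormedType.Exports.

Local Open Scope classical_set_scope.
Local Open Scope ring_scope.
Local Open Scope sesquilinear_scope.

(** * Maps that are locally compositions of field operations and square roots *)

(** Two obstacles shape the proof. Smoothness is a condition on iterated directional derivatives,
    and composition would need a chain rule of every order. Terms avoid it, since composing terms is
    substitution. The price is that every map needs a formula near each point. Eigenvectors of a
    varying matrix have none, so the maps use spectral projections, which are polynomials in the
    matrix. The second obstacle is that changing the eigenvalues of x_k also moves the eigenspaces
    of x_(k+1), so levels cannot be treated separately. But the eigenspace of x_(k+1) at mu is
    explicit: its vectors with last coordinate 0 are the eigenvectors of x_k at mu orthogonal to b,
    and the rest is at most a line, spanned by the projection of the last basis vector e. On the
    former a unitary is known from level k; on the line, e itself fixes length and phase. This gives
    the unitary of the next level without any choice ([glue]). The same splitting, read on traces,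
    expresses the vanishing of the squared norms by multiplicities. *)

(* The directional derivatives of a term are terms with a no smaller domain, so
   terms are smooth where no denominator or radicand vanishes. *)
Inductive term (R : Type) (m : nat) :=
| Cst of R
| Var of 'I_m
| Add of term R m & term R m
| Mul of term R m & term R m
| Inv of term R m
| Sqrt of term R m.

Section TermDef.
Variables (R : realType) (m : nat).
Implicit Types (t : term R m) (x v : 'rV[R]_m).

Fixpoint ev t x : R :=
  match t with
  | Cst c => c
  | Var i => x 0 i
  | Add s t => ev s x + ev t x
  | Mul s t => ev s x * ev t x
  | Inv t => (ev t x)^-1
  | Sqrt t => Num.sqrt (ev t x)
  end.

Fixpoint dom t x : Prop :=
  match t with
  | Cst _ | Var _ => True
  | Add s t | Mul s t => dom s x /\ dom t x
  | Inv t => dom t x /\ ev t x != 0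
  | Sqrt t => dom t x /\ 0 < ev t x
  end.

Fixpoint dterm v t : term R m :=
  match t with
  | Cst _ => Cst m 0
  | Var i => Cst m (v 0 i)
  | Add s t => Add (dterm v s) (dterm v t)
  | Mul s t => Add (Mul s (dterm v t)) (Mul t (dterm v s))
  | Inv t => Mul (Mul (Cst m (-1)) (Mul (Inv t) (Inv t))) (dterm v t)
  | Sqrt t => Mul (Inv (Mul (Cst m 2) (Sqrt t))) (dterm v t)
  end.

Lemma dom_dterm v t x : dom t x -> dom (dterm v t) x.
Proof.
elim: t => [c|i|s IHs t IHt|s IHs t IHt|t IHt|t IHt] //=.
- by case=> /IHs ? /IHt.
- by case=> hs ht; split; split=> //; [exact: IHt | exact: IHs].
- by case=> ht t0; split; [|exact: IHt].
- case=> ht t0; split; [split|exact: IHt] => //.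
  by rewrite mulf_neq0// gt_eqF// sqrtr_gt0.
Qed.

Lemma ev_continuous t x : dom t x -> {for x, continuous (ev t)}.
Proof.
elim: t => [c|i|s IHs t IHt|s IHs t IHt|t IHt|t IHt] /=.
- by move=> _; apply: cst_continuous.
- by move=> _; exact: coord_continuous.
- by case=> hs ht; apply: continuousD; [exact: IHs | exact: IHt].
- by case=> hs ht; apply: continuousM; [exact: IHs | exact: IHt].
- by case=> ht t0; apply: (continuousV t0); exact: IHt.
- case=> ht t0; apply: (continuous_comp (f := ev t)); first exact: IHt.
  exact: sqrt_continuous.
Qed.

Lemma is_derive_sqrt_comp (f : 'rV[R]_m -> R) x v df : 0 < f x ->
  is_derive x v f df ->
  is_derive x v (fun y => Num.sqrt (f y)) ((2 * Num.sqrt (f x))^-1 * df).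
Proof.
move=> f0 [dfx <-].
(* On the line through [x] in direction [v] the one-variable chain rule applies. *)
pose g (h : R) := f (h *: v + x).
have dg : is_derive (0 : R) 1 g ('D_v f x).
  apply: DeriveDef; first by move/derivable1P : dfx.
  rewrite /derive; set g1 := fun h => h^-1 *: _; set g2 := fun h => h^-1 *: _.
  suff -> : g1 = g2 by [].
  by apply/funext => h; rewrite /g1 /g2 /g /= scale0r add0r addr0 [_%:A]mulr1.
have g0 : g 0 = f x by rewrite /g scale0r add0r.
have dsg : is_derive (0 : R) 1 (Num.sqrt \o g)
    ((2 * Num.sqrt (f x))^-1 * 'D_v f x).
  rewrite -g0; apply: is_derive1_comp.
  by apply: is_derive1_sqrt; rewrite g0.
have [dsg1 dsg2] := dsg.
apply: DeriveDef; first by apply/derivable1P.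
rewrite -dsg2 /derive; set g1 := fun h => h^-1 *: _; set g2 := fun h => h^-1 *: _.
suff -> : g1 = g2 by [].
by apply/funext => h; rewrite /g1 /g2 /g /= scale0r add0r addr0 [_%:A]mulr1.
Qed.

Lemma is_derive_ev t x v : dom t x ->
  is_derive x v (ev t) (ev (dterm v t) x).
Proof.
elim: t => [c|i|s IHs t IHt|s IHs t IHt|t IHt|t IHt] /=.
- by move=> _; exact: is_derive_cst.
- move=> _.
  have h0 : (fun h : R => h^-1 *: ((h *: v + x) 0 i - x 0 i)) @ 0^' -->
      (v 0 i).
    apply: (@cvg_trans _ (((fun=> v 0 i) : R -> R) @ 0^')); last exact: cvg_cst.
    apply: near_eq_cvg; near=> h.
    rewrite !mxE addrK [_ *: _]mulrA mulVf ?mul1r//.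
    by near: h; exact: nbhs_dnbhs_neq.
  apply: DeriveDef; first by apply/cvg_ex; exists (v 0 i).
  exact: cvg_lim h0.
- by case=> hs ht; apply: is_deriveD; [exact: IHs | exact: IHt].
- by case=> hs ht; apply: is_deriveM; [exact: IHs | exact: IHt].
- case=> ht t0; have [dt et] := IHt ht; apply: DeriveDef.
    exact: derivableV.
  rewrite deriveV// et; congr (_ * _).
  by rewrite mulN1r -invfM expr2.
- by case=> ht t0; apply: is_derive_sqrt_comp => //; exact: IHt.
Unshelve. all: by end_near. Qed.

Lemma near_gt0 (f : 'rV[R]_m -> R) x : {for x, continuous f} -> 0 < f x ->
  \forall y \near x, 0 < f y.
Proof.
move=> fx f0; have h : nbhs (f x) [set y | y > 0].
  by apply: open_nbhs_nbhs; split=> //; exact: open_gt.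
exact: (fx _ h).
Qed.

Lemma near_neq0 (f : 'rV[R]_m -> R) x : {for x, continuous f} -> f x != 0 ->
  \forall y \near x, f y != 0.
Proof.
move=> fx f0; have h : nbhs (f x) [set y | y != 0].
  by apply: open_nbhs_nbhs; split=> //; exact: open_neq.
exact: (fx _ h).
Qed.

Lemma near_dom t x : dom t x -> \forall y \near x, dom t y.
Proof.
elim: t => [c|i|s IHs t IHt|s IHs t IHt|t IHt|t IHt] /=.
1,2: by move=> _; exact: filterT.
1,2: by case=> /IHs hs /IHt ht; exact: filterI.
- case=> ht t0; have c := ev_continuous ht.
  by apply: filterI; [exact: IHt | exact: near_neq0].
- case=> ht t0; have c := ev_continuous ht.
  by apply: filterI; [exact: IHt | exact: near_gt0].
Unshelve. all: by end_near. Qed.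

End TermDef.

Section Substitution.
Variables (R : realType) (m n : nat).

Fixpoint subst (ts : 'I_n -> term R m) (t : term R n) : term R m :=
  match t with
  | Cst c => Cst m c
  | Var i => ts i
  | Add s t => Add (subst ts s) (subst ts t)
  | Mul s t => Mul (subst ts s) (subst ts t)
  | Inv t => Inv (subst ts t)
  | Sqrt t => Sqrt (subst ts t)
  end.

Lemma ev_subst ts t x : ev (subst ts t) x = ev t (\row_i ev (ts i) x).
Proof.
elim: t => [c|i|s IHs t IHt|s IHs t IHt|t IHt|t IHt] //=.
- by rewrite mxE.
- by rewrite IHs IHt.
- by rewrite IHs IHt.
- by rewrite IHt.
- by rewrite IHt.
Qed.

Lemma dom_subst ts t x : (forall i, dom (ts i) x) ->
  dom t (\row_i ev (ts i) x) -> dom (subst ts t) x.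
Proof.
move=> hts; elim: t => [c|i|s IHs t IHt|s IHs t IHt|t IHt|t IHt] //=.
- by case=> /IHs ? /IHt.
- by case=> /IHs ? /IHt.
- by rewrite ev_subst => -[/IHt].
- by rewrite ev_subst => -[/IHt].
Qed.

Lemma row_continuous (x : 'rV[R]_m) (f : 'rV[R]_m -> 'rV[R]_n) :
  (forall j, {for x, continuous (fun y => f y 0 j)}) ->
  {for x, continuous f}.
Proof.
move=> fx; have FF := nbhs_filter x; apply/cvgrPdist_le => e e0.
have fj j : \forall y \near x, `|f x 0 j - f y 0 j| <= e.
  by have /cvgrPdist_le/(_ e e0) := fx j.
apply: filterS (filter_forall FF fj) => y fy.
rewrite [leLHS]/Num.Def.normr/= mx_normrE (bigmax_le _ (ltW e0))// => -[i j] _.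
by rewrite !mxE/= ord1.
Qed.

(** Induction on [k] closes because the derivative along [v] is again a row of terms,
    [dterm v (ts j)], defined on all of [U] by [dom_dterm]. *)
Lemma Ck_on_ev k (U : set 'rV[R]_m) (ts : 'I_n -> term R m)
    (f : 'rV[R]_m -> 'rV[R]_n) : open U ->
  (forall x j, U x -> dom (ts j) x) ->
  (forall x j, U x -> f x 0 j = ev (ts j) x) -> Ck_on k U f.
Proof.
move=> oU; elim: k ts f => [|k IHk] ts f dts fts.
all: have nU x : U x -> \forall y \near x, U y by move=> Ux; apply: open_nbhs_nbhs; split.
all: have cf x : U x -> {for x, continuous f}.
1,3: move=> Ux; apply: row_continuous => j.
1,2: have h : ev (ts j) @ x --> f x 0 j by rewrite fts//; exact/ev_continuous/dts.
1,2: move=> A /h hA; apply: filterS2 (nU x Ux) hA => y Uy.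
1,2: by rewrite /= fts.
- by split.
- have df x v : U x -> forall j,
      is_derive x v (fun y => f y 0 j) (ev (dterm v (ts j)) x).
    move=> Ux j; apply: near_eq_is_derive (is_derive_ev v (dts x j Ux)).
    by near do apply/esym/fts; exact: nU.
  have dfm x v : U x -> derivable f x v.
    by move=> Ux; apply/derivable_mxP => i j; rewrite ord1; case: (df x v Ux j).
  split=> // v; split=> [x Ux|]; first exact: dfm.
  apply: (IHk (fun j => dterm v (ts j))) => x j Ux; first exact/dom_dterm/dts.
  by rewrite derive_mx ?mxE; [case: (df x v Ux j)|exact: dfm].
Unshelve. all: by end_near. Qed.

End Substitution.

Section ElementaryMaps.
Variable R : realType.
Implicit Types m n p : nat.

(** The term may depend on [x], and it represents [f] only on [A] near [x]. Quantities that are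
    constant on [A], such as weights on a fiber, may thus enter as constants. *)
Definition esm m (A : set 'rV[R]_m) (x : 'rV[R]_m) (f : 'rV[R]_m -> R) : Prop :=
  exists t : term R m, dom t x /\ \forall y \near x, A y -> f y = ev t y.

Definition emap m n (A : set 'rV[R]_m) (f : 'rV[R]_m -> 'rV[R]_n) : Prop :=
  forall x, A x -> forall j, esm A x (fun y => f y 0 j).

Lemma emap_terms m n (A : set 'rV[R]_m) (f : 'rV[R]_m -> 'rV[R]_n) x :
  emap A f -> A x -> exists ts : 'I_n -> term R m,
    (forall j, dom (ts j) x) /\
    \forall y \near x, A y -> f y = \row_j ev (ts j) y.
Proof.
move=> ef Ax; have /choice[ts tsP] := ef x Ax.
exists ts; split=> [j|]; first by case: (tsP j).
have tsj j : \forall y \near x, A y -> f y 0 j = ev (ts j) y.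
  by case: (tsP j).
apply: filterS (filter_forall (nbhs_filter x) tsj) => y fy Ay.
by apply/rowP => j; rewrite mxE fy.
Qed.

Lemma emap_smooth m n (A : set 'rV[R]_m) (f : 'rV[R]_m -> 'rV[R]_n) :
  emap A f -> smooth_map A f.
Proof.
move=> ef x Ax; have [ts [dts fts]] := emap_terms ef Ax.
pose N := [set y | (A y -> f y = \row_j ev (ts j) y) /\ forall j, dom (ts j) y].
exists N^°, (fun y => \row_j ev (ts j) y); split.
- exact: open_interior.
- apply: filterI => //.
  exact: (filter_forall (nbhs_filter x) (fun j => near_dom (dts j))).
- move=> k; apply: (@Ck_on_ev R m n k _ ts); first exact: open_interior.
    by move=> y j /interior_subset[].
  by move=> y j _; rewrite mxE.
- by move=> y Ay /interior_subset[-> ].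
Qed.

(** [f] need not be continuous off [A]; continuity comes from the terms that agree with it on [A]
    near a point. *)
Lemma emap_rel_open m n (A : set 'rV[R]_m) (f : 'rV[R]_m -> 'rV[R]_n)
    (V : set 'rV[R]_n) : emap A f -> open V ->
  exists O, open O /\ forall x, A x -> (O x <-> V (f x)).
Proof.
move=> ef oV; pose N := [set y | A y -> V (f y)].
exists N^°; split; first exact: open_interior.
move=> x Ax; split=> [/interior_subset/(_ Ax)//|Vfx].
have [ts [dts fts]] := emap_terms ef Ax.
have cg : {for x, continuous (fun y => \row_j ev (ts j) y)}.
  apply: row_continuous => j.
  under [X in {for x, continuous X}]eq_fun do rewrite mxE.
  exact: ev_continuous.
have fx : f x = \row_j ev (ts j) x by exact: (nbhs_singleton fts).
have hV : nbhs (\row_j ev (ts j) x) V.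
  by rewrite -fx; apply: open_nbhs_nbhs.
apply: filterS2 fts (cg _ hV) => y fy Vy Ay.
by rewrite fy.
Qed.

Lemma esm_sub m (A B : set 'rV[R]_m) x f : A `<=` B -> esm B x f -> esm A x f.
Proof.
move=> AB [t [dt ft]]; exists t; split=> //.
by apply: filterS ft => y fy /AB.
Qed.

Lemma esm_ext m (A : set 'rV[R]_m) x f g :
  (forall y, A y -> f y = g y) -> esm A x f -> esm A x g.
Proof.
move=> fg [t [dt ft]]; exists t; split=> //.
by apply: filterS ft => y fy Ay; rewrite -fg ?fy.
Qed.

Lemma esm_comp m n (A : set 'rV[R]_m) (B : set 'rV[R]_n) f g x :
  emap A f -> (forall y, A y -> B (f y)) -> A x -> esm B (f x) g ->
  esm A x (fun y => g (f y)).
Proof.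
move=> ef AB Ax [t [dt gt]].
have [ts [dts fts]] := emap_terms ef Ax.
have fx : f x = \row_j ev (ts j) x by exact: (nbhs_singleton fts).
exists (subst ts t); split; first by apply: dom_subst => //; rewrite -fx.
have cg : {for x, continuous (fun y => \row_j ev (ts j) y)}.
  apply: row_continuous => j.
  under [X in {for x, continuous X}]eq_fun do rewrite mxE.
  exact: ev_continuous.
rewrite fx in gt; apply: filterS2 fts (cg _ gt) => y fy /= gy Ay.
by rewrite ev_subst -gy -?fy//; exact: AB.
Qed.

Lemma emap_comp m n p (A : set 'rV[R]_m) (B : set 'rV[R]_n) f
    (g : 'rV[R]_n -> 'rV[R]_p) :
  emap A f -> (forall y, A y -> B (f y)) -> emap B g -> emap A (fun y => g (f y)).
Proof. by move=> ef AB eg x Ax j; exact: (esm_comp ef AB Ax (eg _ (AB _ Ax) j)). Qed.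

Lemma emap_sub m n (A B : set 'rV[R]_m) (f : 'rV[R]_m -> 'rV[R]_n) :
  A `<=` B -> emap B f -> emap A f.
Proof. by move=> AB ef x /AB Bx j; apply: esm_sub AB _; exact: ef. Qed.

Lemma esm_cst m (A : set 'rV[R]_m) x c : esm A x (fun=> c).
Proof. by exists (Cst m c); split=> //; apply: filterS filterT. Qed.

Lemma esm_coord m (A : set 'rV[R]_m) x i : esm A x (fun y => y 0 i).
Proof. by exists (Var R i); split=> //; apply: filterS filterT. Qed.

Lemma esmD m (A : set 'rV[R]_m) x f g : esm A x f -> esm A x g ->
  esm A x (fun y => f y + g y).
Proof.
move=> [s [ds fs]] [t [dt gt]]; exists (Add s t); split=> //.
by apply: filterS2 fs gt => y fy gy Ay; rewrite fy ?gy.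
Qed.

Lemma esmM m (A : set 'rV[R]_m) x f g : esm A x f -> esm A x g ->
  esm A x (fun y => f y * g y).
Proof.
move=> [s [ds fs]] [t [dt gt]]; exists (Mul s t); split=> //.
by apply: filterS2 fs gt => y fy gy Ay; rewrite fy ?gy.
Qed.

Lemma esmN m (A : set 'rV[R]_m) x f : esm A x f -> esm A x (fun y => - f y).
Proof.
move=> ef; apply: esm_ext (esmM (esm_cst A x (-1)) ef) => y _.
by rewrite mulN1r.
Qed.

Lemma esmB m (A : set 'rV[R]_m) x f g : esm A x f -> esm A x g ->
  esm A x (fun y => f y - g y).
Proof. by move=> ef eg; apply: esmD => //; exact: esmN. Qed.

Lemma esmV m (A : set 'rV[R]_m) x f : A x -> f x != 0 -> esm A x f ->
  esm A x (fun y => (f y)^-1).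
Proof.
move=> Ax fx0 [t [dt ft]]; exists (Inv t); split.
  by split=> //; rewrite -(nbhs_singleton ft).
by apply: filterS ft => y fy Ay; rewrite fy.
Qed.

Lemma esm_sqrt m (A : set 'rV[R]_m) x f : A x -> 0 < f x -> esm A x f ->
  esm A x (fun y => Num.sqrt (f y)).
Proof.
move=> Ax fx0 [t [dt ft]]; exists (Sqrt t); split.
  by split=> //; rewrite -(nbhs_singleton ft).
by apply: filterS ft => y fy Ay; rewrite fy.
Qed.

Lemma esm_sum m (A : set 'rV[R]_m) x (I : Type) (r : seq I) (P : pred I)
    (F : I -> 'rV[R]_m -> R) :
  (forall i, P i -> esm A x (F i)) -> esm A x (fun y => \sum_(i <- r | P i) F i y).
Proof.
move=> eF; elim: r => [|i r IHr].
  by apply: esm_ext (esm_cst A x 0) => y _; rewrite big_nil.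
case: (boolP (P i)) => Pi.
  by apply: esm_ext (esmD (eF i Pi) IHr) => y _; rewrite big_cons Pi.
by apply: esm_ext IHr => y _; rewrite big_cons (negPf Pi).
Qed.

Lemma emap_id m (A : set 'rV[R]_m) : emap A id.
Proof. by move=> x _ j; exact: esm_coord. Qed.

Lemma emap_row_mx m n p (A : set 'rV[R]_m) (f : 'rV[R]_m -> 'rV[R]_n)
    (g : 'rV[R]_m -> 'rV[R]_p) :
  emap A f -> emap A g -> emap A (fun y => row_mx (f y) (g y)).
Proof.
move=> ef eg x Ax j; case: (split_ordP j) => k ->.
  by apply: esm_ext (ef x Ax k) => y _; rewrite row_mxEl.
by apply: esm_ext (eg x Ax k) => y _; rewrite row_mxEr.
Qed.

Lemma emap_lsubmx m n (A : set 'rV[R]_(m + n)) : emap A (@lsubmx R 1 m n).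
Proof.
by move=> x Ax j; apply: esm_ext (esm_coord A x (lshift n j)) => y _; rewrite mxE.
Qed.

Lemma emap_rsubmx m n (A : set 'rV[R]_(m + n)) : emap A (@rsubmx R 1 m n).
Proof.
by move=> x Ax j; apply: esm_ext (esm_coord A x (rshift m j)) => y _; rewrite mxE.
Qed.

Lemma open_esm_neq0 m (f : 'rV[R]_m -> R) :
  (forall x, esm setT x f) -> open [set x | f x != 0].
Proof.
move=> ef; rewrite openE => x /= fx0.
have [t [dt ft]] := ef x.
have tx0 : ev t x != 0 by rewrite -(nbhs_singleton ft).
by apply: filterS2 ft (near_neq0 (ev_continuous dt) tx0) => y /(_ I) ft0; rewrite /= ft0.
Qed.

(** * Elementary diffeomorphisms and charts *)

Definition ediff m n (A : set 'rV[R]_m) (B : set 'rV[R]_n) f g : Prop :=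
  [/\ emap A f, emap B g, forall x, A x -> B (f x) /\ g (f x) = x
    & forall y, B y -> A (g y) /\ f (g y) = y].

Lemma ediff_diffeo m n (A : set 'rV[R]_m) (B : set 'rV[R]_n) f g :
  ediff A B f g -> diffeo_pair A B f g.
Proof. by case=> ef eg fP gP; split=> //; exact: emap_smooth. Qed.

Lemma ediff_sym m n (A : set 'rV[R]_m) (B : set 'rV[R]_n) f g :
  ediff A B f g -> ediff B A g f.
Proof. by case. Qed.

Lemma ediff_comp m n p (A : set 'rV[R]_m) (B : set 'rV[R]_n) (C : set 'rV[R]_p)
    f g f' g' :
  ediff A B f g -> ediff B C f' g' ->
  ediff A C (fun x => f' (f x)) (fun x => g (g' x)).
Proof.
move=> [ef eg fP gP] [ef' eg' fP' gP']; split.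
- by apply: emap_comp ef _ ef' => y /fP[].
- by apply: emap_comp eg' _ eg => y /gP'[].
- by move=> x Ax; case: (fP x Ax) => /fP'[? ->] ->.
- by move=> x Cx; case: (gP' x Cx) => /gP[? ->] ->.
Qed.

Lemma ediff_restr m n (A : set 'rV[R]_m) (B : set 'rV[R]_n) f g V :
  ediff A B f g -> open V ->
  exists O, [/\ open O, forall x, A x -> (O x <-> V (f x))
    & ediff (A `&` O) (B `&` V) f g].
Proof.
case=> ef eg fP gP oV; have [O [oO OP]] := emap_rel_open ef oV.
exists O; split=> //; split.
- exact: (emap_sub (@subIsetl _ _ _)).
- exact: (emap_sub (@subIsetl _ _ _)).
- by move=> x [Ax /(OP x Ax) Vfx]; case: (fP x Ax).
- move=> y [By Vy]; case: (gP y By) => Agy fgy; split=> //; split=> //.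
  by apply/OP => //; rewrite fgy.
Qed.

Definition chart m d (S : set 'rV[R]_m) (x : 'rV[R]_m) : Prop :=
  exists (U : set 'rV[R]_m) (W : set 'rV[R]_d) f g,
    [/\ open U, U x, open W & ediff (S `&` U) W f g].

Definition emanifold m (S : set 'rV[R]_m) : Prop :=
  exists d, forall x, S x -> chart d S x.

Lemma emanifold_manifold m (S : set 'rV[R]_m) : emanifold S -> manifold S.
Proof.
case=> d h; exists d => x /h[U [W [f [g [oU Ux oW fg]]]]].
by exists U, W; split=> //; exists f, g; exact: ediff_diffeo.
Qed.

Lemma chart_ediff m n d (A U : set 'rV[R]_m) (B V : set 'rV[R]_n) f g x :
  open U -> A x -> U x -> open V -> ediff (A `&` U) (B `&` V) f g ->
  chart d B (f x) -> chart d A x.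
Proof.
move=> oU Ax Ux oV fg [U' [W [f' [g' [oU' U'fx oW fg']]]]].
have [O [oO OP fgO]] := ediff_restr fg oU'.
have [O' [oO' OP' fgO']] := ediff_restr (ediff_sym fg') oV.
have Ox : O x by apply/OP.
exists (U `&` O), (W `&` O'), (fun x => f' (f x)), (fun x => g (g' x)).
split=> //; [exact: openI|exact: openI|].
rewrite setIA; apply: ediff_comp fgO _.
by rewrite setIAC; exact: ediff_sym.
Qed.

Definition prodset m n (A : set 'rV[R]_m) (B : set 'rV[R]_n) :
    set 'rV[R]_(m + n) := [set z | A (lsubmx z) /\ B (rsubmx z)].

Lemma ediff_prod m n m' n' (A : set 'rV[R]_m) (B : set 'rV[R]_n)
    (A' : set 'rV[R]_m') (B' : set 'rV[R]_n') f g f' g' :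
  ediff A A' f g -> ediff B B' f' g' ->
  ediff (prodset A B) (prodset A' B')
    (fun z => row_mx (f (lsubmx z)) (f' (rsubmx z)))
    (fun z => row_mx (g (lsubmx z)) (g' (rsubmx z))).
Proof.
move=> [ef eg fP gP] [ef' eg' fP' gP']; split.
- apply: emap_row_mx.
    by apply: emap_comp (@emap_lsubmx _ _ _) _ ef => y [].
  by apply: emap_comp (@emap_rsubmx _ _ _) _ ef' => y [].
- apply: emap_row_mx.
    by apply: emap_comp (@emap_lsubmx _ _ _) _ eg => y [].
  by apply: emap_comp (@emap_rsubmx _ _ _) _ eg' => y [].
- move=> z [/fP[Az fz] /fP'[Bz gz]].
  by rewrite /prodset /= row_mxKl row_mxKr fz gz hsubmxK.
- move=> z [/gP[Az fz] /gP'[Bz gz]].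
  by rewrite /prodset /= row_mxKl row_mxKr fz gz hsubmxK.
Qed.

Lemma open_prodset m n (A : set 'rV[R]_m) (B : set 'rV[R]_n) :
  open A -> open B -> open (prodset A B).
Proof.
move=> oA oB.
have [O [oO OP]] := emap_rel_open (@emap_lsubmx m n setT) oA.
have [O' [oO' OP']] := emap_rel_open (@emap_rsubmx m n setT) oB.
rewrite (_ : prodset A B = O `&` O'); first exact: openI.
by apply/seteqP; split=> z [] => [/(OP z I) ? /(OP' z I)|/(OP z I) ? /(OP' z I)].
Qed.

Lemma prodsetI m n (A A' : set 'rV[R]_m) (B B' : set 'rV[R]_n) :
  prodset A B `&` prodset A' B' = prodset (A `&` A') (B `&` B').
Proof. by apply/seteqP; split=> z [[? ?] [? ?]]. Qed.

Lemma emanifold_prod m n (A : set 'rV[R]_m) (B : set 'rV[R]_n) :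
  emanifold A -> emanifold B -> emanifold (prodset A B).
Proof.
move=> [d Ad] [e Be]; exists (d + e)%N => z [Az Bz].
have [U [W [f [g [oU Uz oW fg]]]]] := Ad _ Az.
have [U' [W' [f' [g' [oU' Uz' oW' fg']]]]] := Be _ Bz.
exists (prodset U U'), (prodset W W').
have := ediff_prod fg fg'; rewrite -prodsetI => h.
by do 2 eexists; split; [exact: open_prodset| |exact: open_prodset|exact: h].
Qed.

Lemma emanifold_point m (x : 'rV[R]_m) : emanifold [set x].
Proof.
exists 0%N => _ ->; exists setT, setT, (fun=> 0), (fun=> x).
split=> //; try exact: openT.
split=> //.
- by move=> y _ j; apply: esm_ext (esm_cst _ _ 0) => z _; rewrite mxE.
- by move=> y _ j; exact: esm_cst.
- by move=> y [-> _].
- by move=> y _; split=> //; apply/rowP; case.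
Qed.

End ElementaryMaps.
(** * Spectral projections of Hermitian matrices *)

Section Adjoint.
Variable C : numClosedFieldType.
Implicit Types m n p : nat.

Lemma adjM m n p (A : 'M[C]_(m, n)) (B : 'M[C]_(n, p)) :
  (A *m B)^t* = B^t* *m A^t*.
Proof. by rewrite trmx_mul map_mxM. Qed.

Lemma adjD m n (A B : 'M[C]_(m, n)) : (A + B)^t* = A^t* + B^t*.
Proof. by apply/matrixP => i j; rewrite !mxE rmorphD. Qed.

Lemma adjN m n (A : 'M[C]_(m, n)) : (- A)^t* = - A^t*.
Proof. by apply/matrixP => i j; rewrite !mxE rmorphN. Qed.

Lemma adjB m n (A B : 'M[C]_(m, n)) : (A - B)^t* = A^t* - B^t*.
Proof. by rewrite adjD adjN. Qed.

Lemma adjZ m n a (A : 'M[C]_(m, n)) : (a *: A)^t* = a^* *: A^t*.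
Proof. by apply/matrixP => i j; rewrite !mxE rmorphM. Qed.

Lemma adj0 m n : (0 : 'M[C]_(m, n))^t* = 0.
Proof. by apply/matrixP => i j; rewrite !mxE rmorph0. Qed.

Lemma adj_scalar m a : (a%:M : 'M[C]_m)^t* = (a^*)%:M.
Proof. by apply/matrixP => i j; rewrite !mxE rmorphMn eq_sym. Qed.

Lemma adj1 m : (1%:M : 'M[C]_m)^t* = 1%:M.
Proof. by rewrite adj_scalar rmorph1. Qed.

Lemma adj_sum m n (I : Type) (r : seq I) (P : pred I) (F : I -> 'M[C]_(m, n)) :
  (\sum_(i <- r | P i) F i)^t* = \sum_(i <- r | P i) (F i)^t*.
Proof.
elim: r => [|i r IHr]; first by rewrite !big_nil adj0.
by rewrite !big_cons; case: ifP => // _; rewrite adjD IHr.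
Qed.

Lemma adj_block m n p q (A : 'M[C]_(m, n)) (B : 'M[C]_(m, p))
    (D : 'M[C]_(q, n)) (E : 'M[C]_(q, p)) :
  (block_mx A B D E)^t* = block_mx (A^t*) (D^t*) (B^t*) (E^t*).
Proof. by rewrite tr_block_mx map_block_mx. Qed.

Lemma hermsymmxP m (A : 'M[C]_m) : (A \is hermsymmx) <-> A^t* = A.
Proof.
split=> [/is_hermitianmxP|h]; first by rewrite expr0 scale1r => <-.
by apply/is_hermitianmxP; rewrite expr0 scale1r h.
Qed.

Lemma unitary_adjl m (Q : 'M[C]_m) : Q \is unitarymx -> Q^t* *m Q = 1%:M.
Proof. by move=> uQ; apply: mulmx1C; exact/unitarymxP. Qed.

Lemma sqr_norm_ge0 m (v : 'cV[C]_m) : 0 <= (v^t* *m v) 0 0.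
Proof.
rewrite mxE sumr_ge0// => i _; rewrite !mxE mulrC; exact: mul_conjC_ge0.
Qed.

Lemma sqr_norm_eq0 m (v : 'cV[C]_m) : (v^t* *m v) 0 0 = 0 -> v = 0.
Proof.
rewrite mxE => /eqP; rewrite psumr_eq0 => [|i _]; last first.
  by rewrite !mxE mulrC mul_conjC_ge0.
move=> /allP h; apply/colP => i; rewrite mxE; apply/eqP.
by have := h i (mem_index_enum _); rewrite !mxE mulrC mul_conjC_eq0.
Qed.

Lemma char_poly_similar m (P Q A : 'M[C]_m) : P *m Q = 1%:M ->
  char_poly (P *m A *m Q) = char_poly A.
Proof.
move=> PQ.
have PQX : map_mx polyC P *m map_mx polyC Q = 1%:M.
  by rewrite -map_mxM PQ map_mx1.
rewrite /char_poly.
have -> : char_poly_mx (P *m A *m Q) =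
    map_mx polyC P *m char_poly_mx A *m map_mx polyC Q.
  rewrite /char_poly_mx mulmxBr mulmxBl -!map_mxM; congr (_ - _).
  by rewrite scalar_mxC -mulmxA PQX mulmx1.
rewrite !det_mulmx mulrAC -det_mulmx PQX det1 mul1r //.
Qed.

Lemma horner_char_poly m (A : 'M[C]_m) t : (char_poly A).[t] = \det (t%:M - A).
Proof.
rewrite /char_poly -[_.[t]]/(horner_eval t _) -det_map_mx; congr (\det _).
apply/matrixP => i j; rewrite !mxE /=.
by rewrite -[LHS]/(_.[t]) hornerD hornerN hornerC hornerMn hornerX.
Qed.

End Adjoint.

Section SpectralProjections.
Variable C : numClosedFieldType.
Implicit Types (m : nat) (s : seq C).

Definition has_spectrum m s (y : 'M[C]_m) : Prop :=
  y^t* = y /\ char_poly y = \prod_(z <- s) ('X - z%:P).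

Lemma has_spectrum_size m s (y : 'M[C]_m) : has_spectrum s y -> size s = m.
Proof.
case=> _ /(congr1 (size \o polyseq)) /=.
by rewrite size_char_poly size_prod_XsubC => -[].
Qed.

Lemma perm_roots (s t : seq C) :
  \prod_(z <- s) ('X - z%:P) = \prod_(z <- t) ('X - z%:P) -> perm_eq s t.
Proof.
elim: s t => [|a s IHs] t.
  rewrite big_nil => /(congr1 (size \o polyseq)) /=.
  by rewrite size_prod_XsubC size_poly1; case: t.
move=> e; have at_ : a \in t.
  by rewrite -root_prod_XsubC -e root_prod_XsubC mem_head.
rewrite perm_sym (permPl (perm_to_rem at_)) perm_cons perm_sym; apply: IHs.
apply: (@mulfI _ ('X - a%:P)); first by rewrite polyXsubC_eq0.
by move: e; rewrite big_cons (perm_big _ (perm_to_rem at_)) big_cons.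
Qed.

Lemma diag_unitary_perm m (d e : m.-tuple C) : perm_eq d e ->
  exists2 Q : 'M[C]_m, Q \is unitarymx &
    diag_mx (\row_i tnth d i) = Q^t* *m diag_mx (\row_i tnth e i) *m Q.
Proof.
move=> /tuple_permP[p pE].
have dp i : tnth d i = tnth e (p i) by rewrite (val_inj pE) tnth_mktuple.
exists (perm_mx p)^T.
  apply/unitarymxP; rewrite trmxK map_perm_mx tr_perm_mx -perm_mxM.
  by rewrite mulVg perm_mx1.
rewrite trmxK map_perm_mx tr_perm_mx -row_permE -col_permE.
by apply/matrixP => i j; rewrite !mxE dp (inj_eq perm_inj).
Qed.

(** The spectral theorem gives the diagonal in an uncontrolled order; a permutation matrix absorbed
    into [Q] puts it in the order of the list [s]. *)
Lemma spectrum_diag m s (y : 'M[C]_m) : has_spectrum s y ->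
  exists2 Q : 'M[C]_m, Q \is unitarymx &
    y = Q^t* *m diag_mx (\row_i s`_i) *m Q.
Proof.
move=> sy; have sz := has_spectrum_size sy; case: sy => hy cy.
have /hermitian_normalmx/orthomx_spectralP yE : y \is hermsymmx by exact/hermsymmxP.
set P := spectralmx y in yE; set d := spectral_diag y in yE.
have uP : P \is unitarymx by exact: spectral_unitarymx.
rewrite invmx_unitary// in yE.
have pd : perm_eq [tuple d 0 i | i < m] s.
  apply: perm_roots; rewrite -cy yE char_poly_similar ?unitary_adjl//.
  rewrite char_poly_trig ?diag_mx_is_trig// big_map big_enum/=.
  by apply: eq_bigr => i _; rewrite !mxE eqxx.
have szs : size s == m by rewrite sz.
have [Q uQ QE] := @diag_unitary_perm m [tuple d 0 i | i < m] (Tuple szs) pd.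
exists (Q *m P); first exact: mul_unitarymx.
rewrite adjM yE.
have <- : \row_i tnth [tuple d 0 i | i < m] i = d.
  by apply/rowP => i; rewrite mxE tnth_mktuple.
rewrite QE !mulmxA; congr (_ *m _ *m _ *m _ *m _); congr diag_mx.
by apply/rowP => i; rewrite !mxE (tnth_nth 0).
Qed.

Lemma has_spectrum_conj m s (y Q : 'M[C]_m) : Q \is unitarymx ->
  has_spectrum s y -> has_spectrum s (Q *m y *m Q^t*).
Proof.
move=> uQ [hy cy]; split; first by rewrite !adjM trmxCK hy mulmxA.
by rewrite char_poly_similar//; exact/unitarymxP.
Qed.

(** The Lagrange polynomial that is 1 at [mu] and 0 at the other values in [s], evaluated at [y].
    Being polynomial in [y], it is smooth in [y] and commutes with conjugation; for [mu] outside [s]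
    it vanishes on matrices of spectrum [s]. *)
Definition sproj m s (y : 'M[C]_m) (mu : C) : 'M[C]_m :=
  \big[mulmx/1%:M]_(nu <- undup s | nu != mu) ((mu - nu)^-1 *: (y - nu%:M)).

Lemma sproj_conj m s (y Q Q' : 'M[C]_m) mu : Q *m Q' = 1%:M -> Q' *m Q = 1%:M ->
  sproj s (Q *m y *m Q') mu = Q *m sproj s y mu *m Q'.
Proof.
move=> QQ' Q'Q; rewrite /sproj; elim: (undup s) => [|nu r IHr].
  by rewrite !big_nil mulmx1.
rewrite !big_cons; case: ifP => // _; rewrite IHr.
have -> : Q *m y *m Q' - nu%:M = Q *m (y - nu%:M) *m Q'.
  by rewrite mulmxBr mulmxBl scalar_mxC -[nu%:M *m _ *m _]mulmxA QQ' mulmx1.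
by rewrite -!scalemxAl -scalemxAr -!scalemxAl !mulmxA -[_ *m Q' *m Q]mulmxA Q'Q mulmx1.
Qed.

Lemma sproj_diag m s (d : 'rV[C]_m) mu : (forall i, d 0 i \in s) ->
  sproj s (diag_mx d) mu = diag_mx (\row_i (d 0 i == mu)%:R).
Proof.
move=> ds.
have -> : sproj s (diag_mx d) mu = diag_mx (\row_i
    \prod_(nu <- undup s | nu != mu) ((mu - nu)^-1 * (d 0 i - nu))).
  rewrite /sproj; elim: (undup s) => [|nu r IHr].
    by rewrite big_nil; apply/matrixP => i j; rewrite !mxE big_nil.
  rewrite big_cons; under [in RHS]eq_mx do rewrite big_cons.
  case: ifP => // _; rewrite IHr -diag_const_mx -raddfB -linearZ mulmx_diag.
  by congr diag_mx; apply/rowP => i; rewrite !mxE.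
congr diag_mx; apply/rowP => i; rewrite !mxE.
case: eqVneq => [->|dmu].
  rewrite big1// => nu numu; rewrite mulVf// subr_eq0 eq_sym//.
rewrite (big_rem (d 0 i)) ?mem_undup//= dmu subrr mulr0 mul0r //.
Qed.

Section Properties.
Variables (m : nat) (s : seq C) (y : 'M[C]_m).
Hypothesis sy : has_spectrum s y.
Local Notation P := (sproj s y).

Lemma sproj_decomp : exists2 Q : 'M[C]_m, Q \is unitarymx &
  y = Q^t* *m diag_mx (\row_i s`_i) *m Q /\
  forall mu, P mu = Q^t* *m diag_mx (\row_(i < m) (s`_i == mu)%:R) *m Q.
Proof.
have [Q uQ yE] := spectrum_diag sy; exists Q => //; split=> // mu.
rewrite yE sproj_conj ?unitary_adjl//; last exact/unitarymxP.
rewrite sproj_diag => [|i]; last by rewrite mxE mem_nth// (has_spectrum_size sy).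
by congr (_ *m diag_mx _ *m _); apply/rowP => i; rewrite !mxE.
Qed.

Lemma spectrum_real mu : mu \in s -> mu^* = mu.
Proof.
have [Q uQ yE] := spectrum_diag sy.
have : diag_mx (\row_i s`_i) = Q *m y *m Q^t* :> 'M_m.
  by rewrite yE !mulmxA (unitarymxP uQ) mul1mx -mulmxA (unitarymxP uQ) mulmx1.
move=> dE mus; case/(nthP 0): mus => i; rewrite (has_spectrum_size sy) => im <-.
have : (diag_mx (\row_i s`_i) : 'M_m)^t* = diag_mx (\row_i s`_i).
  by rewrite dE !adjM trmxCK (proj1 sy) mulmxA.
by move/matrixP/(_ (Ordinal im) (Ordinal im)); rewrite !mxE eqxx !mulr1n.
Qed.

Lemma sproj_adj mu : (P mu)^t* = P mu.
Proof.
have [Q uQ [_ ->]] := sproj_decomp; rewrite !adjM trmxCK mulmxA.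
congr (_ *m _ *m _); apply/matrixP => i j; rewrite !mxE rmorphMn rmorph_nat.
by have [->|] := eqVneq i j.
Qed.

Lemma sprojM mu nu : P mu *m P nu = if mu == nu then P mu else 0.
Proof.
have [Q uQ [_ PE]] := sproj_decomp; rewrite !PE.
rewrite !mulmxA -[_ *m Q *m Q^t*]mulmxA (unitarymxP uQ) mulmx1.
rewrite -[Q^t* *m _ *m diag_mx _]mulmxA mulmx_diag.
case: eqVneq => [<-|munu].
  congr (_ *m diag_mx _ *m _); apply/rowP => i; rewrite !mxE.
  by case: eqP; rewrite ?mulr1 ?mulr0.
rewrite (_ : \row_i _ = 0) ?linear0 ?mulmx0 ?mul0mx//.
apply/rowP => i; rewrite !mxE.
by case: (eqVneq _ mu) => [->|]; rewrite ?(negPf munu) ?mulr0 ?mul0r.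
Qed.

Lemma sproj_notin mu : mu \notin s -> P mu = 0.
Proof.
have [Q uQ [_ ->]] := sproj_decomp => mus.
rewrite (_ : \row_i _ = 0) ?linear0 ?mulmx0 ?mul0mx//.
apply/rowP => i; rewrite !mxE; case: eqVneq => // smu.
by case/negP: mus; rewrite -smu mem_nth// (has_spectrum_size sy).
Qed.

Lemma sproj_sum : \sum_(mu <- undup s) P mu = 1%:M.
Proof.
have [Q uQ [_ PE]] := sproj_decomp.
under eq_bigr do rewrite PE.
rewrite -mulmx_suml -mulmx_sumr -(unitary_adjl uQ) -[in RHS](mulmx1 (Q^t*)).
congr (_ *m _ *m _); rewrite -raddf_sum -diag_const_mx; congr diag_mx.
apply/rowP => i; rewrite summxE mxE.
rewrite (bigD1_seq s`_i) ?undup_uniq ?mem_undup ?mem_nth ?(has_spectrum_size sy)//=.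
rewrite mxE eqxx big1 ?addr0// => mu; rewrite mxE eq_sym => /negPf -> //.
Qed.

Lemma mul_sproj mu : y *m P mu = mu *: P mu.
Proof.
have [Q uQ [yE PE]] := sproj_decomp; rewrite PE {1}yE.
rewrite !mulmxA -[_ *m Q *m Q^t*]mulmxA (unitarymxP uQ) mulmx1.
rewrite -[Q^t* *m _ *m diag_mx _]mulmxA mulmx_diag scalemxAl scalemxAr.
congr (_ *m _ *m _); rewrite -linearZ; congr diag_mx; apply/rowP => i.
by rewrite !mxE; case: eqP => [->|]; rewrite ?mulr0.
Qed.

Lemma sproj_mul mu : P mu *m y = mu *: P mu.
Proof.
have [mus|mus] := boolP (mu \in s); last by rewrite sproj_notin// mul0mx scaler0.
have := congr1 (fun A => A^t*) (mul_sproj mu).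
by rewrite /= adjM adjZ sproj_adj (proj1 sy) spectrum_real.
Qed.

Lemma sproj_trace mu : \tr (P mu) = (count_mem mu s)%:R.
Proof.
have [Q uQ [_ ->]] := sproj_decomp.
rewrite mxtrace_mulC mulmxA (unitarymxP uQ) mul1mx mxtrace_diag.
under eq_bigr do rewrite mxE; rewrite -natr_sum; congr _%:R.
have sz := has_spectrum_size sy.
rewrite -sum1_count (big_nth 0) sz big_mkord [RHS]big_mkcond /=.
by apply: eq_bigr => i _; case: eqP.
Qed.

Lemma sproj_fix p mu (A : 'M[C]_(m, p)) : y *m A = mu *: A -> P mu *m A = A.
Proof.
move=> yA; rewrite -[RHS]mul1mx -sproj_sum mulmx_suml.
have PA nu : nu != mu -> P nu *m A = 0.
  move=> numu; have : nu *: (P nu *m A) = mu *: (P nu *m A).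
    by rewrite scalemxAl -sproj_mul -mulmxA yA scalemxAr.
  move/eqP; rewrite -subr_eq0 -scalerBl scaler_eq0 subr_eq0 (negPf numu).
  by move/eqP.
have [mus|mus] := boolP (mu \in s); last first.
  rewrite sproj_notin// mul0mx big_seq big1// => nu; rewrite mem_undup => nus.
  by apply: PA; apply: contraNneq mus => <-.
rewrite (bigD1_seq mu) ?undup_uniq ?mem_undup//=.
by rewrite big1 ?addr0.
Qed.

End Properties.

End SpectralProjections.

Global Opaque sproj.

(** * The part of an eigenspace orthogonal to a border vector *)

Section Deflation.
Variable C : numClosedFieldType.

(** The squared norm of the projection of [b] to the eigenspace ([wtE]). It is also the residue at
    [mu] of the resolvent of [y] evaluated on [b], which is how weights are compared. *)
Definition wt m (s : seq C) (y : 'M[C]_m) (b : 'cV[C]_m) mu : C :=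
  (b^t* *m sproj s y mu *m b) 0 0.

(* The orthogonal projection onto the part of the eigenspace orthogonal to
   [b]; as [0^-1 = 0], it is the whole spectral projection when [wt] is 0. *)
Definition defl m (s : seq C) (y : 'M[C]_m) (b : 'cV[C]_m) mu : 'M[C]_m :=
  sproj s y mu - (wt s y b mu)^-1 *: (sproj s y mu *m b *m b^t* *m sproj s y mu).

Variables (m : nat) (s : seq C) (y : 'M[C]_m) (b : 'cV[C]_m).
Hypothesis sy : has_spectrum s y.
Local Notation P := (sproj s y).

Lemma wtE mu : wt s y b mu = ((P mu *m b)^t* *m (P mu *m b)) 0 0.
Proof.
by rewrite /wt adjM (sproj_adj sy) mulmxA -[_ *m P mu *m P mu]mulmxA sprojM ?eqxx.
Qed.

Lemma wt_ge0 mu : 0 <= wt s y b mu.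
Proof. by rewrite wtE sqr_norm_ge0. Qed.

Lemma wt_eq0 mu : wt s y b mu = 0 -> P mu *m b = 0.
Proof. by rewrite wtE; exact: sqr_norm_eq0. Qed.

Lemma wtM mu : b^t* *m P mu *m b = (wt s y b mu)%:M.
Proof. exact: mx11_scalar. Qed.

Lemma wt_conj mu : (wt s y b mu)^* = wt s y b mu.
Proof. by apply/CrealP; exact: ger0_real (wt_ge0 mu). Qed.

Lemma defl_adj mu : (defl s y b mu)^t* = defl s y b mu.
Proof.
rewrite /defl adjB adjZ !adjM !trmxCK (sproj_adj sy) fmorphV /= wt_conj.
by rewrite !mulmxA.
Qed.

Lemma mul_defl mu : y *m defl s y b mu = mu *: defl s y b mu.
Proof.
by rewrite /defl mulmxBr -scalemxAr !mulmxA (mul_sproj sy) scalerBr -!scalemxAl !scalerA mulrC.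
Qed.

Lemma border_defl mu : b^t* *m defl s y b mu = 0.
Proof.
rewrite /defl mulmxBr -scalemxAr !mulmxA wtM -mulmxA mul_scalar_mx scalerA.
have [w0|w0] := eqVneq (wt s y b mu) 0; last first.
  by rewrite mulVf// scale1r subrr.
rewrite w0 mulr0 scale0r subr0; apply: (can_inj (@trmxCK _ _ _)).
by rewrite adjM trmxCK (sproj_adj sy) adj0 wt_eq0.
Qed.

Lemma defl_fix p mu (A : 'M[C]_(m, p)) : y *m A = mu *: A -> b^t* *m A = 0 ->
  defl s y b mu *m A = A.
Proof.
move=> /(sproj_fix sy) PA bA.
by rewrite /defl mulmxBl PA -scalemxAl -!mulmxA PA bA !mulmx0 scaler0 subr0.
Qed.

(** The trace of a projection is its rank, so this turns the vanishing of a weight into a statement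
    about dimensions; it is the source of [wt_neq0_count]. *)
Lemma defl_trace mu :
  \tr (defl s y b mu) = (count_mem mu s)%:R - (wt s y b mu != 0)%:R.
Proof.
rewrite /defl mxtraceB mxtraceZ (sproj_trace sy) -mulmxA mxtrace_mulC -!mulmxA.
rewrite [P mu *m (P mu *m b)]mulmxA sprojM// eqxx mulmxA wtM mxtrace_scalar mulr1n.
by case: eqVneq => [->|w0]; rewrite ?mulr0 ?mulVf.
Qed.

Lemma defl_notin mu : mu \notin s -> defl s y b mu = 0.
Proof. by move=> mus; rewrite /defl sproj_notin// !mul0mx scaler0 subr0. Qed.

End Deflation.

(** * Bordered Hermitian matrices *)

Section PartialFractions.
Variable C : numFieldType.

(** Multiplying by the linear factors of the exceptional points gives a polynomial that vanishes
    everywhere, in particular at more natural numbers than its degree allows. *)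
Lemma poly_cofinite_eq0 (p : {poly C}) (z : seq C) :
  (forall t, t \notin z -> p.[t] = 0) -> p = 0.
Proof.
move=> h; pose q := p * \prod_(a <- z) ('X - a%:P).
have q0 : q = 0.
  apply: (@roots_geq_poly_eq0 _ q [seq k%:R | k <- iota 0 (size q)]).
  - apply/allP => t _; rewrite rootE hornerM.
    have [tz|tz] := boolP (t \in z); last by rewrite h// mul0r.
    by have := tz; rewrite -root_prod_XsubC rootE => /eqP ->; rewrite mulr0.
  - rewrite map_inj_uniq ?iota_uniq// => i j /eqP; rewrite eqr_nat => /eqP //.
  - by rewrite size_map size_iota.
move/eqP: q0; rewrite mulf_eq0 => /orP[/eqP//|].
by rewrite (negPf (monic_neq0 (monic_prod_XsubC _ _ _))).
Qed.

(** After clearing denominators, evaluation at [mu] isolates [al mu]; what is left is [c] times a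
    monic polynomial. The list [z] leaves room for further excluded points, such as the poles of
    another expression. *)
Lemma partial_fraction_eq0 (s z : seq C) (c : C) (al : C -> C) : uniq s ->
  (forall t, t \notin s ++ z -> c + \sum_(mu <- s) al mu / (t - mu) = 0) ->
  c = 0 /\ forall mu, mu \in s -> al mu = 0.
Proof.
move=> us h.
pose q (r : seq C) : {poly C} := \prod_(nu <- r) ('X - nu%:P).
pose p := c *: q s + \sum_(mu <- s) al mu *: q (rem mu s).
have qE mu t : mu \in s -> (q s).[t] = (t - mu) * (q (rem mu s)).[t].
  move=> mus; rewrite /q (perm_big _ (perm_to_rem mus)) big_cons hornerM.
  by rewrite hornerXsubC.
have p0 : p = 0.
  apply: (@poly_cofinite_eq0 _ (s ++ z)) => t tsz.
  have ts : t \notin s by apply: contra tsz; rewrite mem_cat => ->.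
  suff -> : p.[t] = (q s).[t] * (c + \sum_(mu <- s) al mu / (t - mu)).
    by rewrite h// mulr0.
  rewrite /p hornerD hornerZ horner_sum mulrDr mulr_sumr [c * _]mulrC.
  congr (_ + _); apply: eq_big_seq => mu mus.
  rewrite hornerZ (qE mu)//; have tmu : t - mu != 0.
    by rewrite subr_eq0; apply: contraNneq ts => ->.
  by rewrite [al mu / _]mulrC mulrACA mulfV// mul1r mulrC.
have al0 mu : mu \in s -> al mu = 0.
  move=> mus; have /(congr1 (fun p => p.[mu])) := p0.
  rewrite /p hornerD hornerZ horner_sum horner0 (qE mu)// subrr mul0r mulr0 add0r.
  rewrite (bigD1_seq mu)//= hornerZ big1_seq ?addr0 => [|nu /andP[numu nus]]; last first.
    rewrite hornerZ /q; apply/eqP; rewrite mulf_eq0 -rootE root_prod_XsubC.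
    by rewrite mem_rem_uniq// inE [mu == nu]eq_sym numu mus orbT.
  move/eqP; rewrite mulf_eq0 => /orP[/eqP//|].
  by rewrite -rootE root_prod_XsubC mem_rem_uniq// inE eqxx.
split=> //; have /eqP := p0; rewrite /p big_seq big1 => [|mu /al0 ->]; last first.
  by rewrite scale0r.
rewrite addr0 scaler_eq0 => /orP[/eqP//|].
by rewrite (negPf (monic_neq0 (monic_prod_XsubC _ _ _))).
Qed.

Lemma partial_fraction_inj (s z : seq C) (c d : C) (al be : C -> C) : uniq s ->
  (forall t, t \notin s ++ z -> c + \sum_(mu <- s) al mu / (t - mu) =
     d + \sum_(mu <- s) be mu / (t - mu)) ->
  c = d /\ forall mu, mu \in s -> al mu = be mu.
Proof.
move=> us h.
have [|/eqP + h'] := @partial_fraction_eq0 s z (c - d) (fun mu => al mu - be mu) us.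
  move=> t tsz; under eq_bigr do rewrite mulrBl.
  by rewrite big_split/= sumrN addrACA -opprD h// subrr.
rewrite subr_eq0 => /eqP; split=> // mu /h' /eqP.
by rewrite subr_eq0 => /eqP.
Qed.

End PartialFractions.

Section Bordered.
Variable C : numClosedFieldType.

Definition bord m (y : 'M[C]_m) (b : 'cV[C]_m) (c : C) : 'M[C]_(m + 1) :=
  block_mx y b (b^t*) c%:M.

(** The last basis vector. It is to the bordered matrix what [b] is to [y]: deflating by the one or
    by the other leaves the same part of an eigenspace ([defl_bord]). *)
Definition ebot m : 'cV[C]_(m + 1) := col_mx 0 1%:M.

Lemma hermitian_bord m (x : 'M[C]_(m + 1)) : x^t* = x ->
  let c := drsubmx x 0 0 in
  [/\ (ulsubmx x)^t* = ulsubmx x, c^* = c & x = bord (ulsubmx x) (ursubmx x) c].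
Proof.
move=> hx /=; have := hx; rewrite -{1 2}[x]submxK adj_block.
move=> /eq_block_mx[h1 h2 h3 h4]; split=> //.
  by have /matrixP/(_ 0 0) := h4; rewrite !mxE.
by rewrite /bord h3 -mx11_scalar submxK.
Qed.

Lemma bord_hermitian m (y : 'M[C]_m) b c : y^t* = y -> c^* = c ->
  (bord y b c)^t* = bord y b c.
Proof. by move=> hy hc; rewrite /bord adj_block trmxCK hy adj_scalar hc. Qed.

Lemma ulsubmx_bord m (y : 'M[C]_m) b c : ulsubmx (bord y b c) = y.
Proof. exact: block_mxKul. Qed.

Lemma ursubmx_bord m (y : 'M[C]_m) b c : ursubmx (bord y b c) = b.
Proof. exact: block_mxKur. Qed.

Lemma drsubmx_bord m (y : 'M[C]_m) b c : drsubmx (bord y b c) 0 0 = c.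
Proof. by rewrite /bord block_mxKdr mxE. Qed.

Lemma adj_ebot m : (ebot m)^t* = row_mx 0 1%:M.
Proof. by rewrite /ebot tr_col_mx map_row_mx trmx0 map_mx0 adj1. Qed.

Section Secular.
Variables (m : nat) (s : seq C) (y : 'M[C]_m) (b : 'cV[C]_m) (c : C).
Hypothesis sy : has_spectrum s y.
Local Notation P := (sproj s y).
Local Notation x := (bord y b c).

Definition resolvent t : 'M[C]_m := \sum_(mu <- undup s) (t - mu)^-1 *: P mu.

Lemma resolventP t : t \notin s -> (t%:M - y) *m resolvent t = 1%:M.
Proof.
move=> ts; rewrite -(sproj_sum sy) mulmx_sumr; apply: eq_big_seq => mu.
rewrite mem_undup => mus; rewrite -scalemxAr mulmxBl mul_scalar_mx (mul_sproj sy).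
rewrite -scalerBl scalerA mulVf ?scale1r// subr_eq0.
by apply: contraNneq ts => ->.
Qed.

(** The Schur complement of [t%:M - y] in [t%:M - x], expanded in partial fractions; it is the
    quotient of the two characteristic polynomials. *)
Definition secular t : C := t - c - \sum_(mu <- undup s) wt s y b mu / (t - mu).

Lemma bord_resolvent t : b^t* *m resolvent t *m b =
  (\sum_(mu <- undup s) wt s y b mu / (t - mu))%:M.
Proof.
rewrite /resolvent mulmx_sumr mulmx_suml raddf_sum; apply: eq_bigr => mu _.
by rewrite -scalemxAr -scalemxAl wtM scale_scalar_mx mulrC.
Qed.

Lemma bord_shift t : t%:M - x = block_mx (t%:M - y) (- b) (- b^t*) (t - c)%:M.
Proof.
rewrite /bord scalar_mx_block opp_block_mx add_block_mx !add0r.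
by rewrite [(t - c)%:M]raddfB.
Qed.

Lemma char_poly_bord t : t \notin s ->
  (char_poly x).[t] = (char_poly y).[t] * secular t.
Proof.
move=> ts; rewrite !horner_char_poly bord_shift.
have Rl : resolvent t *m (t%:M - y) = 1%:M by apply: mulmx1C; exact: resolventP.
have -> : \det (block_mx (t%:M - y) (- b) (- b^t*) (t - c)%:M) =
    \det (block_mx 1%:M 0 (b^t* *m resolvent t) 1%:M *m
          block_mx (t%:M - y) (- b) (- b^t*) (t - c)%:M).
  by rewrite det_mulmx det_lblock !det1 !mul1r.
rewrite mulmx_block !mul1mx !mul0mx !addr0 -mulmxA Rl mulmx1 subrr.
by rewrite det_ublock mulmxN bord_resolvent det_mx11 !mxE !eqxx !mulr1n addrC.
Qed.

(** The column is a multiple of the last column of the inverse of [t%:M - x], whose bottom entry is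
    therefore [(secular t)^-1] wherever that inverse exists. *)
Lemma bord_resolvent_ebot t : t \notin s ->
  (t%:M - x) *m col_mx (resolvent t *m b) 1%:M = secular t *: ebot m.
Proof.
move=> ts; rewrite bord_shift /ebot mul_block_col mulmxA resolventP// mul1mx mulmx1.
rewrite subrr scale_col_mx scaler0 mulmx1 mulNmx mulmxA bord_resolvent.
by rewrite -raddfN -raddfD scale_scalar_mx mulr1 addrC.
Qed.

End Secular.

Section Comparison.
Variables (m : nat) (s s' : seq C) (y y0 : 'M[C]_m) (b b0 : 'cV[C]_m) (c c0 : C).
Hypotheses (sy : has_spectrum s y) (sy0 : has_spectrum s y0).
Hypotheses (hc : c^* = c) (sx0 : has_spectrum s' (bord y0 b0 c0)).

(** The weights are compared with those of a reference matrix of spectrum [s'] instead of being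
    computed from [s] and [s']; uniqueness of the partial fractions of [secular] does the rest. *)
Lemma bord_spectrum : has_spectrum s' (bord y b c) <->
  c = c0 /\ forall mu, mu \in s -> wt s y b mu = wt s y0 b0 mu.
Proof.
split=> [[_ cx]|[cc ww]].
  have h t : t \notin undup s ++ [::] ->
      - c + \sum_(mu <- undup s) - wt s y b mu / (t - mu) =
      - c0 + \sum_(mu <- undup s) - wt s y0 b0 mu / (t - mu).
    rewrite cats0 mem_undup => ts.
    have : (char_poly (bord y b c)).[t] = (char_poly (bord y0 b0 c0)).[t].
      by rewrite cx (proj2 sx0).
    rewrite (char_poly_bord _ _ sy)// (char_poly_bord _ _ sy0)//.
    rewrite (proj2 sy) (proj2 sy0) => /mulfI.
    rewrite -rootE root_prod_XsubC => /(_ ts).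
    rewrite /secular -!addrA => /addrI; rewrite -!sumrN.
    by under eq_bigr do rewrite -mulNr; under [in X in _ = X -> _]eq_bigr do rewrite -mulNr.
  have [/oppr_inj cc ww] := partial_fraction_inj (undup_uniq s) h.
  by split=> // mu mus; apply/oppr_inj/ww; rewrite mem_undup.
split; first exact: bord_hermitian (proj1 sy) hc.
rewrite -(proj2 sx0); apply/eqP; rewrite -subr_eq0; apply/eqP.
apply: (@poly_cofinite_eq0 _ _ s) => t ts; rewrite hornerD hornerN.
rewrite (char_poly_bord _ _ sy)// (char_poly_bord _ _ sy0)//.
rewrite (proj2 sy) (proj2 sy0) -mulrBr /secular cc.
rewrite (eq_big_seq (fun mu => wt s y0 b0 mu / (t - mu))) ?subrr ?mulr0//.
by move=> mu; rewrite mem_undup => mus; rewrite ww.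
Qed.

(** The bottom entry of the resolvent of the bordered matrix is the inverse of [secular], which by
    [bord_spectrum] is the same function for both matrices; its residues are the weights of the last
    basis vector. *)
Lemma bord_wt_ebot : has_spectrum s' (bord y b c) -> forall mu, mu \in s' ->
  wt s' (bord y b c) (ebot m) mu = wt s' (bord y0 b0 c0) (ebot m) mu.
Proof.
move=> sx; have [cc ww] := bord_spectrum.1 sx.
have secE t : secular s y b c t = secular s y0 b0 c0 t.
  rewrite /secular cc; congr (_ - _); apply: eq_big_seq => mu.
  by rewrite mem_undup => mus; rewrite ww.
have key (y1 : 'M[C]_m) b1 c1 t : has_spectrum s y1 ->
    has_spectrum s' (bord y1 b1 c1) -> t \notin undup s' ++ s ->
    \sum_(mu <- undup s') wt s' (bord y1 b1 c1) (ebot m) mu / (t - mu) =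
    (secular s y1 b1 c1 t)^-1.
  move=> sy1 sx1; rewrite mem_cat negb_or mem_undup => /andP[ts' ts].
  have sec0 : secular s y1 b1 c1 t != 0.
    have := char_poly_bord b1 c1 sy1 ts; rewrite (proj2 sx1).
    apply: contra_eq_neq => ->; rewrite mulr0 -rootE root_prod_XsubC //.
  have Rx := resolventP sx1 ts'.
  have := congr1 (mulmx (resolvent s' (bord y1 b1 c1) t))
    (bord_resolvent_ebot b1 c1 sy1 ts).
  rewrite mulmxA (mulmx1C Rx) mul1mx => /(congr1 (mulmx ((ebot m)^t*))).
  rewrite -scalemxAr -scalemxAr mulmxA bord_resolvent adj_ebot mul_row_col.
  rewrite mul0mx add0r mulmx1 scale_scalar_mx => /(congr1 (fun A : 'M_1 => A 0 0)).
  rewrite !mxE eqxx !mulr1n => h; apply: (mulfI sec0).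
  by rewrite -h mulfV.
have h t : t \notin undup s' ++ s ->
    0 + \sum_(mu <- undup s') wt s' (bord y b c) (ebot m) mu / (t - mu) =
    0 + \sum_(mu <- undup s') wt s' (bord y0 b0 c0) (ebot m) mu / (t - mu).
  by move=> ts; rewrite !add0r !key// secE.
have [_ h'] := partial_fraction_inj (undup_uniq s') h.
by move=> mu mus; apply: h'; rewrite mem_undup.
Qed.

End Comparison.

(** * Weights and multiplicities of consecutive spectra *)

Section Interlocking.
Variables (m : nat) (s s' : seq C) (y : 'M[C]_m) (b : 'cV[C]_m) (c : C).
Local Notation x := (bord y b c).
Hypotheses (sy : has_spectrum s y) (sx : has_spectrum s' x).

(** Eigenvectors of [x] with last entry 0 are the eigenvectors of [y] orthogonal to [b]. Both sides
    project orthogonally to this space: each fixes the columns of the other, and taking adjoints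
    makes them equal. *)
Lemma defl_bord mu :
  defl s' x (ebot m) mu = block_mx (defl s y b mu) 0 0 0.
Proof.
set B := block_mx _ _ _ _; set A := defl _ _ _ _.
have AB : A *m B = B.
  apply: defl_fix => //.
    rewrite /B /bord mulmx_block !mulmx0 !addr0 (mul_defl b sy) (border_defl b sy).
    by rewrite scale_block_mx !scaler0.
  by rewrite adj_ebot /B -[block_mx _ _ _ _]/(col_mx _ _) mul_row_col row_mx0 mulmx0 mul0mx addr0.
have eA : dsubmx A = 0.
  have := border_defl (ebot m) sx mu; rewrite -/A adj_ebot -[A]vsubmxK mul_row_col.
  by rewrite mul0mx add0r mul1mx col_mxKd.
have hA : A^t* = A by exact: defl_adj.
have AE : A = block_mx (ulsubmx A) 0 0 0.
  rewrite -[LHS]submxK; have -> : dlsubmx A = 0 by rewrite /dlsubmx eA linear0.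
  have -> : drsubmx A = 0 by rewrite /drsubmx eA linear0.
  congr block_mx; have := hA; rewrite -{1 2}[A]submxK adj_block => /eq_block_mx[_ <- _ _].
  by rewrite /dlsubmx eA linear0 adj0.
have BA : B *m A = A.
  have := mul_defl (ebot m) sx mu; rewrite -/A {1 2}AE /bord mulmx_block !mulmx0 !addr0.
  rewrite scale_block_mx !scaler0 => /eq_block_mx[yA _ bA _].
  rewrite AE /B mulmx_block !mulmx0 !mul0mx !addr0.
  by rewrite (defl_fix sy).
have hB : B^t* = B by rewrite /B adj_block !adj0 (defl_adj b sy).
by rewrite -hA -BA adjM hA hB.
Qed.

(** Pairing the upper block of the eigenvector equation of [x] with the projection of [b] leaves the
    weight times the last entry of the eigenvector, so a nonzero weight forces all these last
    entries to be 0. *)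
Lemma wt_exclusive mu : wt s y b mu != 0 -> wt s' x (ebot m) mu = 0.
Proof.
move=> w0; have := mul_sproj sx mu; set A := sproj s' x mu.
rewrite -[A]submxK /bord mulmx_block scale_block_mx => /eq_block_mx[_ h _ _].
have := congr1 (mulmx (b^t* *m sproj s y mu)) h.
rewrite mulmxDr !mulmxA -[_ *m _ *m y]mulmxA (sproj_mul sy) -scalemxAr -scalemxAl -scalemxAr.
move/(canRL (addKr _)); rewrite addNr wtM mul_scalar_mx => /eqP.
rewrite scaler_eq0 (negPf w0) /= => /eqP A0.
rewrite /wt -/A adj_ebot -[A]submxK A0 -[block_mx _ _ _ _]/(col_mx _ _) mul_row_col.
by rewrite mul0mx add0r mul1mx mul_row_col mulmx0 mul0mx addr0 mxE.
Qed.

(** Traces in [defl_bord] show that the two multiplicities differ by the difference of two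
    indicators, one for each weight, and [wt_exclusive] forbids that both are 1. *)
Lemma wt_neq0_count mu :
  (wt s y b mu != 0) = (count_mem mu s' < count_mem mu s)%N.
Proof.
have := congr1 mxtrace (defl_bord mu).
rewrite (defl_trace _ sx) mxtrace_block mxtrace0 addr0 (defl_trace _ sy).
have := @wt_exclusive mu.
case: (eqVneq (wt s y b mu) 0) => [_ _|_ -> //].
  case: (eqVneq (wt s' x (ebot m) mu) 0) => _ /=; rewrite ?subr0.
    by move/eqP; rewrite eqr_nat => /eqP ->; rewrite ltnn.
  move/eqP; rewrite subr_eq -natrD eqr_nat => /eqP ->.
  by rewrite addn1 ltnNge leqnSn.
rewrite eqxx /= subr0 => /eqP; rewrite eq_sym subr_eq -natrD eqr_nat => /eqP ->.
by rewrite addn1 ltnS leqnn.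
Qed.

Lemma wt_ebot_neq0_count mu :
  (wt s' x (ebot m) mu != 0) = (count_mem mu s < count_mem mu s')%N.
Proof.
have := congr1 mxtrace (defl_bord mu).
rewrite (defl_trace _ sx) mxtrace_block mxtrace0 addr0 (defl_trace _ sy).
have := @wt_exclusive mu.
case: (eqVneq (wt s y b mu) 0) => [_ _|_ -> //].
  case: (eqVneq (wt s' x (ebot m) mu) 0) => _ /=; rewrite ?subr0.
    by move/eqP; rewrite eqr_nat => /eqP ->; rewrite ltnn.
  move/eqP; rewrite subr_eq -natrD eqr_nat => /eqP ->.
  by rewrite addn1 leqnn.
rewrite eqxx /= subr0 => /eqP; rewrite eq_sym subr_eq -natrD eqr_nat => /eqP ->.
by rewrite addn1 ltnNge leqnSn.
Qed.

End Interlocking.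

End Bordered.
(** * Elementary complex matrix-valued maps *)

Section ComplexElementary.
Variables (R : realType) (k : nat) (A : set 'rV[R]_k) (x : 'rV[R]_k).
Local Notation C := R[i].
Implicit Types (f g : 'rV[R]_k -> C).

Definition csm f : Prop :=
  esm A x (fun y => complex.Re (f y)) /\ esm A x (fun y => complex.Im (f y)).

Lemma csm_ext f g : (forall y, A y -> f y = g y) -> csm f -> csm g.
Proof.
by move=> fg [h1 h2]; split; [apply: esm_ext h1|apply: esm_ext h2] => y Ay; rewrite fg.
Qed.

Lemma csm_cst c : csm (fun=> c).
Proof. by split; exact: esm_cst. Qed.

Lemma csmD f g : csm f -> csm g -> csm (fun y => f y + g y).
Proof.
move=> [f1 f2] [g1 g2]; split.
  by apply: esm_ext (esmD f1 g1) => y _; case: (f y); case: (g y).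
by apply: esm_ext (esmD f2 g2) => y _; case: (f y); case: (g y).
Qed.

Lemma csmM f g : csm f -> csm g -> csm (fun y => f y * g y).
Proof.
move=> [f1 f2] [g1 g2]; split.
  apply: esm_ext (esmB (esmM f1 g1) (esmM f2 g2)) => y _.
  by case: (f y) => ? ?; case: (g y).
apply: esm_ext (esmD (esmM f1 g2) (esmM f2 g1)) => y _.
by case: (f y) => ? ?; case: (g y).
Qed.

Lemma csmN f : csm f -> csm (fun y => - f y).
Proof.
move=> cf; apply: csm_ext (csmM (csm_cst (-1)) cf) => y _; exact: mulN1r.
Qed.

Lemma csm_conj f : csm f -> csm (fun y => (f y)^*).
Proof.
move=> [f1 f2]; split.
  by apply: esm_ext f1 => y _; case: (f y).
by apply: esm_ext (esmN f2) => y _; case: (f y).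
Qed.

Lemma csm_real (f : 'rV[R]_k -> R) : esm A x f -> csm (fun y => (f y)%:C%C).
Proof. by move=> ef; split=> //=; exact: esm_cst. Qed.

Lemma csmV f : A x -> f x != 0 -> csm f -> csm (fun y => (f y)^-1).
Proof.
move=> Ax fx0 [f1 f2].
have n0 : complex.Re (f x) ^+ 2 + complex.Im (f x) ^+ 2 != 0.
  case: (f x) fx0 => a b /=; apply: contraNneq => /eqP.
  by rewrite paddr_eq0 ?sqr_ge0// !sqrf_eq0 => /andP[/eqP-> /eqP->].
have en : esm A x (fun y => (complex.Re (f y) ^+ 2 + complex.Im (f y) ^+ 2)^-1).
  by apply: esmV => //; exact: esmD (esmM f1 f1) (esmM f2 f2).
split.
  by apply: esm_ext (esmM f1 en) => y _; case: (f y).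
by apply: esm_ext (esmN (esmM f2 en)) => y _; case: (f y).
Qed.

Lemma csm_sum (I : Type) (r : seq I) (P : pred I) (F : I -> 'rV[R]_k -> C) :
  (forall i, P i -> csm (F i)) -> csm (fun y => \sum_(i <- r | P i) F i y).
Proof.
move=> cF; elim: r => [|i r IHr].
  by apply: csm_ext (csm_cst 0) => y _; rewrite big_nil.
case: (boolP (P i)) => Pi.
  by apply: csm_ext (csmD (cF i Pi) IHr) => y _; rewrite big_cons Pi.
by apply: csm_ext IHr => y _; rewrite big_cons (negPf Pi).
Qed.

Lemma csm_prod (I : Type) (r : seq I) (P : pred I) (F : I -> 'rV[R]_k -> C) :
  (forall i, P i -> csm (F i)) -> csm (fun y => \prod_(i <- r | P i) F i y).
Proof.
move=> cF; elim: r => [|i r IHr].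
  by apply: csm_ext (csm_cst 1) => y _; rewrite big_nil.
case: (boolP (P i)) => Pi.
  by apply: csm_ext (csmM (cF i Pi) IHr) => y _; rewrite big_cons Pi.
by apply: csm_ext IHr => y _; rewrite big_cons (negPf Pi).
Qed.

Definition msm m n (F : 'rV[R]_k -> 'M[C]_(m, n)) : Prop :=
  forall i j, csm (fun y => F y i j).

Lemma msm_ext m n (F G : 'rV[R]_k -> 'M[C]_(m, n)) :
  (forall y, A y -> F y = G y) -> msm F -> msm G.
Proof. by move=> FG mF i j; apply: csm_ext (mF i j) => y Ay; rewrite FG. Qed.

Lemma msm_cst m n (M : 'M[C]_(m, n)) : msm (fun=> M).
Proof. by move=> i j; exact: csm_cst. Qed.

Lemma msmD m n (F G : 'rV[R]_k -> 'M[C]_(m, n)) :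
  msm F -> msm G -> msm (fun y => F y + G y).
Proof.
by move=> mF mG i j; apply: csm_ext (csmD (mF i j) (mG i j)) => y _; rewrite mxE.
Qed.

Lemma msmN m n (F : 'rV[R]_k -> 'M[C]_(m, n)) : msm F -> msm (fun y => - F y).
Proof. by move=> mF i j; apply: csm_ext (csmN (mF i j)) => y _; rewrite mxE. Qed.

Lemma msmB m n (F G : 'rV[R]_k -> 'M[C]_(m, n)) :
  msm F -> msm G -> msm (fun y => F y - G y).
Proof. by move=> mF mG; apply: msmD => //; exact: msmN. Qed.

Lemma msmZ m n f (F : 'rV[R]_k -> 'M[C]_(m, n)) :
  csm f -> msm F -> msm (fun y => f y *: F y).
Proof.
by move=> cf mF i j; apply: csm_ext (csmM cf (mF i j)) => y _; rewrite mxE.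
Qed.

Lemma msmM m n p (F : 'rV[R]_k -> 'M[C]_(m, n)) (G : 'rV[R]_k -> 'M[C]_(n, p)) :
  msm F -> msm G -> msm (fun y => F y *m G y).
Proof.
move=> mF mG i j.
apply: csm_ext (@csm_sum _ (index_enum 'I_n) xpredT (fun l y => F y i l * G y l j) _).
  by move=> y _; rewrite mxE.
by move=> l _; exact: csmM.
Qed.

Lemma msm_adj m n (F : 'rV[R]_k -> 'M[C]_(m, n)) : msm F -> msm (fun y => (F y)^t*).
Proof. by move=> mF i j; apply: csm_ext (csm_conj (mF j i)) => y _; rewrite !mxE. Qed.

Lemma msm_sum m n (I : Type) (r : seq I) (P : pred I)
    (F : I -> 'rV[R]_k -> 'M[C]_(m, n)) :
  (forall i, P i -> msm (F i)) -> msm (fun y => \sum_(i <- r | P i) F i y).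
Proof.
move=> mF i j; apply: csm_ext (@csm_sum _ r P (fun l y => F l y i j) _).
  by move=> y _; rewrite summxE.
by move=> l Pl; exact: mF.
Qed.

Lemma msm_block m n p q (F1 : 'rV[R]_k -> 'M[C]_(m, n)) (F2 : 'rV[R]_k -> 'M[C]_(m, p))
    (F3 : 'rV[R]_k -> 'M[C]_(q, n)) (F4 : 'rV[R]_k -> 'M[C]_(q, p)) :
  msm F1 -> msm F2 -> msm F3 -> msm F4 ->
  msm (fun y => block_mx (F1 y) (F2 y) (F3 y) (F4 y)).
Proof.
move=> m1 m2 m3 m4 i j; case: (split_ordP i) => i' ->; case: (split_ordP j) => j' ->.
- by apply: csm_ext (m1 i' j') => y _; rewrite block_mxEul.
- by apply: csm_ext (m2 i' j') => y _; rewrite block_mxEur.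
- by apply: csm_ext (m3 i' j') => y _; rewrite block_mxEdl.
- by apply: csm_ext (m4 i' j') => y _; rewrite block_mxEdr.
Qed.

Lemma msm_ulsubmx m n p q (F : 'rV[R]_k -> 'M[C]_(m + n, p + q)) :
  msm F -> msm (fun y => ulsubmx (F y)).
Proof. by move=> mF i j; apply: csm_ext (mF (lshift n i) (lshift q j)) => y _; rewrite !mxE. Qed.

Lemma msm_ursubmx m n p q (F : 'rV[R]_k -> 'M[C]_(m + n, p + q)) :
  msm F -> msm (fun y => ursubmx (F y)).
Proof. by move=> mF i j; apply: csm_ext (mF (lshift n i) (rshift p j)) => y _; rewrite !mxE. Qed.

Local Transparent sproj.
Lemma msm_sproj m (s : seq C) mu (F : 'rV[R]_k -> 'M[C]_m) :
  msm F -> msm (fun y => sproj s (F y) mu).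
Proof.
move=> mF; rewrite /sproj; elim: (undup s) => [|nu r IHr].
  by apply: msm_ext (msm_cst 1%:M) => y _; rewrite big_nil.
have h := msmM (msmZ (csm_cst (mu - nu)^-1) (msmB mF (msm_cst nu%:M))) IHr.
case: (boolP (nu != mu)) => numu.
  by apply: msm_ext h => y _; rewrite big_cons numu.
by apply: msm_ext IHr => y _; rewrite big_cons (negPf numu).
Qed.

Local Opaque sproj.

Lemma csm_det m (F : 'rV[R]_k -> 'M[C]_m) : msm F -> csm (fun y => \det (F y)).
Proof.
move=> mF; apply: csm_sum => s _; apply: csmM; first exact: csm_cst.
by apply: csm_prod => i _; exact: mF.
Qed.

Lemma msm_invmx m (F : 'rV[R]_k -> 'M[C]_m) : A x ->
  (forall y, A y -> F y \in unitmx) -> msm F -> msm (fun y => invmx (F y)).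
Proof.
move=> Ax uF mF.
have mV : msm (fun y => (\det (F y))^-1 *: \adj (F y)).
  apply: msmZ.
    apply: csmV => //; last exact: csm_det.
    by rewrite -unitfE -unitmxE uF.
  move=> i j; apply: csm_ext (csmM (csm_cst ((-1) ^+ (j + i))) (csm_det _)).
    by move=> y _; rewrite mxE.
  move=> i' j'.
  by apply: csm_ext (mF (lift j i') (lift i j')) => y _; rewrite !mxE.
by apply: msm_ext mV => y Ay; rewrite /invmx uF.
Qed.

End ComplexElementary.

Section MatrixCoordinates.
Variables (R : realType) (n : nat).
Local Notation C := R[i].

Definition mx_of (v : 'rV[R]_(n * n + n * n)) : 'M[C]_n :=
  \matrix_(i, j) (v 0 (lshift _ (mxvec_index i j)) +i* v 0 (rshift _ (mxvec_index i j)))%C.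

Lemma mx_coordK : cancel (@mx_coord R n) mx_of.
Proof.
move=> A; apply/matrixP => i j.
by rewrite mxE /mx_coord row_mxEl row_mxEr !mxvecE !mxE; case: (A i j).
Qed.

Lemma mx_ofK : cancel mx_of (@mx_coord R n).
Proof.
move=> v; apply/rowP => l; rewrite /mx_coord; case: (split_ordP l) => l' ->.
  by rewrite row_mxEl; case/mxvec_indexP: l' => i j; rewrite mxvecE !mxE.
by rewrite row_mxEr; case/mxvec_indexP: l' => i j; rewrite mxvecE !mxE.
Qed.

Lemma mx_coord_image (S : set 'M[C]_n) : @mx_coord R n @` S = mx_of @^-1` S.
Proof.
apply/seteqP; split=> [_ [A SA <-]|v Sv]; first by rewrite /preimage /= mx_coordK.
by exists (mx_of v) => //; exact: mx_ofK.
Qed.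

Lemma msm_mx_of (A : set 'rV[R]_(n * n + n * n)) x : msm A x mx_of.
Proof.
move=> i j; split.
  by apply: esm_ext (esm_coord A x (lshift _ (mxvec_index i j))) => y _; rewrite mxE.
by apply: esm_ext (esm_coord A x (rshift _ (mxvec_index i j))) => y _; rewrite mxE.
Qed.

Lemma emap_mx_coord k (A : set 'rV[R]_k) (F : 'rV[R]_k -> 'M[C]_n) :
  (forall x, A x -> msm A x F) -> emap A (fun v => mx_coord (F v)).
Proof.
move=> mF x Ax l; rewrite /mx_coord; case: (split_ordP l) => l' ->.
  case/mxvec_indexP: l' => i j; apply: esm_ext (mF x Ax i j).1 => y _.
  by rewrite row_mxEl mxvecE mxE.
case/mxvec_indexP: l' => i j; apply: esm_ext (mF x Ax i j).2 => y _.
by rewrite row_mxEr mxvecE mxE.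
Qed.

Lemma open_det_neq0 k m (F : 'rV[R]_k -> 'M[C]_m) :
  (forall x, msm setT x F) -> open [set v | \det (F v) != 0].
Proof.
move=> mF.
have -> : [set v | \det (F v) != 0] =
    [set v | complex.Re (\det (F v)) ^+ 2 + complex.Im (\det (F v)) ^+ 2 != 0].
  apply/seteqP; split=> v /=; case: (\det (F v)) => a b /=.
    apply: contraNneq => /eqP.
    by rewrite paddr_eq0 ?sqr_ge0// !sqrf_eq0 => /andP[/eqP-> /eqP->].
  by apply: contraNneq => -[-> ->]; rewrite expr0n addr0.
apply: open_esm_neq0 => x; have [d1 d2] := csm_det (mF x).
exact: esmD (esmM d1 d1) (esmM d2 d2).
Qed.

End MatrixCoordinates.
(** * Transport of border vectors between spectral decompositions *)

Lemma sum_pick (V : nmodType) (I : eqType) (r : seq I) (P : pred I) (F : I -> V) p :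
  p \in r -> uniq r -> (forall q, q \in r -> q != p -> F q = 0) ->
  \sum_(q <- r | P q) F q = if P p then F p else 0.
Proof.
move=> pr ur F0; rewrite big_mkcond (bigD1_seq p)//= big1_seq ?addr0// => q.
by case/andP=> qp /F0 ->; rewrite // if_same.
Qed.

Section Transport.
Variable C : numClosedFieldType.

Definition sqn m (w : 'cV[C]_m) : C := (w^t* *m w) 0 0.

Definition nf m (r : C) (w : 'cV[C]_m) : 'cV[C]_m := sqrtC (r / sqn w) *: w.

Lemma sqn_gt0 m (w : 'cV[C]_m) : w != 0 -> 0 < sqn w.
Proof.
move=> w0; rewrite lt_def sqr_norm_ge0 andbT; apply: contraNneq w0 => w0.
exact/eqP/sqr_norm_eq0.
Qed.

Lemma sqnZ m (a : C) (w : 'cV[C]_m) : 0 <= a -> sqn (a *: w) = a ^+ 2 * sqn w.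
Proof.
move=> a0; rewrite /sqn adjZ (geC0_conj a0) -scalemxAl -scalemxAr scalerA.
by rewrite mxE expr2.
Qed.

Lemma sqn_nf m (r : C) (w : 'cV[C]_m) : 0 <= r -> w != 0 -> sqn (nf r w) = r.
Proof.
move=> r0 w0; have rw : 0 <= r / sqn w by rewrite divr_ge0 ?sqr_norm_ge0.
by rewrite sqnZ ?sqrtC_ge0// sqrtCK divfK ?gt_eqF ?sqn_gt0.
Qed.

(** [T] is only assumed to have the left inverse [T'], not to preserve norms: both rescalings have
    positive factors, so the result is a positive multiple of [v], and its norm decides. *)
Lemma nf_transport m n (r r' : C) (T : 'M[C]_(n, m)) (T' : 'M[C]_(m, n)) v :
  0 <= r -> r != 0 -> 0 <= r' -> r' != 0 -> sqn v = r -> T' *m T = 1%:M ->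
  nf r (T' *m nf r' (T *m v)) = v.
Proof.
move=> r0 rn0 r0' rn0' vr T'T.
have v0 : v != 0 by apply: contraNneq rn0 => v0; rewrite -vr v0 /sqn mulmx0 mxE.
have Tv0 : T *m v != 0.
  by apply: contraNneq v0 => h; rewrite -[v]mul1mx -T'T -mulmxA h mulmx0.
rewrite {2}/nf -scalemxAr mulmxA T'T mul1mx /nf; set a := sqrtC (_ / sqn (T *m v)).
have a0 : 0 < a by rewrite sqrtC_gt0 divr_gt0 ?sqn_gt0// lt_def rn0'.
rewrite sqnZ ?ltW// vr scalerA invfM mulrCA mulfV// mulr1 -exprVn sqrCK ?invr_ge0 ?ltW//.
by rewrite mulVf ?gt_eqF// scale1r.
Qed.

Definition swapz (z : seq (C * C)) := [seq (p.2, p.1) | p <- z].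

(** A list of pairs carries two spectra, [unzip1 z] and [unzip2 z], with corresponding eigenvalues
    at the same position. The condition makes it the graph of a bijection between the distinct
    eigenvalues. *)
Definition matched (z : seq (C * C)) :=
  forall p q, p \in z -> q \in z -> (p.1 == q.1) = (p.2 == q.2).

Lemma swapzK : involutive swapz.
Proof. by move=> z; rewrite /swapz -map_comp map_id_in// => -[]. Qed.

Lemma mem_swapz z p : (p \in swapz z) = ((p.2, p.1) \in z).
Proof.
have inj : injective (fun p : C * C => (p.2, p.1)) by move=> [a b] [c d] [-> ->].
by case: p => a b; rewrite -[RHS](mem_map inj).
Qed.

Lemma unzip1_swapz z : unzip1 (swapz z) = unzip2 z.
Proof. by rewrite /unzip1 /swapz -map_comp. Qed.

Lemma unzip2_swapz z : unzip2 (swapz z) = unzip1 z.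
Proof. by rewrite /unzip2 /swapz -map_comp. Qed.

Lemma undup_swapz z : undup (swapz z) = swapz (undup z).
Proof. by rewrite /swapz undup_map_inj// => -[a b] [c d] [-> ->]. Qed.

Lemma matched_swapz z : matched z -> matched (swapz z).
Proof. by move=> mz p q; rewrite !mem_swapz => pz qz; have := mz _ _ pz qz. Qed.

Lemma undup_unzip1 z : matched z -> undup (unzip1 z) = unzip1 (undup z).
Proof.
elim: z => //= p z IHz mz.
rewrite IHz => [|q q' qz q'z]; last by apply: mz; rewrite inE ?qz ?q'z orbT.
have [pz|pz] := boolP (p \in z); first by rewrite (map_f fst pz).
rewrite /=; case: mapP => // -[q qz pq]; case/negP: pz.
have : p.2 == q.2 by rewrite -mz ?mem_head ?inE ?qz ?orbT ?pq.
by move=> /eqP pq2; rewrite (surjective_pairing p) pq pq2 -surjective_pairing.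
Qed.

Lemma sum_unzip1 (V : nmodType) z (F : C -> V) : matched z ->
  \sum_(mu <- undup (unzip1 z)) F mu = \sum_(p <- undup z) F p.1.
Proof. by move=> mz; rewrite undup_unzip1// big_map. Qed.

Lemma count_unzip1 z p : matched z -> p \in z ->
  count_mem p.1 (unzip1 z) = count_mem p z.
Proof.
move=> mz pz; rewrite count_map; apply: eq_in_count => q qz /=.
by apply/eqP/eqP => [h|->//]; have /eqP := h; rewrite mz// => /eqP h'; rewrite (surjective_pairing q) (surjective_pairing p) h h'.
Qed.

Lemma count_unzip2 z p : matched z -> p \in z ->
  count_mem p.2 (unzip2 z) = count_mem p z.
Proof.
move=> mz pz; rewrite count_map; apply: eq_in_count => q qz /=.
by apply/eqP/eqP => [h|->//]; have /eqP := h; rewrite -mz// => /eqP h'; rewrite (surjective_pairing q) (surjective_pairing p) h h'.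
Qed.

Lemma mul_sproj_neq0 m s (y T T' : 'M[C]_m) b mu : has_spectrum s y ->
  T' *m T = 1%:M -> wt s y b mu != 0 -> T *m (sproj s y mu *m b) != 0.
Proof.
move=> sy T'T; apply: contraNneq => h.
by rewrite (wtE _ sy) -[_ *m b]mul1mx -T'T -mulmxA h !mulmx0 mxE.
Qed.

(** Components of target weight 0 are left out: they have to vanish, and the square root in [nf] is
    smooth only for nonzero data. *)
Definition transport m z (y T : 'M[C]_m) (r : C -> C) (b : 'cV[C]_m) : 'cV[C]_m :=
  \sum_(p <- undup z | r p.2 != 0) nf (r p.2) (T *m (sproj (unzip1 z) y p.1 *m b)).

Section TransportProperties.
Variables (m : nat) (z : seq (C * C)) (y y' T T' : 'M[C]_m).
Hypotheses (mz : matched z) (sy : has_spectrum (unzip1 z) y).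
Hypothesis sy' : has_spectrum (unzip2 z) y'.
Hypothesis Tz : forall p, p \in z ->
  T *m sproj (unzip1 z) y p.1 = sproj (unzip2 z) y' p.2 *m T.
Variables (r1 r2 : C -> C) (b : 'cV[C]_m).
Hypothesis r1P : forall p, p \in z -> wt (unzip1 z) y b p.1 = r1 p.1.
Hypothesis r2_ge0 : forall p, p \in z -> 0 <= r2 p.2.
Hypothesis r12 : forall p, p \in z -> (r1 p.1 != 0) = (r2 p.2 != 0).
Hypothesis T'T : T' *m T = 1%:M.
Local Notation P := (sproj (unzip1 z) y).
Local Notation P' := (sproj (unzip2 z) y').

Lemma transport_proj p : p \in z ->
  P' p.2 *m transport z y T r2 b =
  if r2 p.2 != 0 then nf (r2 p.2) (T *m (P p.1 *m b)) else 0.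
Proof.
move=> pz; rewrite /transport mulmx_sumr.
have PT q : q \in z -> P' p.2 *m (T *m (P q.1 *m b)) =
    if p == q then T *m (P q.1 *m b) else 0.
  move=> qz; have pq : (p.2 == q.2) = (p == q).
    by rewrite -[RHS]/((p.1 == q.1) && (p.2 == q.2)) mz// andbb.
  have wE : T *m (P q.1 *m b) = P' q.2 *m (T *m b) by rewrite mulmxA Tz// -mulmxA.
  by rewrite wE [LHS]mulmxA (sprojM sy') pq; case: (p =P q) => [->|_]; rewrite ?mul0mx.
have zp : p \in undup z by rewrite mem_undup.
rewrite (sum_pick _ zp (undup_uniq z)) => [|q]; last first.
  rewrite mem_undup => qz qp; rewrite /nf -[LHS]scalemxAr (PT q qz).
  by rewrite [p == q]eq_sym (negPf qp) scaler0.
case: ifP => // _; rewrite /nf -[LHS]scalemxAr (PT p pz) (eqxx p) //.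
Qed.

Let TPb_neq0 p : p \in z -> r2 p.2 != 0 -> T *m (P p.1 *m b) != 0.
Proof. by move=> pz; rewrite -r12// -r1P//; exact: mul_sproj_neq0 T'T. Qed.

Lemma wt_transport p : p \in z ->
  wt (unzip2 z) y' (transport z y T r2 b) p.2 = r2 p.2.
Proof.
move=> pz; rewrite (wtE _ sy') transport_proj//.
case: eqVneq => [->|r20]; first by rewrite mulmx0 mxE.
by rewrite -[LHS]/(sqn _) sqn_nf ?r2_ge0 ?TPb_neq0.
Qed.

(** Each eigenspace is treated by [nf_transport]; a component with [r1] zero is itself zero by
    [wt_eq0], in agreement with its omission. *)
Lemma transportK : (forall p, p \in z -> 0 <= r1 p.1) ->
  transport (swapz z) y' T' r1 (transport z y T r2 b) = b.
Proof.
move=> r1_ge0; rewrite {1}/transport undup_swapz /swapz big_map /= -/(swapz z).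
rewrite -[RHS]mul1mx -(sproj_sum sy) sum_unzip1// mulmx_suml [LHS]big_mkcond.
apply: eq_big_seq => p; rewrite mem_undup => pz /=.
rewrite unzip1_swapz transport_proj// -r12//.
case: eqVneq => [r10|r10]; last first.
  rewrite nf_transport ?r1_ge0 ?r2_ge0 -?r12//.
  by rewrite -[LHS](wtE _ sy) r1P.
by rewrite (wt_eq0 sy)// r1P.
Qed.

End TransportProperties.

End Transport.

Section BorderSet.
Variables (C : numClosedFieldType) (m : nat).
Variables (s s' : seq C) (B : set 'M[C]_m) (y0 : 'M[C]_m) (b0 : 'cV[C]_m) (c0 : C).
Hypotheses (HB : forall y, B y -> has_spectrum s y) (By0 : B y0).
Hypothesis sx0 : has_spectrum s' (bord y0 b0 c0).

Definition border_set : set 'M[C]_(m + 1) :=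
  [set x | has_spectrum s' x /\ B (ulsubmx x)].

Local Notation r := (wt s y0 b0).
Local Notation D := (diag_mx (\row_(i < m) s`_i)).

Let c0_real : c0^* = c0.
Proof. by have [_] := hermitian_bord (proj1 sx0); rewrite drsubmx_bord. Qed.

Let r_ge0 mu : 0 <= r mu.
Proof. exact: wt_ge0 (HB By0) mu. Qed.

Lemma border_setP x : border_set x <->
  [/\ x = bord (ulsubmx x) (ursubmx x) c0, B (ulsubmx x) &
      forall mu, mu \in s -> wt s (ulsubmx x) (ursubmx x) mu = r mu].
Proof.
split=> [[sx Bx]|[xE Bx wx]].
  have [_ cr xE] := hermitian_bord (proj1 sx).
  have sx' := sx; rewrite xE in sx'.
  have [ce we] := (bord_spectrum _ (HB Bx) (HB By0) cr sx0).1 sx'.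
  by split=> //; rewrite {1}xE ce.
split; last exact: Bx.
rewrite xE; exact/(bord_spectrum _ (HB Bx) (HB By0) c0_real sx0).
Qed.

Lemma has_spectrum_diag : has_spectrum s D.
Proof.
have [Q uQ yE] := spectrum_diag (HB By0).
have -> : D = Q *m y0 *m Q^t*.
  by rewrite yE !mulmxA (unitarymxP uQ) mul1mx -mulmxA (unitarymxP uQ) mulmx1.
exact: has_spectrum_conj uQ (HB By0).
Qed.

(** For every [Q] this intertwines the spectral projections of [D] and of [y]. With the matrix
    chosen in [border_trivialization] it equals that unitary at [yb], hence is invertible nearby;
    elsewhere it need not be unitary, and [nf] restores the norms. *)
Definition intertwiner Q y : 'M[C]_m :=
  \sum_(mu <- undup s) sproj s y mu *m (Q *m sproj s D mu).

Lemma border_trivialization yb : B yb -> exists Q : 'M[C]_m,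
  \det (intertwiner Q yb) != 0 /\
  forall y, has_spectrum s y -> forall mu,
    intertwiner Q y *m sproj s D mu = sproj s y mu *m intertwiner Q y.
Proof.
move=> /HB syb; have [Q uQ [_ PE]] := sproj_decomp syb.
have PQ mu : sproj s yb mu *m Q^t* = Q^t* *m sproj s D mu.
  rewrite sproj_diag => [|i]; last by rewrite mxE mem_nth// (has_spectrum_size syb).
  rewrite PE -mulmxA (unitarymxP uQ) mulmx1; congr (_ *m diag_mx _).
  by apply/rowP => i; rewrite !mxE.
exists (Q^t*); rewrite /intertwiner; split.
- rewrite (eq_bigr (fun mu => sproj s yb mu *m Q^t*)) => [|mu _]; last first.
    by rewrite -PQ mulmxA (sprojM syb) eqxx.
  rewrite -mulmx_suml (sproj_sum syb) mul1mx -unitfE -unitmxE.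
  by apply: unitarymx_unit; rewrite trmxC_unitary.
- move=> y sy mu; rewrite mulmx_suml mulmx_sumr; apply: eq_bigr => nu _.
  rewrite -[LHS]mulmxA -[Q^t* *m _ *m _]mulmxA (sprojM has_spectrum_diag).
  rewrite [RHS]mulmxA (sprojM sy) eq_sym.
  by case: (mu =P nu) => [->//|_]; rewrite !mulmx0 mul0mx.
Qed.

(** A unitary that conjugates [y0] to [y] carries [b0] to a border of [y] with the same weights. *)
Lemma border_set_surj y : B y -> exists b, border_set (bord y b c0).
Proof.
move=> By; have [Q uQ y0E] := spectrum_diag (HB By0).
have [Q' uQ' yE] := spectrum_diag (HB By).
pose V := Q'^t* *m Q.
have VV : V^t* *m V = 1%:M.
  by rewrite /V adjM trmxCK -mulmxA [Q' *m _]mulmxA (unitarymxP uQ') mul1mx unitary_adjl.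
have VV' : V *m V^t* = 1%:M by exact: mulmx1C.
have yV : y = V *m y0 *m V^t*.
  rewrite y0E yE /V adjM trmxCK !mulmxA -[_ *m Q *m Q^t*]mulmxA (unitarymxP uQ) mulmx1.
  by rewrite -[_ *m Q *m Q^t*]mulmxA (unitarymxP uQ) mulmx1.
exists (V *m b0); apply/border_setP; rewrite ulsubmx_bord ursubmx_bord; split=> //.
move=> mu _; rewrite /wt yV sproj_conj// -[in RHS](mul1mx (sproj _ _ _)) -VV.
have -> : b0^t* *m (V^t* *m V *m sproj s y0 mu) *m b0 =
    b0^t* *m (V^t* *m V *m sproj s y0 mu) *m (V^t* *m V *m b0).
  by rewrite VV !mul1mx.
by rewrite adjM !mulmxA.
Qed.

End BorderSet.
(** * The bundle of bordered matrices *)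

Section SmoothTransport.
Variable R : realType.
Local Notation C := R[i].

Lemma sqrtC_real (a : R) : 0 <= a -> sqrtC (a%:C%C : C) = (Num.sqrt a)%:C%C.
Proof.
move=> a0; have s0 : 0 <= (Num.sqrt a)%:C%C :> C by rewrite lecR sqrtr_ge0.
by rewrite -[in LHS](sqr_sqrtr a0) rmorphXn sqrCK.
Qed.

Lemma nonneg_real (c : C) : 0 <= c -> c = (complex.Re c)%:C%C.
Proof. by move=> c0; rewrite RRe_real// ger0_real. Qed.

Lemma msm_nf k (A : set 'rV[R]_k) x m (r : C) (w : 'rV[R]_k -> 'cV[C]_m) :
  A x -> 0 <= r -> r != 0 -> w x != 0 -> msm A x w -> msm A x (fun y => nf r (w y)).
Proof.
move=> Ax r0 rn0 wx0 mw; apply: msmZ => //.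
pose n v := complex.Re (r / sqn (w v)).
have nE v : r / sqn (w v) = (n v)%:C%C.
  by apply: nonneg_real; rewrite divr_ge0 ?sqr_norm_ge0.
have n0 v : 0 <= n v by rewrite -lecR -nE divr_ge0 ?sqr_norm_ge0.
apply: (@csm_ext _ _ _ _ (fun v => (Num.sqrt (n v))%:C%C)).
  by move=> v _; rewrite nE sqrtC_real.
apply: csm_real; apply: esm_sqrt => //.
  have : 0 < r / sqn (w x) by rewrite divr_gt0 ?sqn_gt0// lt_def rn0.
  by rewrite nE ltcR.
apply: (csmM (csm_cst _ _ r) _).1; apply: csmV => //.
  by rewrite gt_eqF// sqn_gt0.
exact: (msmM (msm_adj mw) mw 0 0).
Qed.

Lemma msm_transport m z k (A : set 'rV[R]_k) x (r2 : C -> C) (Y TT : 'rV[R]_k -> 'M[C]_m)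
    (B : 'rV[R]_k -> 'cV[C]_m) : A x ->
  (forall p, p \in z -> 0 <= r2 p.2) ->
  (forall p, p \in z -> r2 p.2 != 0 -> TT x *m (sproj (unzip1 z) (Y x) p.1 *m B x) != 0) ->
  msm A x Y -> msm A x TT -> msm A x B ->
  msm A x (fun v => transport z (Y v) (TT v) r2 (B v)).
Proof.
move=> Ax r2_ge0 TPb_neq0 mY mT mB.
(* The test [p \in z] does not change the sum and makes the hypotheses on pairs of [z] available to
   [msm_sum], which asks for all [p]. *)
pose F p v := if p \in z then
  nf (r2 p.2) (TT v *m (sproj (unzip1 z) (Y v) p.1 *m B v)) else 0.
apply: (@msm_ext _ _ _ _ _ _ (fun v => \sum_(p <- undup z | r2 p.2 != 0) F p v)).
  move=> v _; rewrite /transport [LHS]big_seq_cond [RHS]big_seq_cond.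
  by apply: eq_bigr => p /andP[]; rewrite mem_undup /F => ->.
apply: msm_sum => p r20; rewrite /F; have [pz|_] := boolP (p \in z); last exact: msm_cst.
apply: msm_nf => //; [exact: r2_ge0|by rewrite TPb_neq0|].
by apply: msmM => //; apply: msmM => //; exact: msm_sproj.
Qed.

End SmoothTransport.


Section VectorCoordinates.
Variables (R : realType) (m : nat).
Local Notation C := R[i].

Definition vec_coord (v : 'cV[C]_m) : 'rV[R]_(m + m) :=
  row_mx (\row_i complex.Re (v i 0)) (\row_i complex.Im (v i 0)).

Definition vec_of (z : 'rV[R]_(m + m)) : 'cV[C]_m :=
  \col_i (z 0 (lshift m i) +i* z 0 (rshift m i))%C.

Lemma vec_coordK : cancel vec_coord vec_of.
Proof.
move=> v; apply/colP => i; rewrite mxE /vec_coord row_mxEl row_mxEr !mxE.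
by case: (v i 0).
Qed.

Lemma vec_ofK : cancel vec_of vec_coord.
Proof.
move=> z; apply/rowP => l; rewrite /vec_coord; case: (split_ordP l) => l' ->.
  by rewrite row_mxEl !mxE.
by rewrite row_mxEr !mxE.
Qed.

Lemma msm_vec_of k (A : set 'rV[R]_k) x (f : 'rV[R]_k -> 'rV[R]_(m + m)) :
  A x -> emap A f -> msm A x (fun v => vec_of (f v)).
Proof.
move=> Ax ef i j; split.
  by apply: esm_ext (ef x Ax (lshift m i)) => y _; rewrite mxE.
by apply: esm_ext (ef x Ax (rshift m i)) => y _; rewrite mxE.
Qed.

Lemma emap_vec_coord k (A : set 'rV[R]_k) (F : 'rV[R]_k -> 'cV[C]_m) :
  (forall x, A x -> msm A x F) -> emap A (fun v => vec_coord (F v)).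
Proof.
move=> mF x Ax l; rewrite /vec_coord; case: (split_ordP l) => l' ->.
  by apply: esm_ext (mF x Ax l' 0).1 => y _; rewrite row_mxEl mxE.
by apply: esm_ext (mF x Ax l' 0).2 => y _; rewrite row_mxEr mxE.
Qed.

Lemma msm_mx_of_comp k (A : set 'rV[R]_k) x (f : 'rV[R]_k -> 'rV[R]_(m * m + m * m)) :
  A x -> emap A f -> msm A x (fun v => mx_of (f v)).
Proof.
move=> Ax ef i j; split.
  by apply: esm_ext (ef x Ax (lshift _ (mxvec_index i j))) => y _; rewrite mxE.
by apply: esm_ext (ef x Ax (rshift _ (mxvec_index i j))) => y _; rewrite mxE.
Qed.

End VectorCoordinates.

Section Bundle.
Variables (R : realType) (m : nat).
Local Notation C := R[i].
Variables (s s' : seq C) (B : set 'M[C]_m) (y0 : 'M[C]_m) (b0 : 'cV[C]_m) (c0 : C).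
Hypotheses (HB : forall y, B y -> has_spectrum s y) (By0 : B y0).
Hypothesis sx0 : has_spectrum s' (bord y0 b0 c0).

Local Notation r := (wt s y0 b0).
Local Notation D := (diag_mx (\row_(i < m) s`_i)).
Local Notation border_set := (border_set s' B).

(** The border vectors over the diagonal matrix [D], whose eigenspaces are coordinate subspaces, in
    place of those over a point of the base. *)
Definition model_fiber : set 'rV[R]_(m + m) :=
  [set v | forall mu, mu \in s -> wt s D (vec_of v) mu = r mu].

Let r_ge0 mu : 0 <= r mu.
Proof. exact: wt_ge0 (HB By0) mu. Qed.

(** The trivialization transports between two matrices of equal spectrum, so every eigenvalue is
    paired with itself. *)
Let zz := [seq (mu, mu) | mu <- s].

Let zz1 : unzip1 zz = s.
Proof. by rewrite /zz /unzip1 -map_comp map_id_in. Qed.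

Let zz2 : unzip2 zz = s.
Proof. by rewrite /zz /unzip2 -map_comp map_id_in. Qed.

Let swapzz : swapz zz = zz.
Proof. by rewrite /swapz /zz -map_comp. Qed.

Let zz_matched : matched zz.
Proof. by move=> p q /mapP[mu _ ->] /mapP[nu _ ->]. Qed.

Let zz_mem p : p \in zz -> p.1 = p.2 /\ p.2 \in s.
Proof. by move=> /mapP[mu ? ->]. Qed.

Variables (dF : nat) (F : set 'rV[R]_dF) (f : 'rV[R]_(m + m) -> 'rV[R]_dF)
  (g : 'rV[R]_dF -> 'rV[R]_(m + m)).
Hypotheses (fg : ediff model_fiber F f g).

Let CE := @mx_coord R (m + 1) @` border_set.
Let CB := @mx_coord R m @` B.

Definition border_proj (v : 'rV[R]_((m + 1) * (m + 1) + (m + 1) * (m + 1))) :=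
  mx_coord (ulsubmx (mx_of v)).

Lemma emap_border_proj A : emap A border_proj.
Proof.
by apply: emap_mx_coord => x _; apply: msm_ulsubmx; exact: msm_mx_of.
Qed.

Lemma border_bundle b : CB b ->
  exists (U : set 'rV[R]_(m * m + m * m)) phi psi,
    [/\ open U, U b,
        ediff (CE `&` border_proj @^-1` U)
          [set z | (CB `&` U) (lsubmx z) /\ F (rsubmx z)] phi psi
      & forall x, CE x -> U (border_proj x) -> lsubmx (phi x) = border_proj x].
Proof.
case: fg => ef eg fP gP; rewrite /CE /CB !mx_coord_image => Bb.
have [Q [W0 WP]] := border_trivialization HB By0 Bb.
set W := intertwiner s Q in W0 WP.
have mW k (A : set 'rV[R]_k) x (Y : 'rV[R]_k -> 'M[C]_m) :
    msm A x Y -> msm A x (fun v => W (Y v)).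
  move=> mY; apply: msm_sum => mu _; apply: msmM; last exact: msm_cst.
  exact: msm_sproj.
pose U := [set v : 'rV[R]_(m * m + m * m) | \det (W (mx_of v)) != 0].
have oU : open U.
  by apply: open_det_neq0 => x; apply: mW; exact: msm_mx_of.
(* [th] moves the border over the upper left block to one over [D] by the inverse of the
   intertwiner, and [ht] moves it back; [transportK] makes them mutually inverse. *)
pose th (x : 'M[C]_(m + 1)) := transport zz (ulsubmx x) (invmx (W (ulsubmx x))) r (ursubmx x).
pose ht y v := transport zz D (W y) r v.
have Wu v : U v -> W (mx_of v) \in unitmx by rewrite unitmxE unitfE.
have thP x : B (ulsubmx x) -> border_set x -> W (ulsubmx x) \in unitmx ->
    (forall mu, mu \in s -> wt s D (th x) mu = r mu) /\
    ht (ulsubmx x) (th x) = ursubmx x.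
  move=> Bx /(border_setP HB By0 sx0)[_ _ wx] uW; have sy := HB Bx.
  have TP p : p \in zz -> invmx (W (ulsubmx x)) *m sproj (unzip1 zz) (ulsubmx x) p.1 =
      sproj (unzip2 zz) D p.2 *m invmx (W (ulsubmx x)).
    move=> /zz_mem[-> _]; rewrite zz1 zz2.
    by rewrite -[LHS](mulmxK uW) -[_ *m W _]mulmxA -(WP _ sy) mulKmx.
  have wz p : p \in zz -> wt (unzip1 zz) (ulsubmx x) (ursubmx x) p.1 = r p.1.
    by move=> /zz_mem[-> ps]; rewrite zz1 wx.
  have sy1 : has_spectrum (unzip1 zz) (ulsubmx x) by rewrite zz1.
  have sD2 : has_spectrum (unzip2 zz) D by rewrite zz2; exact: has_spectrum_diag HB By0.
  have rz p : p \in zz -> (r p.1 != 0) = (r p.2 != 0) by move=> /zz_mem[-> _].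
  split=> [mu mus|].
    have pz : (mu, mu) \in zz by exact: map_f.
    have := wt_transport zz_matched sy1 sD2 TP wz (fun p _ => r_ge0 p.2) rz (mulmxV uW) pz.
    by rewrite zz2.
  have := transportK zz_matched sy1 sD2 TP wz (fun p _ => r_ge0 p.2) rz (mulmxV uW)
    (fun p _ => r_ge0 p.1).
  by rewrite swapzz.
have htP y v : B y -> W y \in unitmx -> (forall mu, mu \in s -> wt s D v mu = r mu) ->
    (forall mu, mu \in s -> wt s y (ht y v) mu = r mu) /\
    th (bord y (ht y v) c0) = v.
  move=> By uW wv; have sy := HB By.
  have TP p : p \in zz -> W y *m sproj (unzip1 zz) D p.1 =
      sproj (unzip2 zz) y p.2 *m W y.
    by move=> /zz_mem[-> _]; rewrite zz1 zz2 WP.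
  have wz p : p \in zz -> wt (unzip1 zz) D v p.1 = r p.1.
    by move=> /zz_mem[-> ps]; rewrite zz1 wv.
  have sy1 : has_spectrum (unzip2 zz) y by rewrite zz2.
  have sD2 : has_spectrum (unzip1 zz) D by rewrite zz1; exact: has_spectrum_diag HB By0.
  have rz p : p \in zz -> (r p.1 != 0) = (r p.2 != 0) by move=> /zz_mem[-> _].
  split=> [mu mus|].
    have pz : (mu, mu) \in zz by exact: map_f.
    have := wt_transport zz_matched sD2 sy1 TP wz (fun p _ => r_ge0 p.2) rz (mulVmx uW) pz.
    by rewrite zz2.
  have := transportK zz_matched sD2 sy1 TP wz (fun p _ => r_ge0 p.2) rz (mulVmx uW)
    (fun p _ => r_ge0 p.1).
  by rewrite swapzz /th ulsubmx_bord ursubmx_bord.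
exists U, (fun v => row_mx (border_proj v) (f (vec_coord (th (mx_of v))))),
  (fun u => mx_coord (bord (mx_of (lsubmx u)) (ht (mx_of (lsubmx u))
    (vec_of (g (rsubmx u)))) c0)); split; [exact: oU|exact: W0| |]; last first.
  by move=> x _ _; rewrite row_mxKl.
pose CEU := [set v | border_set (mx_of v)] `&` border_proj @^-1` U.
have eth : emap CEU (fun v => vec_coord (th (mx_of v))).
  apply: emap_vec_coord => v [Ev Uv].
  have mul : msm CEU v (fun w => ulsubmx (mx_of w)) by apply/msm_ulsubmx/msm_mx_of.
  have uW w : CEU w -> W (ulsubmx (mx_of w)) \in unitmx.
    by move=> [_ /Wu]; rewrite mx_coordK.
  have CEUv : CEU v by [].
  apply: msm_transport => //.
  - move=> p pz; have [p12 ps] := zz_mem pz.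
    have [_ Bx wx] := (border_setP HB By0 sx0 _).1 Ev.
    rewrite zz1 p12 -wx//.
    apply: mul_sproj_neq0 (mulmxV (uW v CEUv)); exact: HB.
  - by apply: msm_invmx => //; exact: mW.
  - by apply/msm_ursubmx/msm_mx_of.
have thF v : CEU v -> model_fiber (vec_coord (th (mx_of v))).
  move=> [Ev Uv]; have [_ Bx _] := (border_setP HB By0 sx0 _).1 Ev.
  have uW : W (ulsubmx (mx_of v)) \in unitmx by have := Wu _ Uv; rewrite mx_coordK.
  by move=> mu mus; rewrite vec_coordK; case: (thP _ Bx Ev uW) => ->.
pose CBF := [set z | ((@mx_of R m @^-1` B) `&` U) (lsubmx z) /\ F (rsubmx z)].
split.
- apply: emap_row_mx; first exact: emap_border_proj.
  exact: emap_comp eth thF ef.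
- apply: emap_mx_coord => u [[Bu Uu] Fu].
  have CBFu : CBF u by [].
  have ml : msm CBF u (fun u => mx_of (lsubmx u)).
    by apply: msm_mx_of_comp => //; exact: emap_lsubmx.
  have mh : msm CBF u (fun u => ht (mx_of (lsubmx u)) (vec_of (g (rsubmx u)))).
    apply: msm_transport => //.
    + move=> p pz; have [p12 ps] := zz_mem pz; rewrite zz1 p12.
      have [gu _] := gP _ Fu; rewrite -(gu _ ps).
      apply: mul_sproj_neq0 (mulVmx (Wu _ Uu)); exact: has_spectrum_diag HB By0.
    + exact: msm_cst.
    + exact: mW.
    + apply: msm_vec_of => //; apply: emap_comp (@emap_rsubmx _ _ _ _) _ eg.
      by move=> w [].
  apply: msm_block => //; [exact: msm_adj|exact: msm_cst].
- move=> v [Ev Uv]; have [xE Bx wx] := (border_setP HB By0 sx0 _).1 Ev.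
  have uW : W (ulsubmx (mx_of v)) \in unitmx by have := Wu _ Uv; rewrite mx_coordK.
  have [Fth gf] := fP _ (thF v (conj Ev Uv)).
  split.
    rewrite /= row_mxKl row_mxKr; split; last exact: Fth.
    by split; [rewrite /preimage /= mx_coordK; exact: Bx|exact: Uv].
  rewrite row_mxKl row_mxKr.
  rewrite gf vec_coordK /border_proj mx_coordK.
  have [_ ->] := thP _ Bx Ev uW.
  by rewrite -xE mx_ofK.
- move=> u [[Bu Uu] Fu]; have uW := Wu _ Uu; have [gu fgu] := gP _ Fu.
  have [wy thy] := htP _ _ Bu uW gu.
  split; last first.
    by rewrite /border_proj !mx_coordK !ulsubmx_bord mx_ofK thy vec_ofK fgu hsubmxK.
  split.
    rewrite /preimage /mkset mx_coordK; apply/(border_setP HB By0 sx0).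
    by rewrite ulsubmx_bord ursubmx_bord; split; [|exact: Bu|exact: wy].
  by rewrite /preimage /mkset /border_proj mx_coordK ulsubmx_bord mx_ofK; exact: Uu.
Qed.

Hypothesis mF : emanifold F.

Lemma emanifold_border : emanifold CB -> emanifold CE.
Proof.
move=> mB; have [d hd] := emanifold_prod mB mF; exists d => v Ev.
have Bv : CB (border_proj v).
  by move: Ev; rewrite /CE /CB !mx_coord_image /preimage /= mx_coordK => -[].
have [U [phi [psi [oU Uv e lp]]]] := border_bundle Bv.
have [O [oO OP]] := emap_rel_open (@emap_border_proj setT) oU.
have oV : open (@prodset R _ dF U setT) by apply: open_prodset => //; exact: openT.
have eE : CE `&` border_proj @^-1` U = CE `&` O.
  by apply/seteqP; split=> w [Ew /(OP w I) ?].
have eF : [set z | (CB `&` U) (lsubmx z) /\ F (rsubmx z)] =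
    prodset CB F `&` prodset U setT.
  by apply/seteqP; split=> z [[h1 h2] h3]; split=> //; split=> //; case: h3.
rewrite eE eF in e.
have Ov : O v by apply/(OP v I).
apply: (chart_ediff oO Ev Ov oV e); apply: hd.
by have [_ _ /(_ v (conj Ev Ov))[[]]] := e.
Qed.

Lemma border_fiber_bundle : emanifold CB ->
  @fiber_bundle R (EuclSet CE) (EuclSet CB) (EuclSet F) border_proj.
Proof.
move=> mB; split.
- split; apply: emanifold_manifold => //; exact: emanifold_border.
- exact/emap_smooth/emap_border_proj.
- rewrite /CE /CB /= !mx_coord_image; apply/seteqP; split=> [_ [v [_ Bv] <-]|u Bu].
    by rewrite /border_proj /preimage /= mx_coordK.
  have [b Eb] := border_set_surj HB By0 sx0 Bu.
  exists (mx_coord (bord (mx_of u) b c0)); first by rewrite /preimage /= mx_coordK.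
  by rewrite /border_proj mx_coordK ulsubmx_bord mx_ofK.
- move=> b /border_bundle[U [phi [psi [oU Ub e lp]]]].
  by exists U, phi, psi; split=> //; exact: ediff_diffeo.
Qed.

End Bundle.
(** * Products of spheres *)

Section Spheres.
Variable R : realType.

Lemma open_esm_gt0 m (f : 'rV[R]_m -> R) :
  (forall x, esm setT x f) -> open [set x | 0 < f x].
Proof.
move=> ef; rewrite openE => x /= fx0.
have [t [dt ft]] := ef x.
have tx0 : 0 < ev t x by rewrite -(nbhs_singleton ft).
by apply: filterS2 ft (near_gt0 (ev_continuous dt) tx0) => y /(_ I) h; rewrite /= h.
Qed.

Lemma esm_sqsum m (A : set 'rV[R]_m) x (I : Type) (s : seq I) (P : pred I)
    (F : I -> 'rV[R]_m -> R) :
  (forall i, P i -> esm A x (F i)) ->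
  esm A x (fun y => \sum_(i <- s | P i) F i y ^+ 2).
Proof. by move=> eF; apply: esm_sum => i Pi; apply: esmM; exact: eF. Qed.

(** Hemisphere charts: some coordinate [x 0 i] is nonzero, and on the half where [y 0 i] has its
    sign the other coordinates determine [y]. *)
Lemma emanifold_sphere d : emanifold (eset_set (sphere R d)).
Proof.
exists d => x /= Sx.
have [i xi0] : exists i, x 0 i != 0.
  apply: contrapT => /forallNP h.
  have := Sx; rewrite big1 => [/eqP|i _]; first by rewrite eq_sym oner_eq0.
  by have /negP/negPn/eqP -> := h i; rewrite expr0n.
pose q (w : 'rV[R]_d) := \sum_j w 0 j ^+ 2.
pose g (w : 'rV[R]_d) : 'rV[R]_d.+1 := \row_k
  if unlift i k is Some j then w 0 j else Num.sg (x 0 i) * Num.sqrt (1 - q w).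
have sumE (y : 'rV[R]_d.+1) : \sum_j y 0 j ^+ 2 =
    y 0 i ^+ 2 + q (\row_j y 0 (lift i j)).
  rewrite (bigD1_ord i)//=; congr (_ + _).
  by apply: eq_bigr => j _; rewrite mxE.
exists [set y | 0 < y 0 i * x 0 i], [set w | 0 < 1 - q w],
  (fun y => \row_j y 0 (lift i j)), g; split.
- apply: open_esm_gt0 => y; apply: esmM; [exact: esm_coord|exact: esm_cst].
- by rewrite /= -expr2 lt_def sqr_ge0 sqrf_eq0 xi0.
- apply: open_esm_gt0 => y; apply: esmB; first exact: esm_cst.
  by apply: esm_sqsum => j _; exact: esm_coord.
split.
- move=> y _ j; apply: esm_ext (esm_coord _ y (lift i j)) => w _.
  by rewrite mxE.
- move=> w Ww k; rewrite /g.
  case: (unliftP i k) => [j ->|->].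
    by apply: esm_ext (esm_coord _ w j) => v _; rewrite mxE liftK.
  have e1 : esm [set w | 0 < 1 - q w] w (fun w => 1 - q w).
    apply: esmB; first exact: esm_cst.
    by apply: (@esm_sqsum _ _ _ _ _ xpredT) => j _; exact: esm_coord.
  apply: esm_ext (esmM (esm_cst _ w (Num.sg (x 0 i))) (esm_sqrt Ww Ww e1)) => v _.
  by rewrite mxE unlift_none.
- move=> y [/= Sy yx].
  have y0 : 0 < y 0 i ^+ 2.
    by rewrite lt_def sqr_ge0 sqrf_eq0 andbT; apply: contraTneq yx => ->; rewrite mul0r ltxx.
  have qE : 1 - q (\row_j y 0 (lift i j)) = y 0 i ^+ 2 by rewrite -Sy sumE addrK.
  split; first by rewrite qE.
  apply/rowP => k; rewrite mxE; case: (unliftP i k) => [j ->|->]; first by rewrite mxE.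
  rewrite qE sqrtr_sqr.
  have -> : Num.sg (x 0 i) = Num.sg (y 0 i).
    case: (ltrgt0P (x 0 i)) yx => [x0|x0|->]; rewrite ?mulr0 ?ltxx//.
      by rewrite pmulr_lgt0// => y0'; rewrite !gtr0_sg.
    by rewrite nmulr_lgt0// => y0'; rewrite !ltr0_sg.
  by rewrite -numEsg.
- move=> w /= Ww.
  have gw : \row_j g w 0 (lift i j) = w.
    by apply/rowP => j; rewrite !mxE liftK.
  have gi : g w 0 i = Num.sg (x 0 i) * Num.sqrt (1 - q w) by rewrite mxE unlift_none.
  split; last exact: gw.
  split; last first.
    rewrite /= gi mulrAC pmulr_lgt0 ?sqrtr_gt0//.
    by rewrite -normrEsg normr_gt0.
  rewrite /= sumE gw gi exprMn sqr_sqrtr ?ltW//.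
  by rewrite sqr_sg xi0 mul1r subrK.
Qed.

Lemma emanifold_prod_spheres d ds : emanifold (eset_set (prod_spheres R d ds)).
Proof.
elim: ds d => [|d' ds IHds] d; first exact: emanifold_sphere.
exact: emanifold_prod (emanifold_sphere d) (IHds d').
Qed.

Section SphereProduct.
Variables (N : nat) (T : eqType) (cl : 'I_N -> T) (r : T -> R) (dd : T -> nat).
Hypothesis ddP : forall mu, (0 < r mu) -> #|[set l | cl l == mu]%SET| = (dd mu).+1.

(** A product of spheres inside one coordinate space, with the coordinates grouped by [cl]. The
    vanishing outside [s] stands for the spheres of radius 0. *)
Definition class_spheres (s : seq T) : set 'rV[R]_N :=
  [set z | (forall mu, mu \in s -> \sum_(l | cl l == mu) z 0 l ^+ 2 = r mu) /\
           forall l, cl l \notin s -> z 0 l = 0].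

Lemma class_enum mu : 0 < r mu -> exists e : 'I_(dd mu).+1 -> 'I_N,
  [/\ injective e, forall j, cl (e j) = mu & forall l, cl l = mu -> exists j, l = e j].
Proof.
move=> /ddP cd; exists (fun j => enum_val (cast_ord (esym cd) j)); split.
- by move=> j j' /enum_val_inj/cast_ord_inj.
- by move=> j; have := enum_valP (cast_ord (esym cd) j); rewrite inE => /eqP.
- move=> l lmu; have lA : l \in [set l | cl l == mu]%SET by rewrite inE lmu.
  exists (cast_ord cd (enum_rank_in lA l)); rewrite cast_ordK.
  by rewrite enum_rankK_in.
Qed.

Lemma class_sum mu (e : 'I_(dd mu).+1 -> 'I_N) (F : 'I_N -> R) : injective e ->
  (forall j, cl (e j) = mu) -> (forall l, cl l = mu -> exists j, l = e j) ->
  \sum_(l | cl l == mu) F l = \sum_j F (e j).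
Proof.
move=> ie ce se.
rewrite (reindex_omap e (fun l => [pick j | e j == l])) => [|l /eqP /se[j ->]].
  apply: eq_bigl => j; rewrite ce eqxx /=; case: pickP => [j' /eqP/ie ->|/(_ j)].
    by rewrite eqxx.
  by rewrite eqxx.
by case: pickP => [j' /eqP/ie ->//|/(_ j)]; rewrite eqxx.
Qed.

(** Induction over the classes. For one class, [f] extracts its coordinates and divides by the
    radius, and [g] puts them back with zeros elsewhere. *)
Lemma class_spheres_diff s mu : uniq (mu :: s) -> all (fun mu => 0 < r mu) (mu :: s) ->
  exists f g,
    ediff (class_spheres (mu :: s)) (eset_set (prod_spheres R (dd mu) (map dd s))) f g.
Proof.
have fgP nu : 0 < r nu -> exists (f : 'rV[R]_N -> 'rV[R]_(dd nu).+1)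
    (g : 'rV[R]_(dd nu).+1 -> 'rV[R]_N),
  [/\ forall A, emap A f, forall A, emap A g,
      forall z : 'rV[R]_N, \sum_(l | cl l == nu) z 0 l ^+ 2 = r nu ->
        \sum_j f z 0 j ^+ 2 = 1 /\ forall l, cl l = nu -> g (f z) 0 l = z 0 l,
      forall w : 'rV[R]_(dd nu).+1, \sum_j w 0 j ^+ 2 = 1 ->
        \sum_(l | cl l == nu) g w 0 l ^+ 2 = r nu
    & (forall w l, cl l != nu -> g w 0 l = 0) /\
      forall w (z : 'rV[R]_N), (forall l, cl l = nu -> z 0 l = g w 0 l) -> f z = w].
  move=> r0; have [e [ie ce se]] := class_enum r0.
  have s0 : Num.sqrt (r nu) != 0 by rewrite gt_eqF// sqrtr_gt0.
  pose f (z : 'rV[R]_N) : 'rV[R]_(dd nu).+1 := \row_j (z 0 (e j) / Num.sqrt (r nu)).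
  pose g (w : 'rV[R]_(dd nu).+1) : 'rV[R]_N :=
    \row_l \sum_j (Num.sqrt (r nu) * (e j == l)%:R) * w 0 j.
  have gE w j : g w 0 (e j) = Num.sqrt (r nu) * w 0 j.
    rewrite mxE (bigD1 j)//= eqxx mulr1 big1 ?addr0// => j' jj'.
    by rewrite (inj_eq ie) (negPf jj') mulr0 mul0r.
  exists f, g; split.
  - move=> A x _ j.
    by apply: esm_ext (esmM (esm_coord A x (e j)) (esm_cst A x _)) => y _; rewrite mxE.
  - move=> A x _ l.
    apply: (@esm_ext _ _ _ _ (fun w => \sum_j (Num.sqrt (r nu) * (e j == l)%:R) * w 0 j)).
      by move=> y _; rewrite mxE.
    by apply: esm_sum => j _; apply: esmM; [exact: esm_cst|exact: esm_coord].
  - move=> z; rewrite (class_sum _ ie ce se) => zE; split.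
      under eq_bigr do rewrite mxE expr_div_n.
      by rewrite -mulr_suml zE sqr_sqrtr ?ltW// divff// gt_eqF.
    by move=> l /se[j ->]; rewrite gE mxE mulrC divfK.
  - move=> w wE; rewrite (class_sum _ ie ce se).
    under eq_bigr do rewrite gE exprMn.
    by rewrite -mulr_sumr wE mulr1 sqr_sqrtr// ltW.
  split=> [w l lnu|w z zE].
    rewrite mxE big1// => j _; case: eqP => [ejl|_]; last by rewrite mulr0 mul0r.
    by case/eqP: lnu; rewrite -ejl ce.
  by apply/rowP => j; rewrite mxE zE// gE mulrC mulKf.
elim: s mu => [|nu s IHs] mu us rs.
  have r0 : 0 < r mu by case/andP: rs.
  have [f [g [ef eg fP gP [g0 fg]]]] := fgP mu r0; exists f, g; split.
  - exact: ef.
  - exact: eg.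
  - move=> z [zE z0]; have [fz gf] := fP z (zE mu (mem_head _ _)).
    split=> //; apply/rowP => l; have [/gf//|lmu] := eqVneq (cl l) mu.
    by rewrite g0// z0// inE.
  - move=> w Sw; split; last by apply: fg.
    split=> [nu|l]; rewrite inE; first by move=> /eqP ->; exact: gP.
    exact: g0.
have r0 : 0 < r mu by case/andP: rs.
have [f [g [ef eg fP gP [g0 fg]]]] := fgP mu r0.
have [f' [g' [ef' eg' fP' gP']]] : exists f g, ediff (class_spheres (nu :: s))
    (eset_set (prod_spheres R (dd nu) (map dd s))) f g.
  by apply: IHs; [case/andP: us|case/andP: rs].
have mus : mu \notin nu :: s by case/andP: us.
(* [h] erases the class [mu], so that the rest lies in the product over the remaining classes. *)
pose h (z : 'rV[R]_N) : 'rV[R]_N := \row_l if cl l == mu then 0 else z 0 l.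
have eh A : emap A h.
  move=> x _ l; case: (boolP (cl l == mu)) => lmu.
    by apply: esm_ext (esm_cst _ _ 0) => y _; rewrite mxE lmu.
  by apply: esm_ext (esm_coord _ _ l) => y _; rewrite mxE (negPf lmu).
have hP z : class_spheres [:: mu, nu & s] z -> class_spheres (nu :: s) (h z).
  move=> [zE z0]; split=> [k ks|l ls].
    rewrite -zE ?inE; last by rewrite -in_cons ks orbT.
    apply: eq_bigr => l /eqP lk; rewrite mxE; case: eqP => // lmu.
    by case/negP: mus; rewrite -lmu lk.
  by rewrite mxE; case: eqP => // /eqP lmu; rewrite z0// in_cons negb_or lmu.
exists (fun z => row_mx (f z) (f' (h z))), (fun u => g (lsubmx u) + g' (rsubmx u)).
split.
- by apply: emap_row_mx; [exact: ef|exact: emap_comp (eh _) hP ef'].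
- move=> u [Su Pu] l.
  have e1 : esm (eset_set (prod_spheres R (dd mu) (map dd (nu :: s)))) u
      (fun u => g (lsubmx u) 0 l).
    apply: (@esm_comp _ _ _ _ setT (@lsubmx R 1 _ _) (fun w => g w 0 l)) => //.
      exact: emap_lsubmx.
    exact: eg.
  have e2 : esm (eset_set (prod_spheres R (dd mu) (map dd (nu :: s)))) u
      (fun u => g' (rsubmx u) 0 l).
    apply: (@esm_comp _ _ _ _ (eset_set (prod_spheres R (dd nu) (map dd s)))
      (@rsubmx R 1 _ _) (fun w => g' w 0 l)) => //; last exact: eg'.
      exact: emap_rsubmx.
    by move=> v [].
  by apply: esm_ext (esmD e1 e2) => v _; rewrite mxE.
- move=> z Xz; have [fz gf] := fP z (Xz.1 mu (mem_head _ _)).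
  have [Pz gfz] := fP' _ (hP z Xz).
  rewrite /= row_mxKl row_mxKr; split=> //.
  apply/rowP => l; rewrite mxE gfz mxE; case: eqP => [/gf ->|/eqP lmu].
    by rewrite addr0.
  by rewrite g0// add0r.
- move=> u [Su Pu]; have [[gE gz] fgu] := gP' _ Pu.
  have gmu l : cl l = mu -> g' (rsubmx u) 0 l = 0 by move=> lmu; rewrite gz// lmu.
  split.
    split=> [k|l].
      rewrite in_cons => /predU1P[->|ks].
        rewrite -[RHS](gP _ Su); apply: eq_bigr => l /eqP lmu.
        by rewrite mxE gmu// addr0.
      rewrite -[RHS](gE _ ks); apply: eq_bigr => l /eqP lk.
      rewrite mxE g0 ?add0r// lk; apply: contraNneq mus => <- //.
    by rewrite in_cons negb_or => /andP[lmu ls]; rewrite mxE g0// gz// addr0.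
  rewrite (fg (lsubmx u)) => [|l lmu]; last by rewrite mxE gmu// addr0.
  have -> : h (g (lsubmx u) + g' (rsubmx u)) = g' (rsubmx u).
    apply/rowP => l; rewrite !mxE; case: eqP => [/gmu ->//|/eqP lmu].
    by rewrite g0// add0r.
  by rewrite fgu hsubmxK.
Qed.

Lemma class_spheres_filter s : (forall mu, 0 <= r mu) ->
  (forall l, cl l \in s) ->
  class_spheres [seq mu <- undup s | 0 < r mu] =
  [set z | forall mu, mu \in s -> \sum_(l | cl l == mu) z 0 l ^+ 2 = r mu].
Proof.
move=> r0 cls; apply/seteqP; split=> z /=.
  move=> [zE z0] mu mus; have [rmu|rmu] := boolP (0 < r mu).
    by apply: zE; rewrite mem_filter rmu mem_undup.
  have -> : r mu = 0 by apply: le_anti; rewrite r0 leNgt rmu.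
  rewrite big1// => l /eqP lmu; rewrite z0 ?expr0n// mem_filter lmu (negPf rmu) //.
move=> zE; split=> [mu|l]; first by rewrite mem_filter mem_undup => /andP[_]; exact: zE.
rewrite mem_filter mem_undup cls andbT -leNgt => rl.
have /eqP := zE _ (cls l); have -> : r (cl l) = 0 by apply: le_anti; rewrite r0 rl.
rewrite psumr_eq0 => [/allP/(_ l (mem_index_enum _))|i _]; last exact: sqr_ge0.
by rewrite eqxx /= sqrf_eq0 => /eqP.
Qed.

Lemma class_spheres_nil : class_spheres [::] = [set 0].
Proof.
apply/seteqP; split=> [z [_ z0]|_ ->]; last by split=> // l _; rewrite mxE.
by apply/rowP => l; rewrite mxE z0.
Qed.

End SphereProduct.

End Spheres.

(** * Odd spheres in the model fiber *)

Section ModelFiber.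
Variables (R : realType) (m : nat).
Local Notation C := R[i].
Variables (s : seq C) (y0 : 'M[C]_m) (b0 : 'cV[C]_m).
Hypothesis sy0 : has_spectrum s y0.
Local Notation D := (diag_mx (\row_(i < m) s`_i) : 'M[C]_m).

(** The real and the imaginary part of entry [i] both belong to the eigenvalue at [i]. A class thus
    has twice as many coordinates as the multiplicity, which is why the spheres have odd
    dimension. *)
Definition coord_eig (l : 'I_(m + m)) : C :=
  match fintype.split l with inl i => s`_i | inr i => s`_i end.

Lemma coord_eigl i : coord_eig (lshift m i) = s`_i.
Proof. by rewrite /coord_eig -[lshift m i]/(unsplit (inl i)) unsplitK. Qed.

Lemma coord_eigr i : coord_eig (rshift m i) = s`_i.
Proof. by rewrite /coord_eig -[rshift m i]/(unsplit (inr i)) unsplitK. Qed.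

Lemma coord_eig_mem l : coord_eig l \in s.
Proof.
have h (i : 'I_m) : s`_i \in s by rewrite mem_nth// (has_spectrum_size sy0).
by case: (split_ordP l) => i ->; rewrite ?coord_eigl ?coord_eigr h.
Qed.

Lemma wt_diag (d : 'rV[C]_m) (v : 'cV[C]_m) mu : (forall i, d 0 i \in s) ->
  wt s (diag_mx d) v mu = \sum_(i | d 0 i == mu) (v i 0)^* * v i 0.
Proof.
move=> ds; rewrite /wt (sproj_diag _ ds) -mulmxA mul_diag_mx mxE [RHS]big_mkcond.
apply: eq_bigr => i _; rewrite !mxE.
by case: (d 0 i == mu); rewrite ?mul1r // mul0r mulr0.
Qed.

Lemma wt_diag_coord (v : 'rV[R]_(m + m)) mu : wt s D (vec_of v) mu =
  (\sum_(l | coord_eig l == mu) v 0 l ^+ 2)%:C%C.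
Proof.
rewrite wt_diag => [|i]; last by rewrite mxE mem_nth// (has_spectrum_size sy0).
rewrite [in RHS]big_mkcond big_split_ord /= -!big_mkcond /=.
under [in RHS]eq_bigl do rewrite coord_eigl.
under [X in _ = (_ + X)%:C%C]eq_bigl do rewrite coord_eigr.
rewrite -big_split rmorph_sum /=.
apply: eq_big => [i|i _]; first by rewrite mxE.
apply/eqP; rewrite mxE eq_complex /=; apply/andP; split; apply/eqP.
  by rewrite mulNr opprK !expr2.
by rewrite mulNr mulrC subrr.
Qed.

Lemma wt_notin mu : mu \notin s -> wt s y0 b0 mu = 0.
Proof. by move=> mus; rewrite /wt (sproj_notin sy0 mus) mulmx0 mul0mx mxE. Qed.

Let rr mu : R := complex.Re (wt s y0 b0 mu).
Let cnt mu := #|[set i : 'I_m | s`_i == mu]%SET|.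
(** The dimension of the unit sphere in the coordinates of the class. Truncation at 0 concerns only
    values outside [s], which carry no sphere. *)
Let dd mu := (cnt mu + cnt mu).-1.

Lemma coord_eig_card mu : #|[set l | coord_eig l == mu]%SET| = (cnt mu + cnt mu)%N.
Proof.
rewrite /cnt -!sum1_card big_mkcond big_split_ord /=.
by congr addn; rewrite -big_mkcond; apply: eq_bigl => i;
   rewrite !inE ?coord_eigl ?coord_eigr.
Qed.

Lemma model_fiber_spheres : exists (F : eucl_set R) f g,
  [/\ ediff (model_fiber s y0 b0) (eset_set F) f g, point_or_odd_spheres F
    & emanifold (eset_set F)].
Proof.
have rE mu : wt s y0 b0 mu = (rr mu)%:C%C by exact: nonneg_real (wt_ge0 b0 sy0 mu).
have rr0 mu : 0 <= rr mu.
  by have := wt_ge0 b0 sy0 mu; rewrite rE lecR.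
have cnt_gt0 mu : 0 < rr mu -> (0 < cnt mu)%N.
  move=> rmu; have mus : mu \in s.
    apply: contraLR rmu => /wt_notin; rewrite rE => -[->]; by rewrite ltxx.
  apply/card_gt0P; case/(nthP 0): mus => i; rewrite (has_spectrum_size sy0) => im <-.
  by exists (Ordinal im); rewrite inE /=; exact: (eqxx s`_i).
have ddP mu : 0 < rr mu -> #|[set l | coord_eig l == mu]%SET| = (dd mu).+1.
  move=> /cnt_gt0 c0; rewrite coord_eig_card /dd prednK// addn_gt0 c0 //.
have modelE : model_fiber s y0 b0 =
    class_spheres coord_eig rr [seq mu <- undup s | 0 < rr mu].
  rewrite class_spheres_filter//; last exact: coord_eig_mem.
  apply/seteqP; split=> v h mu mus; have := h mu mus; rewrite wt_diag_coord rE.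
    by move=> [].
  by move=> ->.
rewrite modelE; set t := [seq mu <- _ | _].
have ut : uniq t by rewrite filter_uniq ?undup_uniq.
have rt : all (fun mu => 0 < rr mu) t by exact: filter_all.
case: t ut rt => [_ _|mu t ut rt].
  rewrite class_spheres_nil; exists (EuclSet [set (0 : 'rV[R]_(m + m))]), id, id.
  split; [|by left; exists 0|exact: emanifold_point].
  by split; [exact: emap_id|exact: emap_id|move=> _ ->|move=> _ ->].
have [f [g fg]] := class_spheres_diff ddP ut rt.
exists (prod_spheres R (dd mu) (map dd t)), f, g; split=> //.
  right; exists (dd mu), (map dd t); split=> //.
  have dd_odd nu : 0 < rr nu -> odd (dd nu).
    move=> /cnt_gt0; rewrite /dd; case: (cnt nu) => // c _.
    by rewrite addSn /= addnS /= addnn odd_double.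
  have /allP rt' := rt; apply/allP => d; rewrite -[_ :: _]/(map dd (mu :: t)).
  by case/mapP => nu /rt' /dd_odd ? ->.
exact: emanifold_prod_spheres.
Qed.

End ModelFiber.

(** * The tower of leading principal submatrices *)

Fixpoint sz k := if k is k'.+1 then (sz k' + 1)%N else 1%N.

Lemma szE k : sz k = k.+1.
Proof. by elim: k => //= k ->; rewrite addn1. Qed.

Section TowerSet.
Variables (C : numClosedFieldType) (a : nat -> seq C).

(* Sizes [sz k.+1 = sz k + 1] make [ulsubmx] the leading principal submatrix. *)
Fixpoint tower k : set 'M[C]_(sz k) :=
  match k return set 'M[C]_(sz k) with
  | 0 => [set x | has_spectrum (a 0%N) x]
  | k'.+1 => [set x : 'M[C]_(sz k' + 1) | has_spectrum (a k'.+1) x /\ @tower k' (ulsubmx x)]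
  end.
Arguments tower k : clear implicits.

Lemma tower_spectrum k x : tower k x -> has_spectrum (a k) x.
Proof. by case: k x => [//|k] x []. Qed.

Lemma tower_step k : tower k.+1 !=set0 ->
  exists y0 b0 c0, tower k y0 /\ has_spectrum (a k.+1) (bord y0 b0 c0).
Proof.
move=> [x [sx tx]]; have [_ _ xE] := hermitian_bord (proj1 sx).
by exists (ulsubmx x), (ursubmx x), (drsubmx x 0 0); rewrite -xE.
Qed.

Lemma tower_nonempty k j : (j <= k)%N -> tower k !=set0 -> tower j !=set0.
Proof.
elim: k => [|k IHk]; first by rewrite leqn0 => /eqP ->.
rewrite leq_eqVlt ltnS => /predU1P[->//|/IHk h] [x [_ tx]].
by apply: h; exists (ulsubmx x).
Qed.

Lemma has_spectrum_unique1 (s : seq C) (x y : 'M[C]_1) :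
  has_spectrum s x -> has_spectrum s y -> x = y.
Proof.
move=> [_ cx] [_ cy]; have : char_poly x = char_poly y by rewrite cx cy.
move=> /(congr1 (fun p : {poly C} => p`_0)); rewrite !char_poly_det !det_mx11 expr1 !mulN1r.
by move=> /oppr_inj h; rewrite [x]mx11_scalar [y]mx11_scalar h.
Qed.

End TowerSet.
Arguments tower {C} a k _.

Section Tower.
Variables (R : realType) (a : nat -> seq R[i]).
Local Notation C := R[i].
Local Notation tower := (tower a).

Definition tower_eset k : eucl_set R := EuclSet (@mx_coord R (sz k) @` tower k).

Lemma tower0_point : tower 0 !=set0 -> is_point (tower_eset 0).
Proof.
move=> [x tx]; exists (mx_coord x); apply/seteqP; split=> [_ [y ty <-]|_ ->].
  by rewrite (has_spectrum_unique1 ty tx).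
by exists x.
Qed.

(** The fiber and the projection are chosen before the base is known to be a manifold, because that
    is proved by induction from this very step. *)
Lemma tower_bundle_step k : tower k.+1 !=set0 ->
  exists (F : eucl_set R) (p : 'rV[R]_(eset_dim (tower_eset k.+1)) ->
                                'rV[R]_(eset_dim (tower_eset k))),
    point_or_odd_spheres F /\
    (emanifold (eset_set (tower_eset k)) ->
     fiber_bundle F p /\ emanifold (eset_set (tower_eset k.+1))).
Proof.
move=> /tower_step[y0 [b0 [c0 [ty0 sx0]]]].
have [F [f [g [fg pF mF]]]] := model_fiber_spheres b0 (tower_spectrum ty0).
exists F, (@border_proj R (sz k)); split=> // mB; split.
  by case: F f g fg pF mF => dF F f g fg pF mF; exact: (border_fiber_bundle (@tower_spectrum _ a k) ty0 sx0 fg mF mB).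
exact: (emanifold_border (@tower_spectrum _ a k) ty0 sx0 fg mF mB).
Qed.

Lemma emanifold_tower k : tower k !=set0 -> emanifold (eset_set (tower_eset k)).
Proof.
elim: k => [|k IHk] tk.
  by have [x ->] := tower0_point tk; exact: emanifold_point.
have [F [p [_ h]]] := tower_bundle_step tk.
by case: h => //; apply: IHk; exact: tower_nonempty tk.
Qed.

Lemma tower_iterated_bundle k : tower k !=set0 ->
  iterated_odd_sphere_bundle k (tower_eset k).
Proof.
move=> tk; exists tower_eset; split=> //.
  by apply: tower0_point; exact: tower_nonempty tk.
move=> j jk; have [F [p [pF h]]] := tower_bundle_step (tower_nonempty jk tk).
exists F, p; split=> //; apply: (proj1 (h _)); apply: emanifold_tower.
exact: tower_nonempty (ltnW jk) tk.
Qed.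

End Tower.
(** * Matching towers with the same equality pattern *)

Section Glue.
Variable C : numClosedFieldType.

(** [matched] concerns one level, [crossed] two consecutive ones: it preserves the coincidences
    between their eigenvalues, which decide the vanishing of the weights. *)
Definition crossed (z w : seq (C * C)) :=
  forall p q, p \in z -> q \in w -> (p.1 == q.1) = (p.2 == q.2).

Lemma count_crossed z w p : crossed z w -> p \in z ->
  count_mem p.1 (unzip1 w) = count_mem p.2 (unzip2 w).
Proof.
move=> zw pz; rewrite !count_map; apply: eq_in_count => q qw /=.
by rewrite ![_ == p.1]eq_sym ![_ == p.2]eq_sym zw.
Qed.

Lemma crossed_sym z w : crossed z w -> crossed w z.
Proof. by move=> zw p q pz qw; rewrite ![p.1 == _]eq_sym ![p.2 == _]eq_sym zw. Qed.

Lemma crossed_swapz z w : crossed z w -> crossed (swapz z) (swapz w).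
Proof. by move=> zw p q; rewrite !mem_swapz => pz qz; have := zw _ _ pz qz. Qed.

Lemma mul_defl_sproj m (s : seq C) (y : 'M[C]_m) b mu nu : has_spectrum s y ->
  defl s y b mu *m sproj s y nu = if mu == nu then defl s y b mu else 0.
Proof.
move=> sy; rewrite /defl mulmxBl -scalemxAl -!mulmxA (sprojM sy).
by case: (mu == nu) => /=; rewrite // !mulmx0 scaler0 subr0.
Qed.

Lemma mul_sproj_defl m (s : seq C) (y : 'M[C]_m) b mu nu : has_spectrum s y ->
  sproj s y nu *m defl s y b mu = if nu == mu then defl s y b mu else 0.
Proof.
move=> sy; rewrite /defl mulmxBr -scalemxAr !mulmxA (sprojM sy).
by case: (nu =P mu) => [->//|_]; rewrite !mul0mx scaler0 subr0.
Qed.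

(** On each eigenspace of [x] the line of the projected last basis vector goes to the corresponding
    line for [x'], scaled through [kap]; its complement lies in the old coordinates by [defl_bord]
    and is moved by [g]. *)
Definition glue m (w : seq (C * C)) (kap : C * C -> C) (g : 'M[C]_m)
    (x x' : 'M[C]_(m + 1)) : 'M[C]_(m + 1) :=
  \sum_(q <- undup w)
    (kap q *: (sproj (unzip2 w) x' q.2 *m ebot C m *m (ebot C m)^t* *m
               sproj (unzip1 w) x q.1) +
     block_mx g 0 0 1%:M *m defl (unzip1 w) x (ebot C m) q.1).

(* [glue] with the weights, which are constant in the intended use, given. *)
Definition glue_const m (w : seq (C * C)) (rho : C -> C) (kap : C * C -> C) (g : 'M[C]_m)
    (x x' : 'M[C]_(m + 1)) : 'M[C]_(m + 1) :=
  \sum_(q <- undup w)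
    (kap q *: (sproj (unzip2 w) x' q.2 *m ebot C m *m (ebot C m)^t* *m
               sproj (unzip1 w) x q.1) +
     block_mx g 0 0 1%:M *m (sproj (unzip1 w) x q.1 - (rho q.1)^-1 *:
       (sproj (unzip1 w) x q.1 *m ebot C m *m (ebot C m)^t* *m sproj (unzip1 w) x q.1))).

Lemma glue_constE m w rho kap (g : 'M[C]_m) x x' :
  (forall q, q \in w -> wt (unzip1 w) x (ebot C m) q.1 = rho q.1) ->
  glue_const w rho kap g x x' = glue w kap g x x'.
Proof.
move=> h; apply: eq_big_seq => q; rewrite mem_undup => qw.
by rewrite /defl h.
Qed.

Section Step.
Variables (m : nat) (z w : seq (C * C)) (y y' g : 'M[C]_m) (b b' : 'cV[C]_m) (c c' : C).
Hypotheses (mz : matched z) (mw : matched w) (zw : crossed z w).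
Hypotheses (sy : has_spectrum (unzip1 z) y) (sy' : has_spectrum (unzip2 z) y').
Local Notation x := (bord y b c).
Local Notation x' := (bord y' b' c').
Hypotheses (sx : has_spectrum (unzip1 w) x) (sx' : has_spectrum (unzip2 w) x').
Hypothesis gg : g^t* *m g = 1%:M.
Hypothesis gP : forall p, p \in z ->
  g *m sproj (unzip1 z) y p.1 = sproj (unzip2 z) y' p.2 *m g.
Hypothesis gb : forall p, p \in z -> exists2 k : C, 0 <= k &
  sproj (unzip2 z) y' p.2 *m b' = k *: (g *m (sproj (unzip1 z) y p.1 *m b)).
Local Notation P := (sproj (unzip1 z) y).
Local Notation P' := (sproj (unzip2 z) y').
Local Notation X := (sproj (unzip1 w) x).
Local Notation X' := (sproj (unzip2 w) x').
Local Notation e := (ebot C m).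

Lemma wt_match p : p \in z ->
  (wt (unzip1 z) y b p.1 != 0) = (wt (unzip2 z) y' b' p.2 != 0).
Proof.
move=> pz; rewrite (wt_neq0_count sy sx) (wt_neq0_count sy' sx').
by rewrite (count_crossed zw pz) (count_unzip1 mz pz) (count_unzip2 mz pz).
Qed.

Lemma wt_ebot_match q : q \in w ->
  (wt (unzip1 w) x e q.1 != 0) = (wt (unzip2 w) x' e q.2 != 0).
Proof.
move=> qw; rewrite (wt_ebot_neq0_count sy sx) (wt_ebot_neq0_count sy' sx').
by rewrite (count_crossed (crossed_sym zw) qw) (count_unzip1 mw qw) (count_unzip2 mw qw).
Qed.

(** The component of [b'] is a nonnegative multiple of the image under the isometry [g] of that of
    [b], so [g] matches the lines removed by the two deflations; by [wt_match] they are removed on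
    both sides or on neither. *)
Lemma glue_defl_z p : p \in z ->
  g *m defl (unzip1 z) y b p.1 = defl (unzip2 z) y' b' p.2 *m g.
Proof.
move=> pz; have [k k0 bE] := gb pz.
have rankE (s : seq C) (A : 'M[C]_m) v mu : has_spectrum s A ->
    defl s A v mu = sproj s A mu -
      (wt s A v mu)^-1 *: ((sproj s A mu *m v) *m (sproj s A mu *m v)^t*).
  by move=> sA; rewrite /defl adjM (sproj_adj sA) !mulmxA.
have gE n (v u : 'M[C]_(m, n)) : (g *m v)^t* *m (g *m u) = v^t* *m u.
  by rewrite adjM -mulmxA [g^t* *m (g *m u)]mulmxA gg mul1mx.
have wE : wt (unzip2 z) y' b' p.2 = k * k * wt (unzip1 z) y b p.1.
  rewrite (wtE _ sy') bE (wtE _ sy) adjZ (geC0_conj k0) -scalemxAl -scalemxAr scalerA.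
  by rewrite gE mxE.
rewrite rankE// rankE// bE mulmxBr mulmxBl gP//; congr (_ - _).
set v := P p.1 *m b; rewrite -scalemxAr adjZ (geC0_conj k0) -!scalemxAl -!scalemxAr -scalemxAl.
have -> : (g *m v) *m (g *m v)^t* *m g = g *m (v *m v^t*).
  by rewrite adjM -!mulmxA gg mulmx1.
rewrite !scalerA; congr (_ *: _); rewrite wE; have := wt_match pz; rewrite wE.
case: (eqVneq (wt (unzip1 z) y b p.1) 0) => [->|w0]; first by rewrite mulr0 invr0 !mul0r.
move=> /esym kw; have k2 : k * k != 0 by apply: contraNneq kw => ->; rewrite mul0r.
by rewrite invfM -mulrA mulrAC mulVf// mul1r.
Qed.

Lemma glue_defl q : q \in w ->
  block_mx g 0 0 1%:M *m defl (unzip1 w) x e q.1 =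
  defl (unzip2 w) x' e q.2 *m block_mx g 0 0 1%:M.
Proof.
move=> qw; rewrite (defl_bord sy sx) (defl_bord sy' sx') !mulmx_block.
rewrite !mulmx0 !mul0mx !addr0; congr block_mx.
have [/mapP[p pz qp]|qz] := boolP (q.1 \in unzip1 z).
  have /eqP <- : p.2 == q.2 by rewrite -zw// qp.
  by rewrite qp glue_defl_z.
rewrite (defl_notin _ sy qz) mulmx0 (defl_notin _ sy') ?mul0mx//.
apply: contra qz => /mapP[p pz qp]; have /eqP -> : q.1 == p.1.
  by rewrite eq_sym zw// qp.
exact: map_f.
Qed.

Variable kap : C * C -> C.
Hypothesis kap_ge0 : forall q, 0 <= kap q.
(** The rank-one part maps [X q.1 *m e] to [X' q.2 *m e] times [kap q] and the weight at [q.1]. It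
    preserves the norm exactly when [kap q * kap q] is the inverse of the product of the two
    weights. *)
Hypothesis kapP : forall q, q \in w -> wt (unzip1 w) x e q.1 != 0 ->
  kap q * kap q * wt (unzip1 w) x e q.1 = (wt (unzip2 w) x' e q.2)^-1.

Let A q := kap q *: (X' q.2 *m e *m e^t* *m X q.1) +
  block_mx g 0 0 1%:M *m defl (unzip1 w) x e q.1.

Let A_right q p : A q *m X p = if q.1 == p then A q else 0.
Proof.
rewrite /A mulmxDl -scalemxAl -!mulmxA (sprojM sx) (mul_defl_sproj _ _ _ sx).
by case: (q.1 == p) => /=; rewrite // !mulmx0 scaler0 addr0.
Qed.

Let A_left q p : q \in w -> X' p *m A q = if p == q.2 then A q else 0.
Proof.
move=> qw; rewrite /A glue_defl// mulmxDr -scalemxAr !mulmxA (sprojM sx').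
rewrite (mul_sproj_defl _ _ _ sx').
by case: (p =P q.2) => [->//|_]; rewrite !mul0mx scaler0 addr0.
Qed.

Lemma glue_sproj q : q \in w ->
  glue w kap g x x' *m X q.1 = X' q.2 *m glue w kap g x x'.
Proof.
move=> qw; rewrite /glue mulmx_suml mulmx_sumr; apply: eq_big_seq => p.
rewrite mem_undup => pw; rewrite -/(A p) A_right A_left// mw//.
by rewrite eq_sym.
Qed.

Let gblock_unitary : block_mx g 0 0 1%:M *m (block_mx g 0 0 1%:M)^t* = 1%:M :> 'M[C]_(m + 1).
Proof.
rewrite adj_block !adj0 adj1 mulmx_block !mulmx0 !mul0mx !addr0 add0r mulmx1.
by rewrite (mulmx1C gg) -scalar_mx_block.
Qed.

(** The cross terms vanish since [defl] is orthogonal to [e]. By [kapP] the rank-one part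
    contributes just what [defl] subtracts from [X' q.2]. *)
Let A_adj q : q \in w -> A q *m (A q)^t* = X' q.2.
Proof.
move=> qw; pose gb1 : 'M[C]_(m + 1) := block_mx g 0 0 1%:M.
pose Rq := defl (unzip1 w) x e q.1.
have hR : Rq^t* = Rq by exact: defl_adj.
have eR : e^t* *m Rq = 0 by exact: border_defl.
have XR : X q.1 *m Rq = Rq by rewrite (mul_sproj_defl _ _ _ sx) (eqxx q.1).
have RR : Rq *m Rq = Rq by apply: (defl_fix sx) => //; exact: mul_defl.
have -> : A q = kap q *: (X' q.2 *m e *m (e^t* *m X q.1)) + gb1 *m Rq.
  by rewrite /A !mulmxA.
rewrite adjD adjZ (geC0_conj (kap_ge0 q)) !adjM trmxCK hR (sproj_adj sx) (sproj_adj sx').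
set u := X' q.2 *m e; set v := e^t* *m X q.1.
have -> : e^t* *m X' q.2 = u^t* by rewrite /u adjM (sproj_adj sx').
have vv : v *m (X q.1 *m e) = (wt (unzip1 w) x e q.1)%:M.
  by rewrite /v mulmxA -[e^t* *m _ *m _]mulmxA (sprojM sx) (eqxx q.1) wtM.
have vR : v *m (Rq *m gb1^t*) = 0 by rewrite /v -mulmxA [X q.1 *m _]mulmxA XR mulmxA eR mul0mx.
have Rv : (gb1 *m Rq) *m (X q.1 *m e) = 0.
  apply: (can_inj (@trmxCK _ _ _)); rewrite !adjM hR (sproj_adj sx) adj0.
  by rewrite -/v vR.
have E1 : (u *m v) *m ((X q.1 *m e) *m u^t*) = wt (unzip1 w) x e q.1 *: (u *m u^t*).
  by rewrite mulmxA -[u *m v *m _]mulmxA vv mul_mx_scalar -scalemxAl.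
have E2 : (u *m v) *m (Rq *m gb1^t*) = 0 by rewrite -mulmxA vR mulmx0.
have E3 : (gb1 *m Rq) *m ((X q.1 *m e) *m u^t*) = 0 by rewrite mulmxA Rv mul0mx.
have gg1 : gb1 *m gb1^t* = 1%:M := gblock_unitary.
have E4 : (gb1 *m Rq) *m (Rq *m gb1^t*) = defl (unzip2 w) x' e q.2.
  have gR : gb1 *m Rq = defl (unzip2 w) x' e q.2 *m gb1 := glue_defl qw.
  rewrite -mulmxA [Rq *m (Rq *m _)]mulmxA RR mulmxA gR.
  rewrite -(mulmxA _ gb1 (gb1^t*)).
  rewrite gg1.
  exact: mulmx1.
rewrite mulmxDl (mulmxDr (kap q *: _)) (mulmxDr (gb1 *m Rq)) -!scalemxAl -!scalemxAr.
rewrite E1 E2 E3 E4 !scaler0 addr0 add0r !scalerA.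
rewrite [defl _ _ _ _]/defl /u adjM (sproj_adj sx') !mulmxA.
have -> : kap q * kap q * wt (unzip1 w) x e q.1 = (wt (unzip2 w) x' e q.2)^-1.
  have [w0|w0] := eqVneq (wt (unzip1 w) x e q.1) 0; last exact: kapP.
  have := wt_ebot_match qw; rewrite w0 (eqxx (0 : C)) => /esym/negbFE/eqP ->.
  by rewrite mulr0 invr0.
by rewrite addrC subrK.
Qed.

Lemma glue_unitary : glue w kap g x x' *m (glue w kap g x x')^t* = 1%:M.
Proof.
rewrite -(sproj_sum sx') -(unzip1_swapz w) (sum_unzip1 _ (matched_swapz mw)).
rewrite undup_swapz big_map /= -/(unzip1 (swapz w)) unzip1_swapz /glue adj_sum.
rewrite mulmx_suml; apply: eq_big_seq => q; rewrite mem_undup => qw.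
rewrite mulmx_sumr (sum_pick _ (p := q)) ?undup_uniq ?mem_undup//=; first exact: A_adj.
move=> p; rewrite mem_undup => pw pq; rewrite -/(A q) -/(A p).
have -> : A p = A p *m X p.1 by rewrite A_right (eqxx p.1).
rewrite adjM (sproj_adj sx) mulmxA A_right.
case: (eqVneq q.1 p.1) => [qp|_]; last exact: mul0mx.
case/eqP: pq; have /eqP qp2 : q.2 == p.2 by rewrite -mw// qp.
by rewrite (surjective_pairing p) (surjective_pairing q) qp qp2.
Qed.

(** The adjoint is again a glueing, with the roles of [x] and [x'] exchanged; this makes the inverse
    of [psi] another [psi]. *)
Lemma glue_swap kap' : (forall q, q \in w -> kap' (q.2, q.1) = kap q) ->
  glue (swapz w) kap' (g^t*) x' x = (glue w kap g x x')^t*.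
Proof.
move=> kk; rewrite /glue undup_swapz big_map adj_sum; apply: eq_big_seq => q.
rewrite mem_undup => qw; rewrite unzip1_swapz unzip2_swapz /= kk//.
rewrite glue_defl// adjD adjZ (geC0_conj (kap_ge0 q)) !adjM trmxCK.
rewrite (sproj_adj sx) (sproj_adj sx') (defl_adj _ sx') adj_block !adj0 adj1 !mulmxA //.
Qed.

End Step.

End Glue.
Section MatchTowers.
Variable C : numClosedFieldType.
Local Notation pairs := (seq (C * C)).

(* The target of the map and a unitary intertwining the spectral projections. *)
Fixpoint psi (z : nat -> pairs) (r : nat -> C -> C) (c : nat -> C)
    (kap : nat -> C * C -> C) (t : C) k : 'M[C]_(sz k) -> 'M[C]_(sz k) * 'M[C]_(sz k) :=
  match k return 'M[C]_(sz k) -> 'M[C]_(sz k) * 'M[C]_(sz k) with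
  | 0 => fun _ => (t%:M, 1%:M)
  | k'.+1 => fun x : 'M[C]_(sz k' + 1) =>
      let p := @psi z r c kap t k' (ulsubmx x) in
      let x' := bord p.1 (transport (z k') (ulsubmx x) p.2 (r k') (ursubmx x)) (c k') in
      (x', glue (z k'.+1) (kap k') p.2 x x')
  end.
Arguments psi z r c kap t k _ : clear implicits.

(** The corner, the weights of the border and those of the last basis vector, read off at one
    reference point. By [bord_spectrum] and [bord_wt_ebot] they are the same at every point of the
    tower. *)
Definition refdata (a : nat -> seq C) k (r : C -> C) (c : C) (rho : C -> C) : Prop :=
  exists y0 b0, [/\ tower a k y0, has_spectrum (a k.+1) (bord y0 b0 c),
    r = wt (a k) y0 b0 & rho = wt (a k.+1) (bord y0 b0 c) (ebot C (sz k))].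

Lemma refdata_exists (a : nat -> seq C) k : tower a k.+1 !=set0 ->
  exists r c rho, refdata a k r c rho.
Proof.
move=> /tower_step[y0 [b0 [c0 [ty0 sx0]]]].
by exists (wt (a k) y0 b0), c0, (wt (a k.+1) (bord y0 b0 c0) (ebot C (sz k))), y0, b0.
Qed.

Section RefData.
Variables (a : nat -> seq C) (k : nat) (r : C -> C) (c : C) (rho : C -> C).
Hypothesis rd : refdata a k r c rho.

Lemma refdata_ge0 mu : 0 <= r mu.
Proof. by have [y0 [b0 [/tower_spectrum sy0 _ -> _]]] := rd; exact: wt_ge0. Qed.

Lemma refdata_tower (x : 'M[C]_(sz k + 1)) : tower a k.+1 x ->
  [/\ x = bord (ulsubmx x) (ursubmx x) c,
      forall mu, mu \in a k -> wt (a k) (ulsubmx x) (ursubmx x) mu = r mu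
    & forall mu, mu \in a k.+1 -> wt (a k.+1) x (ebot C (sz k)) mu = rho mu].
Proof.
have [y0 [b0 [ty0 sx0 -> ->]]] := rd; move=> [sx tx].
have [_ cr xE] := hermitian_bord (proj1 sx).
have sx' := sx; rewrite xE in sx'.
have [ce we] := (bord_spectrum _ (tower_spectrum tx) (tower_spectrum ty0) cr sx0).1 sx'.
split=> //; first by rewrite {1}xE ce.
move=> mu mus; rewrite {1}xE.
exact: (bord_wt_ebot (tower_spectrum tx) (tower_spectrum ty0) cr sx0 sx').
Qed.

Lemma refdata_bord (y : 'M[C]_(sz k)) (b : 'cV[C]_(sz k)) : tower a k y ->
  (forall mu, mu \in a k -> wt (a k) y b mu = r mu) -> tower a k.+1 (bord y b c).
Proof.
have [y0 [b0 [ty0 sx0 -> _]]] := rd; move=> ty wy.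
have [_ + _] := hermitian_bord (proj1 sx0); rewrite drsubmx_bord => cr.
have sx : has_spectrum (a k.+1) (bord y b c).
  by apply/(bord_spectrum _ (tower_spectrum ty) (tower_spectrum ty0) cr sx0).
by split; rewrite ?ulsubmx_bord.
Qed.

End RefData.

Variables (l : nat) (z : nat -> pairs) (r1 r2 : nat -> C -> C) (c1 c2 : nat -> C)
  (rho1 rho2 : nat -> C -> C) (t1 t2 : C).
Let a1 k := unzip1 (z k).
Let a2 k := unzip2 (z k).
(** The normalization demanded by [kapP]. It is symmetric in the two towers, so that [kap2] at a
    swapped pair is [kap1], as [glue_swap] needs. *)
Let kap1 k (q : C * C) := sqrtC (rho1 k q.1 * rho2 k q.2)^-1.
Let kap2 k (q : C * C) := sqrtC (rho2 k q.1 * rho1 k q.2)^-1.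
Hypotheses (mz : forall k, (k <= l)%N -> matched (z k))
  (cz : forall k, (k < l)%N -> crossed (z k) (z k.+1))
  (t1P : has_spectrum (a1 0%N) (t1%:M : 'M_1)) (t2P : has_spectrum (a2 0%N) (t2%:M : 'M_1))
  (rd1 : forall k, (k < l)%N -> refdata a1 k (r1 k) (c1 k) (rho1 k))
  (rd2 : forall k, (k < l)%N -> refdata a2 k (r2 k) (c2 k) (rho2 k)).
Local Notation psi1 := (psi z r2 c2 kap1 t2).
Local Notation psi2 := (psi (fun k => swapz (z k)) r1 c1 kap2 t1).

Lemma refdata_match k p : (k < l)%N -> p \in z k -> (r1 k p.1 != 0) = (r2 k p.2 != 0).
Proof.
move=> kl pz; have [y1 [b1 [ty1 sx1 -> _]]] := rd1 kl.
have [y2 [b2 [ty2 sx2 -> _]]] := rd2 kl.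
exact: (wt_match (mz (ltnW kl)) (cz kl) (tower_spectrum ty1) (tower_spectrum ty2) sx1 sx2 pz).
Qed.

Let rho1_ge0 k mu : (k < l)%N -> 0 <= rho1 k mu.
Proof. by move=> kl; have [y1 [b1 [_ sx1 _ ->]]] := rd1 kl; exact: wt_ge0. Qed.

Let rho2_ge0 k mu : (k < l)%N -> 0 <= rho2 k mu.
Proof. by move=> kl; have [y1 [b1 [_ sx1 _ ->]]] := rd2 kl; exact: wt_ge0. Qed.

(** The induction needs all four clauses: unitarity and intertwining are the hypotheses on [g] in
    the next step, and the inverse has to return the adjoint unitary because it transports the
    border back with it. *)
Lemma psi_match k : (k <= l)%N -> forall x, tower a1 k x ->
  let p := psi1 k x in
  [/\ tower a2 k p.1, p.2^t* *m p.2 = 1%:M,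
      forall q, q \in z k -> p.2 *m sproj (a1 k) x q.1 = sproj (a2 k) p.1 q.2 *m p.2
    & psi2 k p.1 = (x, p.2^t*)].
Proof.
elim: k => [_ x tx /=|k IHk kl x tx].
  split=> //; first by rewrite adj1 mulmx1.
    move=> q qz; have : size (z 0%N) = 1%N.
      by rewrite -(size_map fst) (has_spectrum_size t1P).
    have := sproj_sum t2P; have := sproj_sum tx; rewrite /a1 /a2 /=.
    case: (z 0%N) qz => [//|q' [|//]]; rewrite inE => /eqP -> /= + + _.
    by rewrite !big_seq1 => -> ->; rewrite mul1mx.
  by rewrite adj1; congr pair; exact: has_spectrum_unique1 t1P tx.
have [xE wx ex] := refdata_tower (rd1 kl) tx.
have ty : tower a1 k (ulsubmx x) by case: tx.
have sx : has_spectrum (a1 k.+1) x by case: tx.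
have /= := IHk (ltnW kl) _ ty.
rewrite /=.
case: (psi1 k (ulsubmx x)) => y' g /= [ty' gg gP inv].
have sy := tower_spectrum ty; have sy' := tower_spectrum ty'.
have mzk := mz (ltnW kl); have mzk' := mz kl; have czk := cz kl.
have wz p : p \in z k -> wt (a1 k) (ulsubmx x) (ursubmx x) p.1 = r1 k p.1.
  by move=> pz; apply: wx; exact: map_f.
have rz p : p \in z k -> (r1 k p.1 != 0) = (r2 k p.2 != 0) by exact: refdata_match.
have r1_ge0 p : p \in z k -> 0 <= r1 k p.1 by move=> _; exact: refdata_ge0 (rd1 kl) _.
have r2_ge0 p : p \in z k -> 0 <= r2 k p.2 by move=> _; exact: refdata_ge0 (rd2 kl) _.
have wt' := wt_transport mzk sy sy' gP wz r2_ge0 rz gg.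
have inv' := transportK mzk sy sy' gP wz r2_ge0 rz gg r1_ge0.
set b' := transport _ _ _ _ _; pose x' := bord y' b' (c2 k).
have tx' : tower a2 k.+1 x'.
  apply: (refdata_bord (rd2 kl)) => // mu /mapP[p pz ->].
  exact: wt'.
have sx' : has_spectrum (a2 k.+1) x' by case: tx'.
have [_ _ ex'] := refdata_tower (rd2 kl) tx'.
have sx1 : has_spectrum (unzip1 (z k.+1)) (bord (ulsubmx x) (ursubmx x) (c1 k)).
  by rewrite -xE.
have gb p : p \in z k -> exists2 k0 : C, 0 <= k0 &
    sproj (unzip2 (z k)) y' p.2 *m b' =
    k0 *: (g *m (sproj (unzip1 (z k)) (ulsubmx x) p.1 *m ursubmx x)).
  move=> pz; have := transport_proj mzk sy' gP (r2 k) (ursubmx x) pz.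
  rewrite -/b' => ->; case: ifP => _; last by exists 0; rewrite ?scale0r.
  rewrite /nf; eexists; last by [].
  by rewrite sqrtC_ge0 divr_ge0 ?sqr_norm_ge0 ?r2_ge0.
have kap_ge0 q : 0 <= kap1 k q.
  by rewrite sqrtC_ge0 invr_ge0 mulr_ge0 ?rho1_ge0 ?rho2_ge0.
have kapP q : q \in z k.+1 ->
    wt (unzip1 (z k.+1)) (bord (ulsubmx x) (ursubmx x) (c1 k)) (ebot C (sz k)) q.1 != 0 ->
    kap1 k q * kap1 k q *
      wt (unzip1 (z k.+1)) (bord (ulsubmx x) (ursubmx x) (c1 k)) (ebot C (sz k)) q.1 =
    (wt (unzip2 (z k.+1)) x' (ebot C (sz k)) q.2)^-1.
  move=> qz; rewrite -xE ex ?ex'; [|exact: map_f|exact: map_f] => rho0.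
  by rewrite -expr2 sqrtCK invfM mulrAC mulVf// mul1r.
have Gu := glue_unitary mzk mzk' czk sy sy' sx1 sx' gg gP gb kap_ge0 kapP.
have Gs := glue_sproj mzk mzk' czk sy sy' sx1 sx' gg gP gb (kap1 k).
have Gk := glue_swap mzk czk sy sy' sx1 sx' gg gP gb kap_ge0.
rewrite -xE in Gu Gs Gk.
split=> //; first exact: mulmx1C.
rewrite ulsubmx_bord ursubmx_bord inv /= inv' -xE; congr pair.
apply: Gk => q _; by rewrite /kap2 /kap1 /= mulrC.
Qed.

End MatchTowers.
Arguments psi {C} z r c kap t k _.
Arguments refdata {C} a k r c rho.

(** * Smoothness of the map between matched towers *)

Section SmoothMatch.
Variables (R : realType).
Local Notation C := R[i].

Lemma msm_psi (l : nat) (z : nat -> seq (C * C)) (r1 r2 : nat -> C -> C) (c1 c2 : nat -> C)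
    (rho1 rho2 : nat -> C -> C) (t1 t2 : C) :
  let a1 := fun k => unzip1 (z k) in
  let a2 := fun k => unzip2 (z k) in
  let kap := fun k q => sqrtC (rho1 k q.1 * rho2 k q.2)^-1 in
  (forall k, (k <= l)%N -> matched (z k)) ->
  (forall k, (k < l)%N -> crossed (z k) (z k.+1)) ->
  has_spectrum (a1 0%N) (t1%:M : 'M_1) -> has_spectrum (a2 0%N) (t2%:M : 'M_1) ->
  (forall k, (k < l)%N -> refdata a1 k (r1 k) (c1 k) (rho1 k)) ->
  (forall k, (k < l)%N -> refdata a2 k (r2 k) (c2 k) (rho2 k)) ->
  forall k, (k <= l)%N -> forall d (A : set 'rV[R]_d) (F : 'rV[R]_d -> 'M[C]_(sz k)),
    (forall v, A v -> tower a1 k (F v)) -> forall x, A x -> msm A x F ->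
    msm A x (fun v => (psi z r2 c2 kap t2 k (F v)).1) /\
    msm A x (fun v => (psi z r2 c2 kap t2 k (F v)).2).
Proof.
move=> a1 a2 kap mz cz t1P t2P rd1 rd2; elim=> [_|k IHk kl] d A F tF x Ax mF.
  by split=> /=; exact: msm_cst.
have mul : msm A x (fun v => ulsubmx (F v)) by exact: msm_ulsubmx.
have mur : msm A x (fun v => ursubmx (F v)) by exact: msm_ursubmx.
have tul v : A v -> tower a1 k (ulsubmx (F v)) by case/tF.
have [my mg] := IHk (ltnW kl) d A (fun v => ulsubmx (F v)) tul x Ax mul.
have [_ gg _ _] := psi_match mz cz t1P t2P rd1 rd2 (ltnW kl) (tul x Ax).
have [_ wx _] := refdata_tower (rd1 k kl) (tF x Ax).
have mb : msm A x (fun v => transport (z k) (ulsubmx (F v))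
    (psi z r2 c2 kap t2 k (ulsubmx (F v))).2 (r2 k) (ursubmx (F v))).
  apply: msm_transport => //.
    by move=> p _; exact: refdata_ge0 (rd2 k kl) _.
  move=> p pz rp; apply: mul_sproj_neq0 (tower_spectrum (tul x Ax)) gg _.
  by rewrite wx ?map_f// (refdata_match mz cz rd1 rd2 kl pz).
have mx' : msm A x (fun v => (psi z r2 c2 kap t2 k.+1 (F v)).1).
  by apply: msm_block => //; [exact: msm_adj|exact: msm_cst].
split; first exact: mx'.
(* In [glue] the inverse of a possibly vanishing weight depends on [v]; on the tower the weight is
   the constant given by [rho1 k], so its inverse is a constant too. *)
apply: (@msm_ext _ _ _ _ _ _ (fun v => glue_const (z k.+1) (rho1 k) (kap k)
    (psi z r2 c2 kap t2 k (ulsubmx (F v))).2 (F v) (psi z r2 c2 kap t2 k.+1 (F v)).1)).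
  move=> v Av; apply: glue_constE => q qz.
  by have [_ _ ev] := refdata_tower (rd1 k kl) (tF v Av); apply: ev; exact: map_f.
have ms q : msm A x (fun v => sproj (a1 k.+1) (F v) q) by exact: msm_sproj.
apply: msm_sum => q _; apply: msmD.
  apply: msmZ; first exact: csm_cst.
  apply: msmM => //; apply: msmM; last exact: msm_cst.
  by apply: msmM; [exact: msm_sproj|exact: msm_cst].
apply: msmM; first by apply: msm_block => //; exact: msm_cst.
apply: msmB => //; apply: msmZ; first exact: csm_cst.
apply: msmM => //; apply: msmM; last exact: msm_cst.
by apply: msmM => //; exact: msm_cst.
Qed.

Lemma tower_diffeo (l : nat) (z : nat -> seq (C * C)) :
  (forall k, (k <= l)%N -> matched (z k)) ->
  (forall k, (k < l)%N -> crossed (z k) (z k.+1)) ->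
  tower (fun k => unzip1 (z k)) l !=set0 -> tower (fun k => unzip2 (z k)) l !=set0 ->
  diffeomorphic (@mx_coord R (sz l) @` tower (fun k => unzip1 (z k)) l)
                (@mx_coord R (sz l) @` tower (fun k => unzip2 (z k)) l).
Proof.
move=> mz cz ne1 ne2.
have data (a : nat -> seq C) : tower a l !=set0 -> exists r c rho,
    forall k, (k < l)%N -> refdata a k (r k) (c k) (rho k).
  move=> ne; have /choice[d dP] : forall k, exists d : (C -> C) * C * (C -> C),
      (k < l)%N -> refdata a k d.1.1 d.1.2 d.2.
    move=> k; have [kl|_] := boolP (k < l)%N; last by exists (fun=> 0, 0, fun=> 0).
    have [r [c [rho h]]] := refdata_exists (tower_nonempty kl ne).
    by exists (r, c, rho).
  by exists (fun k => (d k).1.1), (fun k => (d k).1.2), (fun k => (d k).2).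
have base (a : nat -> seq C) : tower a l !=set0 ->
    exists t, has_spectrum (a 0%N) (t%:M : 'M_1).
  by move=> /(tower_nonempty (leq0n l))[x tx]; exists (x 0 0); rewrite -mx11_scalar.
have [r1 [c1 [rho1 rd1]]] := data _ ne1; have [r2 [c2 [rho2 rd2]]] := data _ ne2.
have [t1 t1P] := base _ ne1; have [t2 t2P] := base _ ne2.
have mz' k : (k <= l)%N -> matched (swapz (z k)) by move=> /mz; exact: matched_swapz.
have cz' k : (k < l)%N -> crossed (swapz (z k)) (swapz (z k.+1)).
  by move=> /cz; exact: crossed_swapz.
have e1 : (fun k => unzip1 (swapz (z k))) = (fun k => unzip2 (z k)).
  by apply/funext => k; exact: unzip1_swapz.
have e2 : (fun k => unzip2 (swapz (z k))) = (fun k => unzip1 (z k)).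
  by apply/funext => k; exact: unzip2_swapz.
have ez : (fun k => swapz (swapz (z k))) = z by apply/funext => k; exact: swapzK.
have t1P' : has_spectrum (unzip2 (swapz (z 0%N))) (t1%:M : 'M_1) by rewrite unzip2_swapz.
have t2P' : has_spectrum (unzip1 (swapz (z 0%N))) (t2%:M : 'M_1) by rewrite unzip1_swapz.
have rd1' k : (k < l)%N -> refdata (fun k => unzip2 (swapz (z k))) k (r1 k) (c1 k) (rho1 k).
  by rewrite e2; exact: rd1.
have rd2' k : (k < l)%N -> refdata (fun k => unzip1 (swapz (z k))) k (r2 k) (c2 k) (rho2 k).
  by rewrite e1; exact: rd2.
have P1 := psi_match mz cz t1P t2P rd1 rd2 (leqnn l).
have P2 := psi_match mz' cz' t2P' t1P' rd2' rd1' (leqnn l).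
have S1 := msm_psi mz cz t1P t2P rd1 rd2 (leqnn l).
have S2 := msm_psi mz' cz' t2P' t1P' rd2' rd1' (leqnn l).
rewrite /= e1 in S2; rewrite /= e1 e2 ez in P2.
rewrite !mx_coord_image.
set f := psi z r2 c2 _ t2 l in P1 S1 P2; set g := psi _ r1 c1 _ t1 l in P1 P2 S2.
exists (fun v => mx_coord (f (mx_of v)).1), (fun v => mx_coord (g (mx_of v)).1).
apply: ediff_diffeo; split.
- apply: emap_mx_coord => x tx; apply: (S1 _ _ (@mx_of R (sz l)) _ x tx _).1 => //.
  exact: msm_mx_of.
- apply: emap_mx_coord => x tx; apply: (S2 _ _ (@mx_of R (sz l)) _ x tx _).1 => //.
  exact: msm_mx_of.
- move=> x tx; have [tfx _ _ gf] := P1 _ tx.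
  by split; [rewrite /preimage /mkset mx_coordK|rewrite mx_coordK gf mx_ofK].
- move=> x tx; have [tfx _ _ gf] := P2 _ tx.
  by split; [rewrite /preimage /mkset mx_coordK|rewrite mx_coordK gf mx_ofK].
Qed.

End SmoothMatch.
(** * Cauchy interlacing *)

Section Interlacing.
Variable C : numClosedFieldType.

(* A nonzero combination of the rows of [T] avoiding the coordinates in [K]
   compares the two quadratic forms. *)
Lemma compression_le p n (T : 'M[C]_(p, n)) (dA : 'rV[C]_n) (dB : 'rV[C]_p)
    (K : {set 'I_n}) (al be : C) : T *m T^t* = 1%:M ->
  T *m diag_mx dA *m T^t* = diag_mx dB -> (#|K| < p)%N ->
  (forall j, al <= dB 0 j) -> (forall k, k \notin K -> dA 0 k <= be) -> al <= be.
Proof.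
move=> TT TdT Kp dBal dAbe.
pose M : 'M[C]_(p, #|K|) := \matrix_(i, j) T i (enum_val j).
have kM0 : kermx M != 0.
  rewrite kermx_eq0 /row_free; apply: contraL Kp => /eqP <-.
  by rewrite -leqNgt rank_leq_col.
have vM : nz_row (kermx M) *m M = 0 by apply/sub_kermxP; exact: nz_row_sub.
set v := nz_row _ in vM; have v0 : v != 0 by rewrite nz_row_eq0.
pose w := v *m T.
have wK k : k \in K -> w 0 k = 0.
  move=> kK; have e : (v *m M) 0 (enum_rank_in kK k) = 0 by rewrite vM mxE.
  rewrite -[RHS]e !mxE; apply: eq_bigr => j _.
  by rewrite mxE enum_rankK_in.
have nE q (u : 'rV[C]_q) (d : 'rV[C]_q) :
    (u *m diag_mx d *m u^t*) 0 0 = \sum_j d 0 j * (u 0 j * (u 0 j)^*).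
  rewrite mxE; apply: eq_bigr => j _; rewrite mul_mx_diag !mxE.
  by rewrite mulrAC mulrC.
have n1 q (u : 'rV[C]_q) : (u *m u^t*) 0 0 = \sum_j u 0 j * (u 0 j)^*.
  by rewrite mxE; apply: eq_bigr => j _; rewrite !mxE.
have vw : (v *m v^t*) 0 0 = (w *m w^t*) 0 0.
  by rewrite /w adjM mulmxA -[v *m T *m _]mulmxA TT mulmx1.
have vdw : (v *m diag_mx dB *m v^t*) 0 0 = (w *m diag_mx dA *m w^t*) 0 0.
  by rewrite /w adjM -TdT !mulmxA.
have v_gt0 : 0 < (v *m v^t*) 0 0.
  rewrite lt_def n1 sumr_ge0 ?andbT => [|j _]; last exact: mul_conjC_ge0.
  apply: contraNneq v0 => /eqP; rewrite psumr_eq0 => [|j _]; last exact: mul_conjC_ge0.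
  move=> /allP h; apply/eqP/rowP => j; rewrite mxE; apply/eqP.
  by have := h j (mem_index_enum _); rewrite mul_conjC_eq0.
rewrite -(ler_pM2r v_gt0); apply: (@le_trans _ _ ((v *m diag_mx dB *m v^t*) 0 0)).
  rewrite nE n1 mulr_sumr ler_sum// => j _.
  by rewrite ler_wpM2r ?mul_conjC_ge0.
rewrite vdw vw nE n1 mulr_sumr ler_sum// => k _.
have [/wK ->|kK] := boolP (k \in K); first by rewrite mul0r !mulr0.
by rewrite ler_wpM2r ?mul_conjC_ge0 ?dAbe.
Qed.

Lemma sorted_ge_nth (s : seq C) i j : sorted (fun x y => y <= x) s ->
  (i <= j)%N -> (j < size s)%N -> s`_j <= s`_i.
Proof.
move=> ss ij js; apply: (sorted_leq_nth (leT := fun x y : C => y <= x)) => //.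
- by move=> a b c ba cb; exact: le_trans cb ba.
- by rewrite inE (leq_ltn_trans ij js).
Qed.

Lemma interlacing m (s s' : seq C) (x : 'M[C]_(m + 1)) :
  has_spectrum s' x -> has_spectrum s (ulsubmx x) ->
  sorted (fun x y => y <= x) s' -> sorted (fun x y => y <= x) s ->
  forall i, (i < m)%N -> s`_i <= s'`_i /\ s'`_i.+1 <= s`_i.
Proof.
move=> sx sy ss' ss i im.
have szs := has_spectrum_size sy; have szs' := has_spectrum_size sx.
have [Q uQ xE] := spectrum_diag sx; have [U uU yE] := spectrum_diag sy.
pose V : 'M[C]_(m, m + 1) := row_mx 1%:M 0.
have VV : V *m V^t* = 1%:M.
  by rewrite /V tr_row_mx map_col_mx mul_row_col adj1 mulmx1 mul0mx addr0.
have VxV : ulsubmx x = V *m x *m V^t*.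
  rewrite /V -{2}[x]submxK mul_row_block !mul1mx !mul0mx !addr0.
  by rewrite tr_row_mx map_col_mx mul_row_col adj1 adj0 mulmx1 mulmx0 addr0.
(* The eigenbasis of the submatrix written in the eigenbasis of [x]. *)
pose T := U *m V *m Q^t*.
have TT : T *m T^t* = 1%:M.
  rewrite /T !adjM trmxCK !mulmxA -[_ *m Q^t* *m Q]mulmxA (unitary_adjl uQ) mulmx1.
  by rewrite -[_ *m V *m _]mulmxA VV mulmx1; exact/unitarymxP.
have TdT : T *m diag_mx (\row_i s'`_i) *m T^t* = diag_mx (\row_i s`_i).
  rewrite /T !adjM trmxCK !mulmxA.
  have -> : U *m V *m Q^t* *m diag_mx (\row_i s'`_i) *m Q = U *m V *m x.
    by rewrite xE !mulmxA.
  rewrite -[U *m V *m x]mulmxA -[U *m _ *m V^t*]mulmxA -VxV yE !mulmxA.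
  by rewrite (unitarymxP uU) mul1mx -mulmxA (unitarymxP uU) mulmx1.
have sub p (f : 'I_p -> 'I_m) : injective f ->
    rowsub f T *m (rowsub f T)^t* = 1%:M /\
    rowsub f T *m diag_mx (\row_i s'`_i) *m (rowsub f T)^t* = diag_mx (\row_i s`_(f i)).
  move=> fi; have h (A : 'M[C]_(m + 1)) (B : 'M[C]_m) : T *m A *m T^t* = B ->
      rowsub f T *m A *m (rowsub f T)^t* = mxsub f f B.
    move=> <-; apply/matrixP => j j'; rewrite !mxE; apply: eq_bigr => k' _.
    by rewrite !mxE; congr (_ * _); apply: eq_bigr => l _; rewrite !mxE.
  split.
    have := h 1%:M 1%:M; rewrite !mulmx1 => -> //.
    by apply/matrixP => j j'; rewrite !mxE (inj_eq fi).
  by rewrite (h _ _ TdT); apply/matrixP => j j'; rewrite !mxE (inj_eq fi).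
split.
  have wi : injective (widen_ord im) by move=> j j' /(congr1 val)/= /val_inj.
  have [i1 i2] := sub _ _ wi.
  (* The first [i + 1] rows against the first [i] entries of [s']: some combination of the rows
     avoids these. *)
  apply: (compression_le (K := [set k : 'I_(m + 1) | (k < i)%N]%SET) i1 i2).
  - have im' : (i <= m + 1)%N by rewrite (leq_trans (ltnW im))// leq_addr.
    have sub_im : ([set k : 'I_(m + 1) | (k < i)%N] \subset
        [set widen_ord im' j | j : 'I_i])%SET.
      apply/fintype.subsetP => k; rewrite inE => ki.
      by apply/imsetP; exists (Ordinal ki) => //; exact: val_inj.
    rewrite ltnS (leq_trans (subset_leq_card sub_im))// (leq_trans (leq_imset_card _ _))//.
    by rewrite card_ord.
  - by move=> j; rewrite mxE; apply: sorted_ge_nth; rewrite ?szs//= -ltnS ltn_ord.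
  - move=> k; rewrite inE -leqNgt => ik; by rewrite mxE; apply: sorted_ge_nth; rewrite ?szs' ?ltn_ord.
have jP (j : 'I_(m - i)) : (i + j < m)%N by rewrite -ltn_subRL.
have inj : injective (fun j => Ordinal (jP j)).
  by move=> j j' /(congr1 val)/= /addnI/val_inj.
have [i1 i2] := sub (m - i)%N (fun j => Ordinal (jP j)) inj.
(* The same argument for the negated matrix: the [m - i] rows from [i] on, against the [m - (i + 1)]
   entries of [s'] beyond position [i + 1]. *)
rewrite -lerN2; apply: (compression_le (dA := - \row_i s'`_i) (dB := - \row_j s`_(i + j))
  (K := [set k : 'I_(m + 1) | (i.+1 < k)%N]%SET) i1).
- have dN q (d : 'rV[C]_q) : diag_mx (- d) = - diag_mx d by exact: raddfN.
  by rewrite !dN mulmxN mulNmx i2.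
- have kP (j : 'I_(m - i.+1)) : (i.+2 + j < m + 1)%N.
    by rewrite addn1 addSn ltnS -ltn_subRL.
  have sub_im : ([set k : 'I_(m + 1) | (i.+1 < k)%N] \subset
      [set Ordinal (kP j) | j : 'I_(m - i.+1)])%SET.
    apply/fintype.subsetP => k; rewrite inE => ik.
    have kl : (k - i.+2 < m - i.+1)%N.
      have km : (k < m.+1)%N by apply: leq_trans (ltn_ord k) _; rewrite addn1.
      by rewrite ltn_subLR// addSn subnKC.
    by apply/imsetP; exists (Ordinal kl) => //; apply: val_inj; rewrite /= subnKC.
  apply: leq_ltn_trans (subset_leq_card sub_im) _.
  apply: leq_ltn_trans (leq_imset_card _ _) _.
  by rewrite card_ord ltn_sub2l.
- by move=> j; rewrite !mxE lerN2; apply: sorted_ge_nth; rewrite ?leq_addr ?szs ?jP.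
- move=> k; rewrite inE -leqNgt => ki; rewrite !mxE lerN2; apply: sorted_ge_nth => //.
  by rewrite szs' addn1 ltnS.
Qed.

End Interlacing.
(** * Fibers of the Gelfand-Cetlin system *)

Section Eigenvalues.
Variable R : realType.
Local Notation C := R[i].
Local Notation cplx := (map (fun r : R => r%:C%C : C)).
Local Notation geR := (fun x y : R => y <= x).

Lemma eigenvalues_sorted m (x : 'M[C]_m) : sorted geR (eigenvalues x).
Proof. by apply: sort_sorted => a b; rewrite orbC; exact: le_total. Qed.

Lemma eigenvalues_spectrum m (x : 'M[C]_m) : x^t* = x ->
  has_spectrum (cplx (eigenvalues x)) x.
Proof.
move=> hx; have sx : has_spectrum (char_roots x) x by split=> //; exact: char_rootsE.
split=> //; rewrite char_rootsE; apply: perm_big; rewrite perm_sym.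
have eE : cplx (map (@complex.Re R) (char_roots x)) = char_roots x.
  rewrite -map_comp; apply: map_id_in => z zx /=.
  by apply/RRe_real/CrealP; exact: spectrum_real sx _ zx.
by rewrite -[X in perm_eq _ X]eE; apply: perm_map; rewrite perm_sort.
Qed.

Lemma size_eigenvalues m (x : 'M[C]_m) : x^t* = x -> size (eigenvalues x) = m.
Proof. by move=> /eigenvalues_spectrum/has_spectrum_size; rewrite size_map. Qed.

Lemma spectrum_eigenvalues m (s : seq R) (x : 'M[C]_m) : sorted geR s ->
  has_spectrum (cplx s) x -> eigenvalues x = s.
Proof.
move=> ss [_ cx]; have h : perm_eq (char_roots x) (cplx s).
  by apply: perm_roots; rewrite -char_rootsE.
apply: (@sorted_eq _ geR) => //; last 1 first.
- rewrite perm_sort; have := perm_map (@complex.Re R) h.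
  by rewrite -map_comp map_id.
- by move=> a b c ba cb; exact: le_trans cb ba.
- by move=> a b; rewrite andbC => /le_anti.
- exact: eigenvalues_sorted.
Qed.

Lemma cplx_sorted (s : seq R) : sorted geR s ->
  sorted (fun x y : C => y <= x) (cplx s).
Proof. by rewrite sorted_map; apply: sub_sorted => a b /=; rewrite lecR. Qed.

(** Sizes such as [minn k.+1 (sz l)] and [sz k] are equal without being convertible; comparing
    entries through the values of the indices avoids casts. *)
Lemma has_spectrum_cast p q (s : seq C) (A : 'M[C]_p) (B : 'M[C]_q) : p = q ->
  (forall (i j : 'I_p) (i' j' : 'I_q), i = i' :> nat -> j = j' :> nat ->
    A i j = B i' j') -> has_spectrum s A -> has_spectrum s B.
Proof.
move=> pq; case: _ / pq B => B AB; suff -> : B = A by [].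
by apply/matrixP => i j; rewrite (AB i j i j).
Qed.

Lemma leading_adj m k (x : 'M[C]_m) : x^t* = x -> (leading k x)^t* = leading k x.
Proof.
move=> hx; apply/matrixP => i j; rewrite !mxE.
by have /matrixP/(_ (widen_ord (geq_minr k m) i) (widen_ord (geq_minr k m) j)) := hx; rewrite !mxE.
Qed.

Lemma towerP (a : nat -> seq C) l (x : 'M[C]_(sz l)) :
  tower a l x <-> forall k, (k <= l)%N -> has_spectrum (a k) (leading k.+1 x).
Proof.
have leadE k m (y : 'M[C]_m) (i j : 'I_(minn k m)) (i' j' : 'I_m) : i = i' :> nat -> j = j' :> nat ->
    leading k y i j = y i' j'.
  by move=> ii jj; rewrite mxE; congr (y _ _); exact: val_inj.
have full m m' (s : seq C) (y : 'M[C]_m) : m' = m ->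
    (has_spectrum s (leading m' y) <-> has_spectrum s y).
  move=> ->; split; apply: has_spectrum_cast; rewrite ?minnn// => i j i' j' ii jj.
    exact: leadE.
  by apply/esym/leadE.
elim: l x => [|l IHl] x.
  split=> [tx k|/(_ 0%N (leqnn _))/(full _ _ _ _ (esym (szE 0)))//].
  by rewrite leqn0 => /eqP ->; exact/(full _ _ _ _ (esym (szE 0))).
have sub k s : (k <= l)%N -> has_spectrum s (leading k.+1 (ulsubmx x : 'M_(sz l))) <->
    has_spectrum s (leading k.+1 x).
  move=> kl; have ke : minn k.+1 (sz l) = minn k.+1 (sz l.+1).
    by rewrite !szE !(minn_idPl _)// ltnS// leqW.
  have ue (i j : 'I_(minn k.+1 (sz l))) (i' j' : 'I_(minn k.+1 (sz l.+1))) : i = i' :> nat -> j = j' :> nat ->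
      leading k.+1 (ulsubmx x : 'M_(sz l)) i j = leading k.+1 x i' j'.
    by move=> ii jj; rewrite !mxE; congr (x _ _); exact: val_inj.
  split; first exact: has_spectrum_cast ke ue.
  apply: has_spectrum_cast (esym ke) _ => i j i' j' ii jj.
  by apply/esym/ue.
split=> [[sx /IHl h] k|h].
  rewrite leq_eqVlt ltnS => /predU1P[->|kl]; last by apply/sub => //; exact: h.
  exact/(full _ _ _ _ (esym (szE l.+1))).
split; first by have /(full _ _ _ _ (esym (szE l.+1))) := h l.+1 (leqnn _).
by apply/IHl => k kl; apply/sub => //; apply: h; exact: leqW.
Qed.

End Eigenvalues.

Lemma gc_systemE (R : realType) n (lam : 'I_n -> R) x k :
  gc_system lam x 0 k = gc_entry (enum_val k).1 (enum_val k).2 x.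
Proof. by rewrite mxE. Qed.

Section GelfandCetlinEntries.
Variable R : realType.

(* Opaque, so that conversion never unfolds [eigenvalues]. *)
Fact levels_sealed n :
  {f : 'M[R[i]]_n -> nat -> seq R | forall x k, f x k = eigenvalues (leading k.+1 x)}.
Proof. by exists (fun x k => eigenvalues (leading k.+1 x)). Qed.

Definition levels n (x : 'M[R[i]]_n) := sval (levels_sealed n) x.

Lemma levelsE n (x : 'M[R[i]]_n) k : levels x k = eigenvalues (leading k.+1 x).
Proof. exact: (svalP (levels_sealed n)). Qed.

(** Entries outside [gc_index] are constant on the orbit, so [gc_system] determines all of them. *)
Lemma gc_entry_eq n (lam : 'I_n -> R) x y :
  coadjoint_orbit lam x -> coadjoint_orbit lam y -> gc_system lam x = gc_system lam y ->
  forall i j, (i + j < n)%N -> gc_entry i j x = gc_entry i j y.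
Proof.
move=> Ox Oy xy i j ij.
have iN : (i < n)%N by exact: leq_ltn_trans (leq_addr _ _) ij.
have jN : (j < n)%N by exact: leq_ltn_trans (leq_addl _ _) ij.
have [ijI|ijI] := boolP ((Ordinal iN, Ordinal jN) \in gc_index lam).
  have E w : gc_system lam w 0 (enum_rank_in ijI (Ordinal iN, Ordinal jN)) = gc_entry i j w.
    by rewrite gc_systemE (enum_rankK_in ijI ijI).
  by rewrite -!E xy.
move: ijI; rewrite inE /= ij /= negbK => /asboolP[c hc].
by rewrite !hc.
Qed.

Lemma gc_system_ext n (lam : 'I_n -> R) x y :
  (forall i j, (i + j < n)%N -> gc_entry i j x = gc_entry i j y) ->
  gc_system lam x = gc_system lam y.
Proof.
move=> h; apply/rowP => k.
apply: etrans (gc_systemE x k) (etrans _ (esym (gc_systemE y k))); apply: h.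
by have := enum_valP k; rewrite inE => /andP[].
Qed.

End GelfandCetlinEntries.

Section GelfandCetlin.
Variables (R : realType) (l : nat).
Local Notation C := R[i].
Local Notation cplx := (map (fun r : R => r%:C%C : C)).
Local Notation n := (sz l).
Variable lam : 'I_n -> R.
Local Notation O := (coadjoint_orbit lam).

Lemma orbit_adj x : O x -> x^t* = x.
Proof. by case=> /hermsymmxP. Qed.


Lemma size_levels (x : 'M[C]_n) k : x^t* = x -> (k <= l)%N -> size (levels x k) = k.+1.
Proof.
move=> hx kl; rewrite levelsE size_eigenvalues; last exact: leading_adj.
by apply/minn_idPl; rewrite szE ltnS.
Qed.

Lemma gc_entry_levels (x : 'M[C]_n) i j : gc_entry i j x = nth 0 (levels x (i + j)) i.
Proof. by rewrite levelsE. Qed.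

Lemma levels_eq x y : O x -> O y -> gc_system lam x = gc_system lam y ->
  forall k, (k <= l)%N -> levels x k = levels y k.
Proof.
move=> Ox Oy xy k kl; have hx := orbit_adj Ox; have hy := orbit_adj Oy.
have sx := size_levels hx kl; have sy := size_levels hy kl.
apply: (@eq_from_nth _ 0); first exact: etrans sx (esym sy).
move=> i; rewrite sx ltnS => ik.
have kn : (i + (k - i) < n)%N by rewrite (subnKC ik) szE ltnS.
have := gc_entry_eq Ox Oy xy kn.
by rewrite !gc_entry_levels (subnKC ik).
Qed.

Lemma tower_levels x : O x -> tower (fun k => cplx (levels x k)) l x.
Proof.
move=> Ox; apply/towerP => k kl; rewrite levelsE; apply: eigenvalues_spectrum.
exact/leading_adj/orbit_adj.
Qed.

(** Membership in the orbit is the condition at the top level of the tower, and the entries omitted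
    from [gc_system] are recovered by [gc_entry_eq]. *)
Lemma gc_fiber_tower x0 : O x0 ->
  gc_fiber lam (gc_system lam x0) = tower (fun k => cplx (levels x0 k)) l.
Proof.
move=> O0; apply/seteqP; split=> x.
  move=> [Ox /= xx0]; apply/towerP => k kl; rewrite -(levels_eq Ox O0 xx0 kl).
  by have /towerP h := tower_levels Ox; exact: h.
move=> tx; have [hx cx] := tower_spectrum tx.
have [_ c0] := tower_spectrum (tower_levels O0).
split; first by split; [exact/hermsymmxP|rewrite cx -c0; case: O0].
apply: gc_system_ext => i j; rewrite {1}szE ltnS => ijl; rewrite !gc_entry_levels.
have e : levels x (i + j) = levels x0 (i + j).
  rewrite [LHS]levelsE; apply: spectrum_eigenvalues.
    by rewrite levelsE; exact: eigenvalues_sorted.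
  by have /towerP h := tx; exact: h.
by rewrite e.
Qed.

Lemma levels_interlacing x k i : O x -> (k < l)%N -> (i <= k)%N ->
  nth 0 (levels x k) i <= nth 0 (levels x k.+1) i /\
  nth 0 (levels x k.+1) i.+1 <= nth 0 (levels x k) i.
Proof.
move=> Ox kl ik; have hx := orbit_adj Ox.
have h m (A : 'M[C]_(m + 1)) : A^t* = A -> forall j, (j < m)%N ->
    nth 0 (eigenvalues (ulsubmx A)) j <= nth 0 (eigenvalues A) j /\
    nth 0 (eigenvalues A) j.+1 <= nth 0 (eigenvalues (ulsubmx A)) j.
  move=> hA j jm; have [hy _ _] := hermitian_bord hA.
  have sA := size_eigenvalues hA; have sy := size_eigenvalues hy.
  have := interlacing (eigenvalues_spectrum hA) (eigenvalues_spectrum hy)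
    (cplx_sorted (eigenvalues_sorted _)) (cplx_sorted (eigenvalues_sorted _)) jm.
  rewrite !(nth_map 0) ?sA ?sy ?addn1 ?ltnS//; last exact: ltnW.
  by rewrite !lecR.
have ck q (B : 'M[C]_q) q' (B' : 'M[C]_q') : B^t* = B -> q = q' ->
    (forall (i j : 'I_q) (i' j' : 'I_q'), i = i' :> nat -> j = j' :> nat ->
      B i j = B' i' j') ->
    eigenvalues B = eigenvalues B'.
  move=> hB qq BB; apply/esym/spectrum_eigenvalues; first exact: eigenvalues_sorted.
  exact: has_spectrum_cast qq BB (eigenvalues_spectrum hB).
have k2 : (k.+1 + 1 <= n)%N by rewrite addn1 szE ltnS.
have hA : (mxsub (widen_ord k2) (widen_ord k2) x)^t* = mxsub (widen_ord k2) (widen_ord k2) x.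
  apply/matrixP => a b; rewrite !mxE.
  by have /matrixP/(_ (widen_ord k2 a) (widen_ord k2 b)) := hx; rewrite !mxE.
have -> : levels x k.+1 = eigenvalues (mxsub (widen_ord k2) (widen_ord k2) x).
  rewrite levelsE; apply: ck; first exact: leading_adj.
    by rewrite addn1; apply/minn_idPl; rewrite szE ltnS.
  by move=> a b a' b' aa bb; rewrite !mxE; congr (x _ _); exact: val_inj.
have -> : levels x k = eigenvalues (ulsubmx (mxsub (widen_ord k2) (widen_ord k2) x)).
  rewrite levelsE; apply: ck; first exact: leading_adj.
    by apply/minn_idPl; rewrite szE ltnS ltnW.
  by move=> a b a' b' aa bb; rewrite !mxE; congr (x _ _); exact: val_inj.
by apply: h; rewrite ?ltnS.
Qed.

End GelfandCetlin.
(** * Points in the relative interior of the same face *)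

(** Two terms of a monotone sequence agree exactly when all neighbours between them agree. *)
Lemma adjacent_pattern (R : realDomainType) N (f g : nat -> R) :
  (forall p, (p < N)%N -> f p.+1 <= f p) -> (forall p, (p < N)%N -> g p.+1 <= g p) ->
  (forall p, (p < N)%N -> (f p == f p.+1) = (g p == g p.+1)) ->
  forall p q, (p <= N)%N -> (q <= N)%N -> (f p == f q) = (g p == g q).
Proof.
have mono (h : nat -> R) : (forall p, (p < N)%N -> h p.+1 <= h p) ->
    forall d p, (p + d <= N)%N -> h (p + d)%N <= h p.
  move=> hd; elim=> [|d IHd] p; first by rewrite addn0.
  by rewrite addnS => pd; apply: le_trans (hd _ pd) (IHd _ (ltnW pd)).
have step (h : nat -> R) : (forall p, (p < N)%N -> h p.+1 <= h p) ->
    forall d p, (p + d.+1 <= N)%N ->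
    (h p == h (p + d.+1)%N) = (h p == h (p + d)%N) && (h (p + d)%N == h (p + d).+1).
  move=> hd d p; rewrite addnS => pd.
  have h1 := hd _ pd; have h2 := mono h hd d p (ltnW pd).
  apply/eqP/andP => [e|[/eqP -> /eqP //]].
  have e' : h p = h (p + d)%N by apply: le_anti; rewrite h2 e h1.
  by split; apply/eqP => //; rewrite -e' -e.
move=> fd gd fg.
have key d p : (p + d <= N)%N -> (f p == f (p + d)%N) = (g p == g (p + d)%N).
  elim: d p => [|d IHd] p pd; first by rewrite addn0 !eqxx.
  by rewrite step// [RHS]step// IHd 1?fg// -?addnS// ltnW// -addnS.
move=> p q pN qN; case: (leqP p q) => [pq|/ltnW qp].
  by rewrite -(subnKC pq) key// subnKC.
by rewrite [LHS]eq_sym [RHS]eq_sym -(subnKC qp) key// subnKC.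
Qed.

(** The coefficients sum to 1, so the point lies in the affine hull, and for small [e] it stays in
    the neighbourhood [U] of [u]. *)
Lemma relint_extend (R : realType) (m : nat) (A : set 'rV[R]_m) u v :
  relative_interior A u -> A v -> exists2 e : R, 0 < e & A ((1 + e) *: u - e *: v).
Proof.
move=> [Au [U [oU Uu UA]]] Av.
have /nbhs_normP[e /= e0 eU] : nbhs u U by apply: open_nbhs_nbhs.
(* The factor 2 makes the estimate strict, and the summand 1 covers the case [u = v]. *)
pose d := e / (2 * (`|u - v| + 1)).
have n0 : 0 < `|u - v| + 1 by rewrite ltr_wpDl.
have d0 : 0 < d by rewrite divr_gt0// mulr_gt0.
exists d => //; apply: UA; split.
  apply: eU; rewrite /ball_ /=.
  have -> : u - ((1 + d) *: u - d *: v) = - (d *: (u - v)).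
    by rewrite scalerDl scale1r scalerBr -addrA opprD addrA subrr add0r.
  rewrite normrN normrZ gtr0_norm//; apply: (@le_lt_trans _ _ (d * (`|u - v| + 1))).
    by rewrite ler_pM2l// lerDl.
  by rewrite /d invfM mulrA divfK ?gt_eqF// ltr_pdivrMr// ltr_pMr// ltr1n.
exists 2%N, (fun i : 'I_2 => if i == 0 then 1 + d else - d),
  (fun i : 'I_2 => if i == 0 then u else v); split.
- by move=> i; case: ifP.
- by rewrite !big_ord_recl big_ord0 /= addr0 addrK.
- by rewrite !big_ord_recl big_ord0 /= addr0 scaleNr.
Qed.

(** The constant entries, which [gc_system] omits, obey the relation too, because the coefficients
    sum to 1. *)
Lemma gc_entry_comb (R : realType) n (lam : 'I_n -> R) x1 x2 x3 (e : R) :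
  coadjoint_orbit lam x1 -> coadjoint_orbit lam x2 -> coadjoint_orbit lam x3 ->
  gc_system lam x3 = (1 + e) *: gc_system lam x1 - e *: gc_system lam x2 ->
  forall i j, (i + j < n)%N ->
    gc_entry i j x3 = (1 + e) * gc_entry i j x1 - e * gc_entry i j x2.
Proof.
move=> O1 O2 O3 xe i j ij.
have iN : (i < n)%N by exact: leq_ltn_trans (leq_addr _ _) ij.
have jN : (j < n)%N by exact: leq_ltn_trans (leq_addl _ _) ij.
have [ijI|ijI] := boolP ((Ordinal iN, Ordinal jN) \in gc_index lam).
  have E w : gc_system lam w 0 (enum_rank_in ijI (Ordinal iN, Ordinal jN)) = gc_entry i j w.
    by rewrite gc_systemE (enum_rankK_in ijI ijI).
  have comb N (u v : 'rV[R]_N) k : ((1 + e) *: u - e *: v) 0 k =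
      (1 + e) * u 0 k - e * v 0 k by rewrite !mxE.
  by rewrite -!E xe comb.
move: ijI; rewrite inE /= ij /= negbK => /asboolP[c hc].
by rewrite !hc// -mulrBl addrK mul1r.
Qed.

Lemma tower_ext (C : numClosedFieldType) (a b : nat -> seq C) l :
  (forall k, (k <= l)%N -> a k = b k) -> tower a l = tower b l.
Proof.
elim: l => [|l IHl] ab /=; first by rewrite ab.
by rewrite ab// IHl// => k kl; apply: ab; exact: leqW.
Qed.

Lemma mem_zip_nth (T : eqType) (x0 : T) (s t : seq T) p : size s = size t ->
  p \in zip s t -> exists2 i, (i < size s)%N & p = (nth x0 s i, nth x0 t i).
Proof.
move=> st pz; case/(nthP (x0, x0)): pz => i; rewrite size_zip st minnn => it <-.
by exists i => //; rewrite nth_zip.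
Qed.

Section Faces.
Variables (R : realType) (l : nat).
Local Notation C := R[i].
Local Notation n := (sz l).
Local Notation cplx := (map (fun r : R => r%:C%C : C)).
Variable lam : 'I_n -> R.
Local Notation O := (coadjoint_orbit lam).

(* Non-increasing in [p] by Cauchy interlacing. *)
Definition interleave (x : 'M[C]_n) k p : R :=
  if odd p then nth 0 (levels x k) p./2 else nth 0 (levels x k.+1) p./2.

Lemma interleave_odd x k i : interleave x k i.*2.+1 = nth 0 (levels x k) i.
Proof. by rewrite /interleave /= odd_double /= uphalf_double. Qed.

Lemma interleave_even x k i : interleave x k i.*2 = nth 0 (levels x k.+1) i.
Proof. by rewrite /interleave odd_double doubleK. Qed.

Lemma interleave_le x k p : O x -> (k < l)%N -> (p < k.+1.*2)%N ->
  interleave x k p.+1 <= interleave x k p.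
Proof.
move=> Ox kl; rewrite -[p]odd_double_half; case: (odd p) => /=; set i := p./2.
  rewrite add1n -doubleS => pk; rewrite interleave_even interleave_odd.
  have ik : (i <= k)%N by rewrite -ltnS -ltn_double doubleS ltnW// ltnW.
  by case: (levels_interlacing Ox kl ik).
rewrite add0n ltn_double ltnS => ik; rewrite interleave_even interleave_odd.
by case: (levels_interlacing Ox kl ik).
Qed.

(** At the point [x3] beyond [x1], each gap between neighbours is [1 + e] times the gap at [x1]
    minus [e] times that at [x2]. All gaps are nonnegative, so one that vanishes at [x1] vanishes at
    [x2]. *)
Lemma face_interleave x1 x2 F : O x1 -> O x2 -> F `<=` gc_polytope lam ->
  relative_interior F (gc_system lam x1) -> F (gc_system lam x2) ->
  forall k p, (k < l)%N -> (p < k.+1.*2)%N ->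
  interleave x1 k p = interleave x1 k p.+1 -> interleave x2 k p = interleave x2 k p.+1.
Proof.
move=> O1 O2 FP r1 F2 k p kl pk e1.
have [e e0 /FP[x3 O3 x3E]] := relint_extend r1 F2.
have ent := gc_entry_comb O1 O2 O3 x3E.
have lev j i : (j <= l)%N -> (i <= j)%N -> nth 0 (levels x3 j) i =
    (1 + e) * nth 0 (levels x1 j) i - e * nth 0 (levels x2 j) i.
  move=> jl ij; have := ent i (j - i)%N; rewrite (subnKC ij) {1}szE ltnS => /(_ jl).
  by rewrite !gc_entry_levels (subnKC ij).
have comb q : (q <= k.+1.*2)%N -> interleave x3 k q =
    (1 + e) * interleave x1 k q - e * interleave x2 k q.
  rewrite -[q]odd_double_half; case: (odd q) => /=; set i := q./2.
    rewrite add1n => qk; have ik : (i <= k)%N by rewrite -ltnS -ltn_double.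
    by rewrite !interleave_odd (lev k i (ltnW kl) ik).
  by rewrite add0n leq_double => ik; rewrite !interleave_even (lev k.+1 i kl ik).
have h3 := interleave_le O3 kl pk; have h2 := interleave_le O2 kl pk.
apply: le_anti; rewrite h2 andbT.
by move: h3; rewrite (comb p.+1 pk) (comb p (ltnW pk)) -e1 lerD2l lerN2 (ler_pM2l e0).
Qed.

Lemma face_pattern x1 x2 F : O x1 -> O x2 -> F `<=` gc_polytope lam ->
  relative_interior F (gc_system lam x1) -> relative_interior F (gc_system lam x2) ->
  forall k p q, (k < l)%N -> (p <= k.+1.*2)%N -> (q <= k.+1.*2)%N ->
  (interleave x1 k p == interleave x1 k q) = (interleave x2 k p == interleave x2 k q).
Proof.
move=> O1 O2 FP r1 r2 k p q kl; apply: adjacent_pattern.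
- by move=> j; exact: interleave_le.
- by move=> j; exact: interleave_le.
- move=> j jk; apply/eqP/eqP.
    by apply: face_interleave r1 (proj1 r2) _ _ kl jk.
  by apply: face_interleave r2 (proj1 r1) _ _ kl jk.
Qed.

Lemma gc_fiber_diffeo (F : set 'rV[R]_#|gc_index lam|) u1 u2 : (0 < l)%N ->
  F `<=` gc_polytope lam -> relative_interior F u1 -> relative_interior F u2 ->
  diffeomorphic (@mx_coord R n @` gc_fiber lam u1) (@mx_coord R n @` gc_fiber lam u2).
Proof.
move=> l0 FP r1 r2.
have [x1 O1 u1E] := FP _ (proj1 r1); have [x2 O2 u2E] := FP _ (proj1 r2).
have E1 := gc_fiber_tower O1; have E2 := gc_fiber_tower O2.
rewrite u1E in E1; rewrite u2E in E2; rewrite E1 E2.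
rewrite -u1E in r1; rewrite -u2E in r2.
have pat := face_pattern O1 O2 FP r1 r2.
(* Eigenvalues are paired by position in the sorted lists; [pat] then yields [matched] inside a
   level and [crossed] between neighbouring levels. *)
pose z k := zip (cplx (levels x1 k)) (cplx (levels x2 k)).
have szz k : (k <= l)%N -> size (cplx (levels x1 k)) = size (cplx (levels x2 k)).
  move=> kl; rewrite !size_map (size_levels (orbit_adj O1) kl).
  by rewrite (size_levels (orbit_adj O2) kl).
have z1 k : (k <= l)%N -> unzip1 (z k) = cplx (levels x1 k).
  by move=> kl; rewrite unzip1_zip// szz.
have z2 k : (k <= l)%N -> unzip2 (z k) = cplx (levels x2 k).
  by move=> kl; rewrite unzip2_zip// szz.
have zP k p : (k <= l)%N -> p \in z k -> exists2 i, (i <= k)%N &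
    p = ((nth 0 (levels x1 k) i)%:C%C, (nth 0 (levels x2 k) i)%:C%C).
  move=> kl pz; have [j jk ->] := mem_zip_nth (0 : C) (szz k kl) pz; exists j.
    by move: jk; rewrite size_map (size_levels (orbit_adj O1) kl) ltnS.
  rewrite size_map (size_levels (orbit_adj O1) kl) in jk.
  rewrite !(nth_map (0 : R)) ?(size_levels (orbit_adj O1) kl)//.
  by rewrite ?(size_levels (orbit_adj O2) kl).
have mz k : (k <= l)%N -> matched (z k).
  move=> kl p q /(zP _ _ kl)[i ik ->] /(zP _ _ kl)[j jk ->] /=.
  rewrite !(inj_eq (@complexI R)).
  (* The top level occurs only as the even entries of the interleaving with the level below, which
     exists because [0 < l]. *)
  move: kl; rewrite leq_eqVlt => /predU1P[kE|kl].
    case: k ik jk kE => [|k] ik jk kE; first by rewrite -kE in l0.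
    have := pat k i.*2 j.*2; rewrite !interleave_even !leq_double; apply=> //.
    by rewrite -kE.
  have := pat k i.*2.+1 j.*2.+1 kl; rewrite !interleave_odd; apply.
    by rewrite doubleS ltnS ltnW// ltnS leq_double.
  by rewrite doubleS ltnS ltnW// ltnS leq_double.
have cz k : (k < l)%N -> crossed (z k) (z k.+1).
  move=> kl p q /(zP _ _ (ltnW kl))[i ik ->] /(zP _ _ kl)[j jk ->] /=.
  rewrite !(inj_eq (@complexI R)).
  have := pat k i.*2.+1 j.*2 kl; rewrite !interleave_odd !interleave_even; apply.
    by rewrite doubleS ltnS ltnW// ltnS leq_double.
  by rewrite leq_double.
have e1 := tower_ext z1; have e2 := tower_ext z2.
rewrite -e1 -e2; apply: tower_diffeo => //.
  by rewrite e1; exists x1; exact: tower_levels O1.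
by rewrite e2; exists x2; exact: tower_levels O2.
Qed.

End Faces.
(** * Isotropy *)

Section IsotropyAlgebra.
Variable C : numClosedFieldType.

Definition comm_mx m (X Y : 'M[C]_m) : 'M[C]_m := X *m Y - Y *m X.

(* The infinitesimal rotation attached to a curve of spectral projections. *)
Lemma projection_rotation m (I : eqType) (r : seq I) (P P' : I -> 'M[C]_m) : uniq r ->
  (forall i, (P i)^t* = P i) -> (forall i, (P' i)^t* = P' i) ->
  (forall i j, i \in r -> j \in r -> P i *m P j = if i == j then P i else 0) ->
  (forall i j, i \in r -> j \in r ->
     P' i *m P j + P i *m P' j = if i == j then P' i else 0) ->
  \sum_(i <- r) P i = 1%:M -> \sum_(i <- r) P' i = 0 ->
  exists X : 'M[C]_m, X^t* = - X /\ forall i, i \in r -> P' i = comm_mx X (P i).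
Proof.
(* Kato's generator for a moving family of projections. It is skew because the products
   [P' i *m P i] and their adjoints add up to the sum of the [P' i], which is 0. *)
move=> ur hP hP' PP PP' sP sP'; exists (\sum_(i <- r) P' i *m P i); split.
  apply/eqP; rewrite -addr_eq0 adj_sum -big_split /=.
  rewrite (eq_big_seq P') ?sP'// => i ir.
  by rewrite adjM hP hP' addrC PP'// (eqxx i).
move=> i ir; rewrite /comm_mx mulmx_suml mulmx_sumr -sumrB.
(* For distinct indices the derivative of [P i *m P j = 0] moves the prime to the other factor up to
   sign; for equal ones it gives the classical [P *m P' *m P = 0]. *)
have PPP j : j \in r -> P i *m (P' j *m P j) = if i == j then 0 else - (P' i *m P j).
  move=> jr; rewrite mulmxA; have [ij|ij] := eqVneq i j.
    rewrite -{j}ij in jr *; have := congr1 (mulmx (P i)) (PP' i i ir ir).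
    rewrite (eqxx i) mulmxDr [P i *m (P i *m _)]mulmxA PP// (eqxx i) !mulmxA.
    by move/(canRL (addrK _)); rewrite subrr.
  have := PP' i j ir jr; rewrite (negPf ij) => /eqP; rewrite addrC addr_eq0 => /eqP ->.
  by rewrite mulNmx -mulmxA PP// (eqxx j).
rewrite (eq_big_seq (fun j => P' i *m P j)) => [|j jr].
  by rewrite -mulmx_sumr sP mulmx1.
rewrite -mulmxA PP// PPP//; have [->|ji] := eqVneq j i.
  by rewrite subr0.
by rewrite mulmx0 sub0r opprK.
Qed.

Lemma tr_comm m (h X Y : 'M[C]_m) : \tr (h *m comm_mx X Y) = \tr (comm_mx Y h *m X).
Proof.
rewrite /comm_mx mulmxBr mulmxBl !mxtraceB !mulmxA; congr (_ - _).
by rewrite mxtrace_mulC mulmxA.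
Qed.

Lemma tr_comml m (h X Y : 'M[C]_m) : \tr (h *m comm_mx X Y) = - \tr (comm_mx X h *m Y).
Proof.
rewrite /comm_mx mulmxBr mulmxBl !mxtraceB opprB !mulmxA; congr (_ - _).
by rewrite mxtrace_mulC mulmxA.
Qed.

Lemma mulmx11C (A B : 'M[C]_1) : A *m B = B *m A.
Proof. by rewrite [B]mx11_scalar scalar_mxC. Qed.

(* Write [X] as the generator [Xk] one level below plus a rest that moves the border
   [b] with velocity [a].  The first part contributes [IH]; the second contributes
   [a^t* *m z - z^t* *m a], where [z] is the border of [Y].  Both [P mu *m a] and
   [P mu *m z] are imaginary multiples of [P mu *m b], so this vanishes. *)
Section Step.
Variables (m : nat) (s : seq C) (y : 'M[C]_m) (b : 'cV[C]_m) (c : C).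
Hypothesis sy : has_spectrum s y.
Local Notation h := (bord y b c).
Local Notation P := (sproj s y).
Variables (X Y : 'M[C]_(m + 1)) (Xk Yk : 'M[C]_m).
Hypotheses (sX : X^t* = - X) (sY : Y^t* = - Y) (sXk : Xk^t* = - Xk).
Let v := comm_mx X h.
Let w := comm_mx Y h.
Hypotheses (hc : c^* = c) (vk : ulsubmx v = comm_mx Xk y) (wk : ulsubmx w = comm_mx Yk y)
  (v0 : drsubmx v = 0) (IH : \tr (ulsubmx w *m Xk) = 0).
Let a := ursubmx v - Xk *m b.
Hypotheses (aP0 : forall mu, wt s y b mu = 0 -> P mu *m a = 0)
  (aP : forall mu, a^t* *m P mu *m b + b^t* *m P mu *m a = 0).

Lemma isotropy_step : \tr (w *m X) = 0.
Proof.
have hh : h^t* = h by exact: bord_hermitian (proj1 sy) hc.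
pose X0 : 'M[C]_(m + 1) := block_mx Xk 0 0 0.
have X0h : comm_mx X0 h = block_mx (comm_mx Xk y) (Xk *m b) (- (b^t* *m Xk)) 0.
  rewrite /comm_mx /X0 /bord !mulmx_block !mul0mx !mulmx0 !addr0.
  by rewrite opp_block_mx add_block_mx !sub0r !subr0 oppr0.
have hv : v^t* = v.
  by rewrite /v /comm_mx adjB !adjM hh sX mulmxN mulNmx opprK addrC.
have vE : v = block_mx (comm_mx Xk y) (ursubmx v) ((ursubmx v)^t*) 0.
  have : (block_mx (ulsubmx v) (ursubmx v) (dlsubmx v) (drsubmx v))^t* =
      block_mx (ulsubmx v) (ursubmx v) (dlsubmx v) (drsubmx v) by rewrite !submxK.
  rewrite adj_block => /eq_block_mx[_ _ vr _].
  by rewrite -[LHS]submxK vk -vr v0.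
have v'E : comm_mx (X - X0) h = block_mx 0 a (a^t*) 0.
  have -> : comm_mx (X - X0) h = v - comm_mx X0 h.
    by rewrite /comm_mx mulmxBl mulmxBr opprB addrACA [in RHS]opprB [_ - h *m X]addrC addrACA addrC.
  rewrite X0h {1}vE opp_block_mx add_block_mx subrr subr0 opprK /a; congr block_mx.
  by rewrite adjB adjM sXk mulmxN opprK.
have -> : w *m X = w *m X0 + w *m (X - X0) by rewrite -mulmxDr addrC subrK.
rewrite mxtraceD; have -> : \tr (w *m X0) = 0.
  by rewrite -{1}[w]submxK mulmx_block !mulmx0 !addr0 mxtrace_block mxtrace0 addr0.
rewrite add0r /w -tr_comm tr_comml.
pose z := ursubmx Y.
have dlY : dlsubmx Y = - z^t*.
  have : (block_mx (ulsubmx Y) (ursubmx Y) (dlsubmx Y) (drsubmx Y))^t* =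
      - block_mx (ulsubmx Y) (ursubmx Y) (dlsubmx Y) (drsubmx Y) by rewrite !submxK.
  rewrite adj_block opp_block_mx => /eq_block_mx[_ _ zE _].
  by rewrite /z zE opprK.
(* The upper left block of [w] computed twice, from [Y] and from [Yk]. *)
have tl : comm_mx (ulsubmx Y - Yk) y + z *m b^t* + b *m z^t* = 0.
  have := wk; rewrite /w /comm_mx -{1 2}[Y]submxK /bord !mulmx_block opp_block_mx add_block_mx.
  rewrite block_mxKul dlY -/z mulmxN mulmxBl mulmxBr => e.
  move: e.
  set A1 := _ *m y; set A2 := z *m _; set A3 := y *m _; set A4 := b *m _.
  set A5 := Yk *m y; set A6 := y *m Yk => e.
  have -> : A1 - A5 - (A3 - A6) + A2 + A4 = A1 + A2 - (A3 - A4) - (A5 - A6).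
    by rewrite !opprD !opprK !addrA [LHS](ACl (1*5*3*6*2*4)).
  by rewrite e subrr.
(* Between two copies of [P mu] a commutator with [y] vanishes, since [y] acts as the scalar [mu] on
   both sides. *)
have sand mu : P mu *m z *m (b^t* *m P mu) + P mu *m b *m (z^t* *m P mu) = 0.
  have := congr1 (fun A => P mu *m A *m P mu) tl.
  rewrite /comm_mx; move: (ulsubmx Y - Yk) => D.
  rewrite !mulmxDr !mulmxDl mulmx0 mul0mx mulmxN mulNmx !mulmxA (sproj_mul sy).
  rewrite -[_ *m y *m P mu]mulmxA (mul_sproj sy).
  by rewrite -scalemxAr -!scalemxAl subrr add0r.
suff e0 : a^t* *m z = z^t* *m a.
  rewrite v'E -[Y]submxK mulmx_block mxtrace_block !mul0mx !add0r addr0 dlY -/z.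
  by rewrite mulmxN raddfN /= mxtrace_mulC -e0 addNr oppr0.
rewrite -[z in LHS]mul1mx -[a in RHS]mul1mx -(sproj_sum sy) !mulmx_suml !mulmx_sumr.
apply: eq_bigr => mu _; rewrite !mulmxA.
have [w0|w0] := eqVneq (wt s y b mu) 0.
  have aP' : a^t* *m P mu = 0.
    by rewrite -(sproj_adj sy) -adjM aP0// adj0.
  by rewrite aP' mul0mx -mulmxA aP0// mulmx0.
have PPl p (A : 'M_(m, p)) : P mu *m (P mu *m A) = P mu *m A.
  by rewrite mulmxA (sprojM sy) (eqxx mu).
(* The weight is [b^t* *m P mu *m b] by [wtM], so multiplying by it inserts [b] on both sides and
   [sand] applies; [K] cancels it at the end. *)
have r1 : a^t* *m P mu *m z *m (wt s y b mu)%:M =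
    - (a^t* *m P mu *m b *m (z^t* *m P mu *m b)).
  rewrite -wtM; have := congr1 (fun A => a^t* *m P mu *m A *m (P mu *m b)) (sand mu).
  rewrite mulmxDr mulmxDl mulmx0 mul0mx => /eqP; rewrite addr_eq0 => /eqP.
  by rewrite -!mulmxA !PPl.
have r2 : z^t* *m P mu *m a *m (wt s y b mu)%:M =
    - (b^t* *m P mu *m z *m (b^t* *m P mu *m a)).
  have := congr1 (fun A => A^t*) r1.
  rewrite adjN !adjM !trmxCK (sproj_adj sy) adj_scalar (wt_conj b sy) !mulmxA => <-.
  by rewrite [LHS]scalar_mxC !mulmxA.
have e1 : b^t* *m P mu *m a = - (a^t* *m P mu *m b).
  by apply/eqP; rewrite -addr_eq0 addrC aP.
have e2 : (b^t* *m P mu *m z) *m (wt s y b mu)%:M = - ((wt s y b mu)%:M *m (z^t* *m P mu *m b)).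
  have := congr1 (fun A => b^t* *m A *m (P mu *m b)) (sand mu).
  rewrite mulmxDr mulmxDl mulmx0 mul0mx => /eqP; rewrite addr_eq0 => /eqP.
  by rewrite -!wtM -!mulmxA !PPl.
have K (A B : 'M[C]_1) : A *m (wt s y b mu)%:M = B *m (wt s y b mu)%:M -> A = B.
  by rewrite !mul_mx_scalar => /(scalerI w0).
have e3 : b^t* *m P mu *m z = - (z^t* *m P mu *m b).
  by apply: K; rewrite e2 mulNmx scalar_mxC.
apply: K; rewrite r1 r2 e1 e3 mulmxN mulNmx opprK; congr (- _).
exact: mulmx11C.
Qed.

End Step.

End IsotropyAlgebra.

(** * Derivatives at 0 of curves of complex matrices, and isotropy of towers *)

Section CurveDerivatives.
Variable R : realType.
Local Notation C := R[i].

Definition cder (f : R -> C) (d : C) : Prop :=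
  is_derive (0 : R) (1 : R) (fun t => complex.Re (f t)) (complex.Re d) /\
  is_derive (0 : R) (1 : R) (fun t => complex.Im (f t)) (complex.Im d).

Definition mder m n (F : R -> 'M[C]_(m, n)) (D : 'M[C]_(m, n)) : Prop :=
  forall i j, cder (fun t => F t i j) (D i j).

Lemma cder_near f g d : (\forall t \near (0 : R), f t = g t) -> cder f d -> cder g d.
Proof.
move=> fg [d1 d2]; split.
  by apply: near_eq_is_derive d1; near=> t; congr complex.Re; near: t.
by apply: near_eq_is_derive d2; near=> t; congr complex.Im; near: t.
Unshelve. all: by end_near. Qed.

Lemma cder_ext f g d e : f =1 g -> d = e -> cder f d -> cder g e.
Proof. by move=> /funext -> ->. Qed.

Lemma cder_unique f d e : cder f d -> cder f e -> d = e.
Proof.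
move=> [d1 d2] [e1 e2]; apply/eqP; rewrite eq_complex; apply/andP; split; apply/eqP.
  by rewrite -(@derive_val _ _ _ _ _ _ _ d1) (@derive_val _ _ _ _ _ _ _ e1).
by rewrite -(@derive_val _ _ _ _ _ _ _ d2) (@derive_val _ _ _ _ _ _ _ e2).
Qed.

Lemma cder_cst c : cder (fun=> c) 0.
Proof. by split; exact: is_derive_cst. Qed.

Lemma cderD f g d e : cder f d -> cder g e -> cder (fun t => f t + g t) (d + e).
Proof.
move=> [d1 d2] [e1 e2]; split.
  have -> : complex.Re (d + e) = complex.Re d + complex.Re e by case: (d); case: (e).
  have -> : (fun t => complex.Re (f t + g t)) =
      (fun t => complex.Re (f t)) + (fun t => complex.Re (g t)).
    by apply/funext => t; rewrite [RHS]/GRing.add /=; case: (f t); case: (g t).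
  exact: is_deriveD.
have -> : complex.Im (d + e) = complex.Im d + complex.Im e by case: (d); case: (e).
have -> : (fun t => complex.Im (f t + g t)) =
    (fun t => complex.Im (f t)) + (fun t => complex.Im (g t)).
  by apply/funext => t; rewrite [RHS]/GRing.add /=; case: (f t); case: (g t).
exact: is_deriveD.
Qed.

Lemma ReM (x z : C) :
  complex.Re (x * z) = complex.Re x * complex.Re z - complex.Im x * complex.Im z.
Proof. by case: x; case: z. Qed.

Lemma ImM (x z : C) :
  complex.Im (x * z) = complex.Re x * complex.Im z + complex.Im x * complex.Re z.
Proof. by case: x; case: z. Qed.

Lemma cderM f g d e : cder f d -> cder g e ->
  cder (fun t => f t * g t) (f 0 * e + g 0 * d).
Proof.
move=> [d1 d2] [e1 e2]; split.
  have -> : (fun t => complex.Re (f t * g t)) =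
      (fun t => complex.Re (f t)) * (fun t => complex.Re (g t)) -
      (fun t => complex.Im (f t)) * (fun t => complex.Im (g t)).
    by apply/funext => t; exact: ReM.
  apply: is_derive_eq (is_deriveB (is_deriveM d1 e1) (is_deriveM d2 e2)) _.
  case: (f 0) (g 0) d e {d1 d2 e1 e2} => [a b] [a' b'] [d d'] [e e'] /=.
  by rewrite /GRing.scale /= opprD addrACA.
have -> : (fun t => complex.Im (f t * g t)) =
    (fun t => complex.Re (f t)) * (fun t => complex.Im (g t)) +
    (fun t => complex.Im (f t)) * (fun t => complex.Re (g t)).
  by apply/funext => t; exact: ImM.
apply: is_derive_eq (is_deriveD (is_deriveM d1 e2) (is_deriveM d2 e1)) _.
case: (f 0) (g 0) d e {d1 d2 e1 e2} => [a b] [a' b'] [d d'] [e e'] /=.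
by rewrite /GRing.scale /= addrACA [b' * d + _]addrC.
Qed.

Lemma cder_conj f d : cder f d -> cder (fun t => (f t)^*) (d^*).
Proof.
move=> [d1 d2]; split.
  have -> : complex.Re d^* = complex.Re d by case: (d).
  have -> // : (fun t => complex.Re (f t)^*) = (fun t => complex.Re (f t)).
  by apply/funext => t; case: (f t).
have -> : complex.Im d^* = - complex.Im d by case: (d).
have -> : (fun t => complex.Im (f t)^*) = - (fun t => complex.Im (f t)).
  by apply/funext => t; rewrite [RHS]/GRing.opp /=; case: (f t).
exact: is_deriveN.
Qed.

Lemma cder_sum (I : Type) (r : seq I) (F : I -> R -> C) (D : I -> C) :
  (forall i, cder (F i) (D i)) -> cder (fun t => \sum_(i <- r) F i t) (\sum_(i <- r) D i).
Proof.
move=> h; elim: r => [|i r IHr].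
  by apply: cder_ext (cder_cst 0) => [t|]; rewrite big_nil.
by apply: cder_ext (cderD (h i) IHr) => [t|]; rewrite big_cons.
Qed.

Lemma mder_near m n (F G : R -> 'M[C]_(m, n)) D :
  (\forall t \near (0 : R), F t = G t) -> mder F D -> mder G D.
Proof.
move=> FG h i j; apply: cder_near (h i j).
by near=> t; congr (fun_of_matrix _ i j); near: t.
Unshelve. all: by end_near. Qed.

Lemma mder_unique m n (F : R -> 'M[C]_(m, n)) D E : mder F D -> mder F E -> D = E.
Proof. by move=> h k; apply/matrixP => i j; exact: cder_unique (h i j) (k i j). Qed.

Lemma mder_cst m n (A : 'M[C]_(m, n)) : mder (fun=> A) 0.
Proof. by move=> i j; apply: cder_ext (cder_cst (A i j)) => [t|]; rewrite ?mxE. Qed.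

Lemma mderD m n (F G : R -> 'M[C]_(m, n)) D E : mder F D -> mder G E ->
  mder (fun t => F t + G t) (D + E).
Proof.
by move=> h k i j; apply: cder_ext (cderD (h i j) (k i j)) => [t|]; rewrite mxE.
Qed.

Lemma mderM m n p (F : R -> 'M[C]_(m, n)) (G : R -> 'M[C]_(n, p)) D E :
  mder F D -> mder G E -> mder (fun t => F t *m G t) (D *m G 0 + F 0 *m E).
Proof.
move=> h k i j; apply: cder_ext
    (cder_sum (index_enum 'I_n) (fun l => cderM (h i l) (k l j))) => [t|].
  by rewrite mxE.
rewrite !mxE -big_split; apply: eq_bigr => l _ /=.
exact: (etrans (addrC _ _) (congr1 (fun x => x + _) (mulrC _ _))).
Qed.

Lemma mderZ m n (a : C) (G : R -> 'M[C]_(m, n)) E :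
  mder G E -> mder (fun t => a *: G t) (a *: E).
Proof.
move=> h i j; apply: cder_ext (cderM (cder_cst a) (h i j)) => [t|].
  by rewrite mxE.
by rewrite mxE mulr0 addr0.
Qed.

Lemma mderB m n (F G : R -> 'M[C]_(m, n)) D E : mder F D -> mder G E ->
  mder (fun t => F t - G t) (D - E).
Proof.
move=> h /(mderZ (-1)) /(mderD h) k i j; apply: cder_ext (k i j) => [t|].
  by rewrite scaleN1r.
by rewrite scaleN1r.
Qed.

Lemma mder_adj m n (F : R -> 'M[C]_(m, n)) D : mder F D ->
  mder (fun t => (F t)^t*) (D^t*).
Proof.
by move=> h i j; apply: cder_ext (cder_conj (h j i)) => [t|]; rewrite !mxE.
Qed.

Lemma mder_sum m n (I : Type) (r : seq I) (F : I -> R -> 'M[C]_(m, n)) D :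
  (forall i, mder (F i) (D i)) -> mder (fun t => \sum_(i <- r) F i t) (\sum_(i <- r) D i).
Proof.
move=> h i j; apply: cder_ext (cder_sum r (fun l => h l i j)) => [t|]; by rewrite summxE.
Qed.

Lemma mder_ulsubmx m n p q (F : R -> 'M[C]_(m + n, p + q)) D : mder F D ->
  mder (fun t => ulsubmx (F t)) (ulsubmx D).
Proof. by move=> h i j; apply: cder_ext (h (lshift n i) (lshift q j)) => [t|]; rewrite !mxE. Qed.

Lemma mder_ursubmx m n p q (F : R -> 'M[C]_(m + n, p + q)) D : mder F D ->
  mder (fun t => ursubmx (F t)) (ursubmx D).
Proof. by move=> h i j; apply: cder_ext (h (lshift n i) (rshift p j)) => [t|]; rewrite !mxE. Qed.

Lemma mder_drsubmx m n p q (F : R -> 'M[C]_(m + n, p + q)) D : mder F D ->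
  mder (fun t => drsubmx (F t)) (drsubmx D).
Proof. by move=> h i j; apply: cder_ext (h (rshift m i) (rshift p j)) => [t|]; rewrite !mxE. Qed.

Local Transparent sproj.
(** Only existence matters here; [isospectral_derivative] finds the value from the identities
    between projections. *)
Lemma mder_sproj m (s : seq C) mu (F : R -> 'M[C]_m) D : mder F D ->
  exists E, mder (fun t => sproj s (F t) mu) E.
Proof.
move=> mF; rewrite /sproj; elim: (undup s) => [|nu r [E IHr]].
  by exists 0; apply: mder_near (mder_cst 1%:M); near=> t; rewrite big_nil.
have [numu|numu] := boolP (nu != mu); last first.
  by exists E; apply: mder_near IHr; near=> t; rewrite big_cons (negPf numu).
eexists; apply: mder_near (mderM (mderZ (mu - nu)^-1 (mderB mF (mder_cst nu%:M))) IHr).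
by near=> t; rewrite big_cons numu.
Unshelve. all: by end_near. Qed.
Local Opaque sproj.

(** The relations between spectral projections hold along the curve, so they can be differentiated
    and fed to [projection_rotation]. The curve itself is the combination of its projections with
    constant eigenvalues. *)
Lemma isospectral_derivative m (s : seq C) (F : R -> 'M[C]_m) D :
  (\forall t \near (0 : R), has_spectrum s (F t)) -> mder F D ->
  exists X : 'M[C]_m, [/\ X^t* = - X, D = comm_mx X (F 0)
    & forall mu, mder (fun t => sproj s (F t) mu) (comm_mx X (sproj s (F 0) mu))].
Proof.
move=> sF mF.
have s0 : has_spectrum s (F 0) by exact: nbhs_singleton sF.
have /choice[P' mP] mu := mder_sproj s mu mF.
pose P mu := sproj s (F 0) mu.
have hP' mu : (P' mu)^t* = P' mu.
  apply: mder_unique (mder_adj (mP mu)) _; apply: mder_near (mP mu).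
  by apply: filterS sF => t st; rewrite sproj_adj.
have [||||||X [sX XE]] := @projection_rotation C m _ (undup s) P P' (undup_uniq s).
- by move=> mu; exact: sproj_adj s0 mu.
- exact: hP'.
- by move=> mu nu _ _; exact: sprojM s0 mu nu.
- move=> mu nu _ _; apply: mder_unique (mderM (mP mu) (mP nu)) _.
  have [mn|mn] := eqVneq mu nu.
    apply: mder_near (mP mu); apply: filterS sF => t st.
    by rewrite -mn (sprojM st) (eqxx mu).
  apply: mder_near (mder_cst 0); apply: filterS sF => t st.
  by rewrite (sprojM st) (negPf mn).
- exact: sproj_sum s0.
- apply: mder_unique (mder_sum (undup s) mP) _; apply: mder_near (mder_cst 1%:M).
  by apply: filterS sF => t st; rewrite sproj_sum.
have PX mu : P' mu = comm_mx X (P mu).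
  have [mus|mus] := boolP (mu \in s); first by apply: XE; rewrite mem_undup.
  rewrite /P sproj_notin// /comm_mx mulmx0 mul0mx subr0.
  apply: mder_unique (mP mu) _; apply: mder_near (mder_cst 0).
  by apply: filterS sF => t st; rewrite sproj_notin.
have FE (A : 'M[C]_m) : has_spectrum s A -> A = \sum_(mu <- undup s) mu *: sproj s A mu.
  move=> sA; rewrite -[LHS]mulmx1 -(sproj_sum sA) mulmx_sumr.
  by apply: eq_bigr => mu _; exact: mul_sproj.
exists X; split=> // [|mu]; last by rewrite -/(P mu) -PX.
have -> : D = \sum_(mu <- undup s) mu *: P' mu.
  apply: mder_unique mF _; apply: mder_near (mder_sum (undup s) (fun mu => mderZ mu (mP mu))).
  by apply: filterS sF => t st; rewrite -FE.
rewrite (FE _ s0) /comm_mx mulmx_sumr mulmx_suml -sumrB; apply: eq_bigr => mu _.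
by rewrite PX /comm_mx scalerBr -scalemxAr -scalemxAl.
Qed.

(** Up to the factor ['i], the trace is the value of the symplectic form. The induction runs over
    all skew generators [X] of [v], so that one level below it applies to the rotation [Xk] supplied
    by [isospectral_derivative]. *)
Lemma tower_isotropic (a : nat -> seq C) k (F G : R -> 'M[C]_(sz k)) v w X Y :
  (\forall t \near (0 : R), tower a k (F t)) -> (\forall t \near (0 : R), tower a k (G t)) ->
  F 0 = G 0 -> mder F v -> mder G w -> X^t* = - X -> Y^t* = - Y ->
  v = comm_mx X (F 0) -> w = comm_mx Y (F 0) -> \tr (w *m X) = 0.
Proof.
elim: k F G v w X Y => [|k IHk] F G v w X Y tF tG FG mF mG sX sY vE wE.
  by rewrite wE /comm_mx [Y *m _](@mulmx11C C) subrr mul0mx mxtrace0.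
have t0 : tower a k.+1 (F 0) by exact: nbhs_singleton tF.
have tF' : \forall t \near (0 : R), tower a k (ulsubmx (F t)).
  by apply: filterS tF => t [].
have tG' : \forall t \near (0 : R), tower a k (ulsubmx (G t)).
  by apply: filterS tG => t [].
have sF : \forall t \near (0 : R), has_spectrum (a k) (ulsubmx (F t)).
  by apply: filterS tF' => t /tower_spectrum.
have sG : \forall t \near (0 : R), has_spectrum (a k) (ulsubmx (G t)).
  by apply: filterS tG' => t /tower_spectrum.
have s0 := nbhs_singleton sF.
have [Xk [sXk vk mP]] := isospectral_derivative sF (mder_ulsubmx mF).
have [Yk [sYk wk _]] := isospectral_derivative sG (mder_ulsubmx mG).
rewrite -FG in wk.
have [rr [c [rho rd]]] : exists r c rho, refdata a k r c rho.
  by apply: refdata_exists; exists (F 0).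
have [hE w0 _] := refdata_tower rd t0.
have IH : \tr (ulsubmx w *m Xk) = 0.
  exact: (IHk (fun t => ulsubmx (F t)) (fun t => ulsubmx (G t)) (ulsubmx v) (ulsubmx w) Xk Yk tF' tG' (congr1 _ FG)
    (mder_ulsubmx mF) (mder_ulsubmx mG) sXk sYk vk wk).
set y := ulsubmx (F 0) in s0 vk wk mP hE w0 *.
set b := ursubmx (F 0) in hE w0 *.
have dr x : tower a k.+1 x -> drsubmx x = c%:M.
  move=> tx; have [xE _ _] := refdata_tower rd tx; rewrite [LHS]mx11_scalar; congr _%:M.
  by rewrite {1}xE drsubmx_bord.
have hc : c^* = c.
  have [_ + _] := hermitian_bord (proj1 (tower_spectrum t0)).
  by rewrite (dr _ t0) mxE.
have v0 : drsubmx v = 0.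
  apply: mder_unique (mder_drsubmx mF) _; apply: mder_near (mder_cst c%:M).
  by apply: filterS tF => t tt; rewrite dr.
have mb := mder_ursubmx mF.
rewrite hE in vE wE.
rewrite vE in vk v0 mb; rewrite wE in wk IH *.
apply: (@isotropy_step C _ (a k) y b c s0 X Y Xk Yk sX sY sXk hc vk wk v0 IH).
(* The projection of the border vanishes along the whole curve, so its derivative is 0; inserting
   the rotation of the spectral projection leaves [P mu *m a = 0]. *)
- move=> mu wmu.
  have : comm_mx Xk (sproj (a k) y mu) *m b +
      sproj (a k) y mu *m ursubmx (comm_mx X (bord y b c)) = 0.
    apply: mder_unique (mderM (mP mu) mb) _; apply: mder_near (mder_cst 0).
    apply: filterS tF => t tt.
    have [mus|mus] := boolP (mu \in a k); last first.
      by rewrite (sproj_notin (tower_spectrum tt.2) mus) mul0mx.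
    have [_ wt_t _] := refdata_tower rd tt.
    rewrite (wt_eq0 (tower_spectrum tt.2))// wt_t// -(w0 mu mus).
    exact: wmu.
  rewrite /comm_mx mulmxBl -mulmxA (wt_eq0 s0 wmu) mulmx0 sub0r => h.
  by rewrite mulmxBr -[RHS]h addrC mulmxA.
(* The weight is constant along the curve; its derivative, with the rotation of the spectral
   projection inserted, is the required sum. *)
move=> mu.
have : mder (fun t => (wt (a k) (ulsubmx (F t)) (ursubmx (F t)) mu)%:M : 'M[C]_1) 0.
  have [mus|mus] := boolP (mu \in a k); last first.
    apply: mder_near (mder_cst 0); apply: filterS tF => t tt.
    rewrite -wtM (sproj_notin (tower_spectrum tt.2) mus) mulmx0 mul0mx //.
  apply: mder_near (mder_cst (rr mu)%:M); apply: filterS tF => t tt.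
  by have [_ wt_t _] := refdata_tower rd tt; rewrite (wt_t mu mus).
move=> /(mder_unique (mder_near _ (mderM (mderM (mder_adj mb) (mP mu)) mb))) <-; last first.
  by near=> t; exact: wtM.
rewrite -/y -/b; move: (ursubmx (comm_mx X _)) => b'.
rewrite /comm_mx adjB adjM sXk mulmxN opprK.
rewrite !(mulmxDl, mulmxDr, mulNmx, mulmxN) !mulmxA -!addrA; congr (_ + (_ + _)).
exact: addrC.
Unshelve. all: by end_near.
Qed.

End CurveDerivatives.

Lemma mder_tangent (R : realType) n (S : set 'M[R[i]]_n) (h v : 'M[R[i]]_n) :
  tangent (@mx_coord R n @` S) (mx_coord h) (mx_coord v) ->
  exists F : R -> 'M[R[i]]_n,
    [/\ \forall t \near (0 : R), S (F t), F 0 = h & mder F v].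
Proof.
move=> [e [c [e0 sc cS c0 cv]]]; exists (fun t => mx_of (c t)); split.
- have : nbhs (0 : R) (ball (0 : R) e) by exact: nbhsx_ballx.
  by apply: filterS => t /cS; rewrite mx_coord_image.
- by rewrite c0 mx_coordK.
- have [_ /(_ 1)[dc _]] := sc 1%N.
  have {}dc := dc 0 (ballxx 0 e0).
  have dl q : is_derive (0 : R) (1 : R) (fun t => c t 0 q) (mx_coord v 0 q).
    apply: DeriveDef; first exact: (derivable_mxP c 0 1).1.
    by rewrite -cv (derive_mx dc) mxE.
  move=> i j; rewrite -[v]mx_coordK; split.
    apply: near_eq_is_derive (is_derive_eq (dl (lshift _ (mxvec_index i j))) _).
      by near=> t; rewrite mxE.
    by rewrite [mx_of _ _ _]mxE.
  apply: near_eq_is_derive (is_derive_eq (dl (rshift _ (mxvec_index i j))) _).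
    by near=> t; rewrite mxE.
  by rewrite [mx_of _ _ _]mxE.
Unshelve. all: by end_near. Qed.

Lemma comm_mxE (R : realType) n (X Y : 'M[R[i]]_n) : comm_mx X Y = commutator X Y.
Proof. by rewrite /comm_mx /commutator. Qed.

Lemma isotropic_tower (R : realType) (a : nat -> seq R[i]) k :
  isotropic (tower a k : set 'M[R[i]]_(sz k)).
Proof.
move=> h v w Sh /mder_tangent[F [tF F0 mF]] /mder_tangent[G [tG G0 mG]].
have sF : \forall t \near (0 : R), has_spectrum (a k) (F t).
  by apply: filterS tF => t /tower_spectrum.
have sG : \forall t \near (0 : R), has_spectrum (a k) (G t).
  by apply: filterS tG => t /tower_spectrum.
have [X [sX vX _]] := isospectral_derivative sF mF.
have [Y [sY wY _]] := isospectral_derivative sG mG.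
have FG : F 0 = G 0 by rewrite F0 G0.
have wY' : w = comm_mx Y (F 0) by rewrite FG.
have w0 := tower_isotropic tF tG FG mF mG sX sY vX wY'.
rewrite comm_mxE F0 in vX; rewrite comm_mxE G0 in wY.
rewrite vX wY kksE// mxtraceZ.
have -> : \tr (h *m commutator X Y) = \tr (w *m X).
  by rewrite wY -!comm_mxE tr_comm.
by rewrite w0 mulr0.
Qed.

(** * Charts of the orbit *)

Section MatrixLemmas.
Variable C : numClosedFieldType.

Lemma unitmx_inj m (A : 'M[C]_m) : (forall v : 'cV_m, A *m v = 0 -> v = 0) -> A \in unitmx.
Proof.
move=> h; rewrite -unitmx_tr -row_free_unit; apply: inj_row_free => v.
move/(congr1 trmx); rewrite trmx_mul trmxK trmx0 => /h /(congr1 trmx).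
by rewrite trmxK trmx0.
Qed.

Lemma unitmx_mul0 m p (A : 'M[C]_m) (B : 'M[C]_(m, p)) : A \in unitmx -> A *m B = 0 -> B = 0.
Proof. by move=> uA /(congr1 (mulmx (invmx A))); rewrite mulKmx// mulmx0. Qed.

Lemma adj_unitmx m (A : 'M[C]_m) : (A^t* \in unitmx) = (A \in unitmx).
Proof. by rewrite map_unitmx unitmx_tr. Qed.

Lemma adj_invmx m (A : 'M[C]_m) : (invmx A)^t* = invmx (A^t*).
Proof. by rewrite trmx_inv map_invmx. Qed.

Lemma tr_adj_mul_eq0 m (A : 'M[C]_m) : \tr (A^t* *m A) = 0 -> A = 0.
Proof.
have E i : (A^t* *m A) i i = ((col i A)^t* *m col i A) 0 0.
  by rewrite !mxE; apply: eq_bigr => j _; rewrite !mxE.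
move/eqP; rewrite psumr_eq0 => [/allP h|i _]; last by rewrite E sqr_norm_ge0.
apply/matrixP => i j; have := h j (mem_index_enum _); rewrite E => /eqP/sqr_norm_eq0.
by move=> /colP/(_ i); rewrite !mxE.
Qed.

Lemma hermitian_spectrum m (x : 'M[C]_m) : x^t* = x -> exists s, has_spectrum s x.
Proof.
move=> hx; have [s sE] := closed_field_poly_normal (char_poly x).
by exists s; split=> //; rewrite {1}sE (monicP (char_poly_monic x)) scale1r.
Qed.

Lemma diag_mx_rowE m (f : 'I_m -> C) i j : diag_mx (\row_k f k) i j = f i *+ (i == j).
Proof. by rewrite !mxE. Qed.

Section Compression.
Variables (m : nat) (J X : 'M[C]_m).
Hypothesis JJ : J *m J = J.
(** The identity on the complement of the range of [J] makes the compression of [X] a matrix of full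
    size, so that its inverse needs no change of dimension. *)
Let N := J *m X *m J + (1%:M - J).

Lemma compr_mulr : N *m J = J *m X *m J.
Proof. by rewrite /N mulmxDl mulmxBl mul1mx -mulmxA JJ subrr addr0. Qed.

Lemma compr_mull : J *m N = J *m X *m J.
Proof. by rewrite /N mulmxDr mulmxBr mulmx1 !mulmxA JJ subrr addr0. Qed.

Hypothesis uN : N \in unitmx.

Lemma compr_inv : J *m X *m J *m invmx N = J.
Proof. by rewrite -compr_mull mulmxK. Qed.

Lemma inv_compr : invmx N *m (J *m X *m J) = J.
Proof. by rewrite -compr_mulr mulKmx. Qed.

Lemma compr_invC : invmx N *m J = J *m invmx N.
Proof. by rewrite -[LHS](mulmxK uN) -[_ *m J *m N]mulmxA compr_mull inv_compr. Qed.

End Compression.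
End MatrixLemmas.

(** * Flags of projections and block unitriangular matrices *)

Section Flags.
Variables (C : numClosedFieldType) (n q : nat) (rho : 'I_n -> nat) (c : nat -> C).
Hypotheses (rho_lt : forall i, (rho i < q)%N) (c_real : forall j, (c j)^* = c j)
  (c_inj : forall i j, (i < q)%N -> (j < q)%N -> c i = c j -> i = j).

(** [rho i] is the block of the index [i] and [c j] the eigenvalue of block [j]; these are the
    projections of the standard flag. *)
Definition flag_idx k : 'M[C]_n := diag_mx (\row_i (rho i < k)%:R).
Local Notation J := flag_idx.

Lemma mulJmx p k (A : 'M[C]_(n, p)) i j : (J k *m A) i j = (rho i < k)%:R * A i j.
Proof. by rewrite mul_diag_mx !mxE. Qed.

Lemma mulmxJ p k (A : 'M[C]_(p, n)) i j : (A *m J k) i j = A i j * (rho j < k)%:R.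
Proof. by rewrite mul_mx_diag !mxE. Qed.

Lemma flag_idx_le k l : (k <= l)%N -> J l *m J k = J k.
Proof.
move=> kl; apply/matrixP => i j; rewrite mulJmx !mxE.
have [->|_] := eqVneq i j; rewrite ?mulr0n ?mulr0//.
by case: (ltnP (rho j) k) => [/leq_trans/(_ kl)->|]; rewrite ?mulr1 ?mulr0.
Qed.

Lemma flag_idxK k : J k *m J k = J k. Proof. exact: flag_idx_le. Qed.

Lemma flag_idx_adj k : (J k)^t* = J k.
Proof.
apply/matrixP => i j; rewrite !mxE rmorphMn rmorph_nat eq_sym.
by case: eqVneq => [->|].
Qed.

Lemma flag_idx0 : J 0 = 0.
Proof. by apply/matrixP => i j; rewrite !mxE ltn0 mul0rn. Qed.

Lemma flag_idxq : J q = 1%:M.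
Proof. by apply/matrixP => i j; rewrite !mxE rho_lt. Qed.

Definition flag (F : nat -> 'M[C]_n) : Prop :=
  [/\ forall k, (F k)^t* = F k, forall k l, (k <= l)%N -> F l *m F k = F k,
      F 0 = 0, F q = 1%:M & forall k, \tr (F k) = \tr (J k)].

Lemma flag_min F k l : flag F -> (k <= l)%N -> F k *m F l = F k.
Proof. by case=> hF FF _ _ _ kl; rewrite -[RHS]hF -[in RHS](FF k l kl) adjM !hF. Qed.

(** Block lower triangular with identity diagonal blocks; these matrices parametrize the open cell
    of flags transversal to the one opposite to the standard flag. *)
Definition unitri (L : 'M[C]_n) : Prop :=
  forall i j, (rho i <= rho j)%N -> L i j = (i == j)%:R.

Lemma unitri_unit L : unitri L -> L \in unitmx.
Proof.
move=> uL; apply: unitmx_inj => v Lv.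
have h m i : (rho i < m)%N -> v i 0 = 0.
  elim: m i => // m IHm i im; have /colP/(_ i) := Lv.
  rewrite !mxE (bigD1 i)//= uL// eqxx mul1r big1 ?addr0// => j ji.
  have [ij|ij] := leqP (rho i) (rho j); first by rewrite uL// eq_sym (negPf ji) mul0r.
  by rewrite IHm ?mulr0//; apply: leq_trans ij im.
by apply/colP => i; rewrite mxE (h _ _ (ltnSn _)).
Qed.

Lemma unitri_compr L k : unitri L -> unitri (J k *m L *m J k + (1%:M - J k)).
Proof.
move=> uL i j ij; rewrite mxE mulmxJ mulJmx !mxE uL//.
have [->|_] := eqVneq i j; last by rewrite mulr0 mul0r add0r oppr0 addr0.
by case: (_ < _)%N; rewrite ?mulr1 ?mulr0 ?subrr ?addr0 ?subr0 ?add0r.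
Qed.

Lemma flag_idx_unitri L i0 : unitri L ->
  J (rho i0).+1 *m L *m (delta_mx i0 0 : 'cV_n) = delta_mx i0 0.
Proof.
move=> uL; rewrite -mulmxA -colE; apply/colP => i; rewrite mulJmx !mxE ltnS andbT.
have [h|h] := leqP (rho i) (rho i0); first by rewrite uL// mul1r.
by rewrite mul0r; case: eqVneq h => // ->; rewrite ltnn.
Qed.

Lemma flag_idx_delta i0 :
  J (rho i0).+1 *m (delta_mx i0 0 : 'cV[C]_n) = delta_mx i0 0.
Proof.
apply/colP => i; rewrite mulJmx !mxE andbT.
by case: eqVneq => [->|_]; rewrite ?mulr0// ltnSn mulr1.
Qed.

Section FlagOf.
Variable L : 'M[C]_n.
Hypothesis uL : unitri L.

Definition gram k := J k *m (L^t* *m L) *m J k + (1%:M - J k).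

Lemma gram_unit k : gram k \in unitmx.
Proof.
apply: unitmx_inj => v Gv.
have Jv : J k *m (L^t* *m L) *m J k *m v = 0.
  by rewrite -(compr_mull (L^t* *m L) (flag_idxK k)) -mulmxA Gv mulmx0.
have v1 : v = J k *m v.
  apply/eqP; rewrite -subr_eq0 -[X in X - _]mul1mx -mulmxBl; apply/eqP.
  by move: Gv; rewrite /gram mulmxDl Jv add0r.
have : L *m (J k *m v) = 0.
  apply: sqr_norm_eq0; rewrite adjM adjM flag_idx_adj.
  by move: Jv; rewrite -!mulmxA => ->; rewrite mulmx0 mxE.
by rewrite -v1 => /(unitmx_mul0 (unitri_unit uL)).
Qed.

(* The orthogonal projection onto the span of the columns [j] of [L] with
   [rho j < k]; [locked] keeps unification from unfolding the product. *)
Definition flag_of k := locked (L *m J k *m invmx (gram k) *m J k *m L^t*).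
Local Notation F := flag_of.

Lemma flag_ofE k : F k = L *m J k *m (invmx (gram k) *m J k *m L^t*).
Proof. by rewrite /flag_of -lock -!mulmxA. Qed.

Lemma flag_of_adj k : (F k)^t* = F k.
Proof.
rewrite /flag_of -lock !adjM trmxCK flag_idx_adj adj_invmx !mulmxA; congr (_ *m _ *m invmx _ *m _ *m _).
by rewrite /gram adjD adjB !adjM adj1 trmxCK flag_idx_adj !mulmxA.
Qed.

Lemma gram_inv k : invmx (gram k) *m (J k *m (L^t* *m (L *m J k))) = J k.
Proof.
by have := inv_compr (flag_idxK k) (gram_unit k); rewrite -/(gram k) -!mulmxA.
Qed.

Lemma flag_ofL k : F k *m (L *m J k) = L *m J k.
Proof.
by rewrite {1}flag_ofE -!mulmxA gram_inv flag_idxK.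
Qed.

Lemma flag_of_le k l : (k <= l)%N -> F l *m F k = F k.
Proof.
move=> kl; have e : F l *m (L *m J k) = L *m J k.
  by rewrite -(flag_idx_le kl) [L *m _]mulmxA mulmxA flag_ofL.
by rewrite (flag_ofE k) mulmxA e.
Qed.

Lemma flag_of_tr k : \tr (F k) = \tr (J k).
Proof.
rewrite flag_ofE -!mulmxA [L *m _]mulmxA mxtrace_mulC -!mulmxA gram_inv //.
Qed.

Lemma flag_ofP : flag F.
Proof.
split.
- exact: flag_of_adj.
- exact: flag_of_le.
- by rewrite flag_ofE flag_idx0 mulmx0 !mul0mx.
- have := flag_ofL q; rewrite flag_idxq mulmx1 => /(congr1 (mulmx^~ (invmx L))).
  by rewrite mulmxK ?mulmxV ?unitri_unit.
- exact: flag_of_tr.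
Qed.

(** The range of [A] contains that of [F k], so [A - F k] is again an orthogonal projection. Its
    trace is 0, and it vanishes by [tr_adj_mul_eq0]. *)
Lemma flag_of_unique k (A : 'M[C]_n) : A^t* = A -> A *m A = A -> \tr A = \tr (J k) ->
  A *m (L *m J k) = L *m J k -> A = F k.
Proof.
move=> hA AA tA AL; have AF : A *m F k = F k.
  by rewrite flag_ofE mulmxA AL.
have FA : F k *m A = F k by rewrite -[RHS]flag_of_adj -[in RHS]AF adjM hA flag_of_adj.
apply/eqP; rewrite -subr_eq0; apply/eqP/tr_adj_mul_eq0.
rewrite adjB hA flag_of_adj mulmxBl !mulmxBr AA AF FA flag_of_le// subrr subr0.
by rewrite mxtraceB tA flag_of_tr subrr.
Qed.

End FlagOf.

Section ChartOf.
Variable F : nat -> 'M[C]_n.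
Hypothesis fF : flag F.

(** For a flag this is invertible exactly when the range of [F k] projects isomorphically to the
    [k]-th standard subspace, which is the condition defining the chart domain. *)
Definition flag_minor k := J k *m F k *m J k + (1%:M - J k).
Local Notation M := flag_minor.

(* Column [j] is the vector of the range of [F (rho j).+1] whose projection onto
   the standard flag is the [j]-th basis vector. *)
Definition chart_mx := \matrix_(i, j) (F (rho j).+1 *m invmx (M (rho j).+1)) i j.

Lemma chart_mxE i j :
  chart_mx i j = (F (rho j).+1 *m invmx (M (rho j).+1)) i j.
Proof. by rewrite mxE. Qed.

Lemma mul_chart_mx p (A : 'M[C]_(p, n)) i j :
  (A *m chart_mx) i j = (A *m (F (rho j).+1 *m invmx (M (rho j).+1))) i j.
Proof. by rewrite mxE [RHS]mxE; apply: eq_bigr => l _; rewrite [chart_mx _ _]mxE. Qed.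

Hypothesis uM : forall k, (0 < k <= q)%N -> M k \in unitmx.

Let uMrho j : M (rho j).+1 \in unitmx. Proof. by apply: uM; rewrite /= rho_lt. Qed.

Lemma chart_mx_unitri : unitri chart_mx.
Proof.
move=> i j ij; rewrite mxE; set l := (rho j).+1.
have e : J l *m (F l *m invmx (M l)) *m J l = J l.
  rewrite -!mulmxA (compr_invC (flag_idxK l) (uMrho j)) !mulmxA.
  exact: (compr_inv (flag_idxK l) (uMrho j)).
have JE : J l i j = (i == j)%:R by rewrite !mxE /l ltnS ij.
by have /matrixP/(_ i j) := e; rewrite mulmxJ mulJmx JE /l !ltnS ij leqnn mul1r mulr1.
Qed.

Lemma flag_chart_mx k : F k *m (chart_mx *m J k) = chart_mx *m J k.
Proof.
have [_ FF _ _ _] := fF.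
apply/matrixP => i j; rewrite mulmxA !mulmxJ.
case: (ltnP (rho j) k) => jk; last by rewrite !mulr0.
rewrite mul_chart_mx mulmxA FF// -[in RHS](mul1mx chart_mx) mul_chart_mx.
by rewrite mul1mx.
Qed.

Lemma chart_mxK k : flag_of chart_mx k = F k.
Proof.
have [hF FF _ _ tF] := fF; apply/esym; apply: flag_of_unique => //.
- exact: chart_mx_unitri.
- by rewrite FF.
- exact: flag_chart_mx.
Qed.

End ChartOf.

Section FlagOfK.
Variable L : 'M[C]_n.
Hypothesis uL : unitri L.
Local Notation F := (flag_of L).

(** A kernel vector [v] satisfies [v = J k *m v] and is orthogonal to the columns of [L *m J k]; the
    compression of [L] is unitriangular, so [v] is 0. *)
Lemma flag_minor_unit k : flag_minor F k \in unitmx.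
Proof.
apply: unitmx_inj => v Mv; set M := flag_minor F k in Mv.
have JFJ : J k *m F k *m J k *m v = 0.
  by rewrite -(compr_mull (F k) (flag_idxK k)) -mulmxA Mv mulmx0.
have v1 : (1%:M - J k) *m v = 0.
  by move: Mv; rewrite /M /flag_minor mulmxDl JFJ add0r.
have FF : F k *m F k = F k by exact: flag_of_le.
have FJ : F k *m (J k *m v) = 0.
  apply: sqr_norm_eq0; rewrite 2!adjM flag_idx_adj flag_of_adj//.
  rewrite -!mulmxA. rewrite [F k *m (F k *m _)]mulmxA FF.
  by move: JFJ; rewrite -!mulmxA => ->; rewrite mulmx0 mxE.
have LJ : J k *m L^t* *m (J k *m v) = 0.
  have := congr1 (fun A => A^t* *m (J k *m v)) (flag_ofL uL k).
  by rewrite 2!adjM flag_idx_adj flag_of_adj// -!mulmxA FJ !mulmx0 => <-.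
apply: (@unitmx_mul0 _ _ _ ((J k *m L *m J k + (1%:M - J k))^t*)).
  by rewrite adj_unitmx unitri_unit//; exact: unitri_compr.
rewrite adjD adjB !adjM adj1 flag_idx_adj mulmxDl v1 addr0 -LJ.
by rewrite !mulmxA.
Qed.

Lemma flag_ofK : chart_mx F = L.
Proof.
apply/matrixP => i j; rewrite mxE; set l := (rho j).+1.
pose e : 'cV[C]_n := delta_mx j 0.
have uM : flag_minor F l \in unitmx by exact: flag_minor_unit.
have Je : J l *m e = e by exact: flag_idx_delta.
have FF : F l *m F l = F l by exact: flag_of_le.
(* The difference of the two candidate columns lies in the range of [F l] and is killed by [J l];
   writing it as [L *m (J l *m w)], the compression of [L] gives [J l *m w = 0]. *)
pose d := F l *m invmx (flag_minor F l) *m e - L *m e.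
suff d0 : d = 0.
  have : F l *m invmx (flag_minor F l) *m e = L *m e.
    by apply/eqP; rewrite -subr_eq0; apply/eqP.
  by rewrite -!colE => /colP/(_ i); rewrite mxE [RHS]mxE.
have Jd : J l *m d = 0.
  rewrite /d mulmxBr mulmxA -{1}Je -!mulmxA [invmx _ *m _]mulmxA.
  rewrite (compr_invC (flag_idxK l) uM) !mulmxA.
  rewrite (compr_inv (flag_idxK l) uM) Je.
  by rewrite /e flag_idx_unitri// subrr.
have Fd : F l *m d = d.
  rewrite /d mulmxBr !mulmxA FF; congr (_ - _).
  by rewrite -[e]Je -!mulmxA [L *m _]mulmxA [F l *m _]mulmxA flag_ofL// -!mulmxA.
have [w dE] : exists w, d = L *m (J l *m w).
  by exists (invmx (gram L l) *m J l *m L^t* *m d); rewrite -{1}Fd flag_ofE -!mulmxA.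
have Jw0 : J l *m w = 0.
  apply: (@unitmx_mul0 _ _ _ (J l *m L *m J l + (1%:M - J l))).
    by rewrite unitri_unit//; exact: unitri_compr.
  rewrite mulmxDl mulmxBl mul1mx !mulmxA flag_idxK subrr addr0.
  by rewrite -[_ *m J l *m J l]mulmxA flag_idxK -!mulmxA -dE.
by rewrite dE Jw0 mulmx0.
Qed.

End FlagOfK.

Definition flag_spectrum : seq C := [seq c (rho i) | i <- enum 'I_n].
Local Notation s := flag_spectrum.

Lemma count_flag_spectrum j : (j < q)%N -> (count_mem (c j) s)%:R = \tr (J j.+1 - J j).
Proof.
move=> jq; rewrite /s count_map /flag_idx -raddfB /= mxtrace_diag.
rewrite -sum1_count big_enum_cond /= natr_sum big_mkcond; apply: eq_bigr => i _ /=.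
rewrite !mxE; case: (eqVneq (c (rho i)) (c j)) => [/c_inj -> //|h].
  by rewrite ltnSn ltnn subr0.
have : rho i != j by apply: contraNneq h => ->.
by rewrite ltnS; case: ltngtP => //; rewrite subrr.
Qed.

Definition flag_sum (F : nat -> 'M[C]_n) := \sum_(0 <= j < q) c j *: (F j.+1 - F j).

(* The cut-off at [q] makes the values of [c] beyond [q] irrelevant. *)
Definition spectral_flag (x : 'M[C]_n) k := \sum_(0 <= j < minn k q) sproj s x (c j).

Lemma mem_flag_spectrum mu : mu \in s -> exists2 j, (j < q)%N & mu = c j.
Proof. by case/mapP => i _ ->; exists (rho i). Qed.

Lemma spectral_flagS x j : (j < q)%N ->
  spectral_flag x j.+1 - spectral_flag x j = sproj s x (c j).
Proof.
move=> jq; rewrite /spectral_flag (minn_idPl jq) (minn_idPl (ltnW jq)).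
by rewrite big_nat_recr//= addrAC subrr add0r.
Qed.

Lemma spectral_flagP x : has_spectrum s x -> flag (spectral_flag x) /\
  flag_sum (spectral_flag x) = x.
Proof.
move=> sx; have FP k j : (j < minn k q)%N ->
    spectral_flag x k *m sproj s x (c j) = sproj s x (c j).
  move=> jk; rewrite /spectral_flag mulmx_suml.
  rewrite (bigD1_seq j) ?mem_index_iota ?iota_uniq//= (sprojM sx) eqxx.
  rewrite big_seq_cond big1 ?addr0// => i; rewrite mem_index_iota => /andP[ik ij].
  rewrite (sprojM sx) ifN//; apply: contraNneq ij => /c_inj e.
  move: ik jk; rewrite /= !leq_min => /andP[_ iq] /andP[_ jq].
  by rewrite e.
have Fq : spectral_flag x q = 1%:M.
  rewrite -[LHS]mulmx1 -(sproj_sum sx) mulmx_sumr; apply: eq_big_seq => mu.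
  rewrite mem_undup => /mem_flag_spectrum[j jq ->].
  by rewrite FP// minnn.
split; first split=> //.
- by move=> k; rewrite /spectral_flag adj_sum; apply: eq_bigr => j _; exact: sproj_adj.
- move=> k l kl; rewrite [in LHS]/(spectral_flag x k) mulmx_sumr [RHS]/spectral_flag.
  apply: eq_big_nat => j /= jk; apply: FP; apply: leq_trans jk _.
  by rewrite leq_min geq_minr (leq_trans (geq_minl _ _) kl).
- by rewrite /spectral_flag min0n big_geq.
- move=> k; rewrite /spectral_flag raddf_sum /=.
  rewrite (eq_big_nat _ _ (F2 := fun j => \tr (J j.+1) - \tr (J j))).
    rewrite telescope_sumr// flag_idx0 mxtrace0 subr0.
    case: (leqP k q) => kq; first by [].
    congr (\tr _); apply/matrixP => i j; rewrite !mxE rho_lt (leq_trans _ (ltnW kq))//.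
  move=> j jk; rewrite (sproj_trace sx) count_flag_spectrum ?mxtraceB//.
  by move: jk; rewrite /= leq_min => /andP[].
rewrite /flag_sum -[RHS]mulmx1 -Fq /spectral_flag mulmx_sumr minnn.
by apply: eq_big_nat => j jq; rewrite (mul_sproj sx) spectral_flagS.
Qed.

Lemma sum_flag_value (E : nat -> 'M[C]_n) j : (j < q)%N ->
  \sum_(0 <= i < q | c i == c j) E i = E j.
Proof.
move=> jq; rewrite big_mkcond (bigD1_seq j) ?mem_index_iota ?iota_uniq//= eqxx.
rewrite big_seq_cond big1 ?addr0// => i /andP[]; rewrite mem_index_iota /= => iq ij.
by case: eqP => // /c_inj e; move: ij; rewrite e// eqxx.
Qed.

Section FlagSum.
Variable F : nat -> 'M[C]_n.
Hypothesis fF : flag F.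
Let E j := F j.+1 - F j.

Lemma flag_stepM i j : E i *m E j = if i == j then E i else 0.
Proof.
have [_ FF _ _ _] := fF; have mF k l := flag_min (k := k) (l := l) fF.
rewrite /E mulmxBl !mulmxBr; case: (ltngtP i j) => ij.
- by rewrite !mF ?leqW// ?(ltnW ij)// subrr sub0r opprB subrr.
- by rewrite !FF ?leqW// ?(ltnW ij)// subrr.
- by rewrite ij (FF j.+1 j.+1)// (FF j j.+1)// (FF j j)// (mF j j.+1)// subrr subr0.
Qed.

Lemma flag_step_sum k : \sum_(0 <= j < k) E j = F k.
Proof. by have [_ _ F0 _ _] := fF; rewrite telescope_sumr// F0 subr0. Qed.

Lemma flag_sum_adj : (flag_sum F)^t* = flag_sum F.
Proof.
have [hF _ _ _ _] := fF; rewrite /flag_sum adj_sum; apply: eq_bigr => j _.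
by rewrite adjZ adjB !hF c_real.
Qed.

Lemma flag_sumM j : (j < q)%N -> flag_sum F *m E j = c j *: E j.
Proof.
move=> jq; rewrite /flag_sum mulmx_suml.
rewrite (bigD1_seq j) ?mem_index_iota ?iota_uniq//= -scalemxAl flag_stepM eqxx.
rewrite big1 ?addr0// => i ij; rewrite -scalemxAl -/(E i) flag_stepM (negPf ij).
by rewrite scaler0.
Qed.

Lemma sproj_flag_sum s' mu : has_spectrum s' (flag_sum F) ->
  sproj s' (flag_sum F) mu = \sum_(0 <= j < q | c j == mu) E j.
Proof.
move=> sx; have [_ _ _ Fq _] := fF.
rewrite -[LHS]mulmx1 -Fq -flag_step_sum mulmx_sumr [RHS]big_mkcond.
apply: eq_big_nat => j /= jq.
have PE := sproj_fix sx (flag_sumM jq); rewrite -PE mulmxA (sprojM sx) eq_sym.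
by case: eqVneq => [->|_]; rewrite ?PE// mul0mx.
Qed.

(** Some spectrum [s'] exists because the matrix is Hermitian. Its multiplicities are the traces of
    the spectral projections, which are steps of the flag and have known traces. *)
Lemma flag_sumP : has_spectrum s (flag_sum F).
Proof.
have [s' sx] := hermitian_spectrum flag_sum_adj.
have [_ _ _ _ tF] := fF.
suff ss : perm_eq s' s.
  by split; rewrite ?flag_sum_adj// (proj2 sx); apply: perm_big.
apply/allP => mu _ /=; apply/eqP; have := sproj_trace sx mu.
rewrite sproj_flag_sum//.
have [/hasP[j]|/hasPn h] := boolP (has (fun j => c j == mu) (index_iota 0 q)).
  rewrite mem_index_iota /= => jq /eqP <-.
  rewrite (sum_flag_value _ jq) mxtraceB !tF -mxtraceB -count_flag_spectrum// => /eqP.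
  by rewrite eqr_nat => /eqP.
rewrite big_seq_cond big1 => [|j /andP[/h /negPf ->//]].
rewrite mxtrace0 => /esym/eqP; rewrite pnatr_eq0 => /eqP ->.
apply/esym/count_memPn/negP => /mem_flag_spectrum[j jq e].
by have := h j; rewrite mem_index_iota e eqxx => /(_ jq).
Qed.

Lemma spectral_flagK k : (k <= q)%N -> spectral_flag (flag_sum F) k = F k.
Proof.
move=> kq; rewrite -flag_step_sum /spectral_flag (minn_idPl kq).
apply: eq_big_nat => j /= jk; have jq := leq_trans jk kq.
by rewrite (sproj_flag_sum _ flag_sumP) sum_flag_value.
Qed.

End FlagSum.

Lemma chart_forward y : has_spectrum s y ->
  (forall k, (0 < k <= q)%N -> flag_minor (spectral_flag y) k \in unitmx) ->
  unitri (chart_mx (spectral_flag y)) /\ flag_sum (flag_of (chart_mx (spectral_flag y))) = y.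
Proof.
move=> sy uM; have [fF yE] := spectral_flagP sy; split; first exact: chart_mx_unitri.
by rewrite -[RHS]yE; apply: eq_bigr => j _; rewrite !chart_mxK.
Qed.

Lemma chart_backward L : unitri L -> let y := flag_sum (flag_of L) in
  [/\ has_spectrum s y,
      forall k, (0 < k <= q)%N -> flag_minor (spectral_flag y) k \in unitmx
    & chart_mx (spectral_flag y) = L].
Proof.
move=> uL y; have fF := flag_ofP uL; split.
- exact: flag_sumP.
- by move=> k /andP[_ kq]; rewrite /flag_minor spectral_flagK//; exact: flag_minor_unit.
rewrite -[RHS](flag_ofK uL); apply/matrixP => i j.
by rewrite !mxE; apply: eq_bigr => l _; rewrite /flag_minor spectral_flagK.
Qed.

Lemma flag_idxP : flag flag_idx.
Proof.
split=> //; [exact: flag_idx_adj|exact: flag_idx_le|exact: flag_idx0|exact: flag_idxq].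
Qed.

Lemma flag_idx_sum : flag_sum flag_idx = diag_mx (\row_i c (rho i)).
Proof.
apply/matrixP => i j; rewrite /flag_sum summxE !mxE.
have [->|ij] := eqVneq i j; last first.
  by rewrite big1 ?mulr0n// => l _; rewrite !mxE (negPf ij) !mulr0n subrr mulr0.
rewrite (bigD1_seq (rho j)) ?mem_index_iota ?iota_uniq//= big1 ?addr0 => [|l lj].
  by rewrite !mxE eqxx ltnSn ltnn subr0 mulr1.
rewrite !mxE eqxx ltnS leq_eqVlt eq_sym (negPf lj) /= subrr mulr0 //.
Qed.

Lemma flag_idx_minor k : (k <= q)%N ->
  flag_minor (spectral_flag (diag_mx (\row_i c (rho i)))) k \in unitmx.
Proof.
move=> kq; rewrite /flag_minor -flag_idx_sum (spectral_flagK flag_idxP kq).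
by rewrite !flag_idxK addrC subrK unitmx1.
Qed.

End Flags.

(** * The orbit as a manifold *)

Section OrbitManifold.
Variables (R : realType) (n q : nat) (rho : 'I_n -> nat) (c : nat -> R[i]).
Local Notation C := R[i].
Hypotheses (rho_lt : forall i, (rho i < q)%N) (c_real : forall j, (c j)^* = c j)
  (c_inj : forall i j, (i < q)%N -> (j < q)%N -> c i = c j -> i = j).
Local Notation s := (flag_spectrum rho c).

(** The positions strictly below the diagonal blocks; their number is the complex dimension of the
    orbit. *)
Definition free_idx : {set 'I_n * 'I_n} := [set ij | (rho ij.2 < rho ij.1)%N]%SET.
Local Notation N := #|free_idx|.

Definition unitri_of (w : 'rV[R]_(N + N)) : 'M[C]_n :=
  \matrix_(i, j) ((i == j)%:R + \sum_(k < N)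
    (if enum_val k == (i, j) then (w 0 (lshift N k) +i* w 0 (rshift N k))%C else 0)).

Definition unitri_coord (L : 'M[C]_n) : 'rV[R]_(N + N) :=
  row_mx (\row_k complex.Re (L (enum_val k).1 (enum_val k).2))
         (\row_k complex.Im (L (enum_val k).1 (enum_val k).2)).

Lemma free_enum (k : 'I_N) : (rho (enum_val k).2 < rho (enum_val k).1)%N.
Proof. by have := enum_valP k; rewrite inE. Qed.

Lemma unitri_ofP w : unitri rho (unitri_of w).
Proof.
move=> i j ij; rewrite mxE [X in _ + X]big1 ?addr0// => k _.
by case: eqP => // e; have := free_enum k; rewrite e /= ltnNge ij.
Qed.

Lemma unitri_of_enum w (k : 'I_N) : unitri_of w (enum_val k).1 (enum_val k).2 =
  (w 0 (lshift N k) +i* w 0 (rshift N k))%C.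
Proof.
rewrite mxE (bigD1 k)//= -surjective_pairing eqxx big1 ?addr0 => [|k' kk'].
  case: eqVneq (free_enum k) => [->|_ _]; first by rewrite ltnn.
  by rewrite add0r.
by rewrite ifN//; apply: contraNneq kk' => /enum_val_inj ->.
Qed.

Lemma unitri_ofK w : unitri_coord (unitri_of w) = w.
Proof.
apply/rowP => l; rewrite /unitri_coord; case: (split_ordP l) => k ->.
  by rewrite row_mxEl mxE unitri_of_enum.
by rewrite row_mxEr mxE unitri_of_enum.
Qed.

Lemma unitri_coordK L : unitri rho L -> unitri_of (unitri_coord L) = L.
Proof.
move=> uL; apply/matrixP => i j.
have [ij|ij] := leqP (rho i) (rho j); first by rewrite uL// unitri_ofP.
have ijN : (i, j) \in free_idx by rewrite inE.
pose k := enum_rank_in ijN (i, j).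
have kE : enum_val k = (i, j) by rewrite enum_rankK_in.
have := unitri_of_enum (unitri_coord L) k; rewrite kE /= => ->.
by rewrite /unitri_coord row_mxEl row_mxEr !mxE kE /=; case: (L i j).
Qed.

Lemma msm_unitri_of (A : set 'rV[R]_(N + N)) x : msm A x unitri_of.
Proof.
move=> i j; have h : csm A x (fun w => (i == j)%:R + \sum_(k < N)
    (if enum_val k == (i, j) then (w 0 (lshift N k) +i* w 0 (rshift N k))%C else 0)).
  apply: csmD; [exact: csm_cst|apply: csm_sum => k _].
  by case: eqP => _; [split; exact: esm_coord|exact: csm_cst].
by apply: csm_ext h => y _; rewrite [RHS]mxE.
Qed.

Lemma emap_unitri_coord m (A : set 'rV[R]_m) (F : 'rV[R]_m -> 'M[C]_n) :
  (forall x, A x -> msm A x F) -> emap A (fun v => unitri_coord (F v)).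
Proof.
move=> mF x Ax l; rewrite /unitri_coord; case: (split_ordP l) => k ->.
  by apply: esm_ext (mF x Ax (enum_val k).1 (enum_val k).2).1 => y _; rewrite row_mxEl mxE.
by apply: esm_ext (mF x Ax (enum_val k).1 (enum_val k).2).2 => y _; rewrite row_mxEr mxE.
Qed.

Lemma msm_spectral_flag m (A : set 'rV[R]_m) x F k : msm A x F ->
  msm A x (fun y => spectral_flag q rho c (F y) k).
Proof. by move=> mF; apply: msm_sum => j _; exact: msm_sproj. Qed.

Lemma msm_flag_minor m (A : set 'rV[R]_m) x (F : 'rV[R]_m -> nat -> 'M[C]_n) k :
  msm A x (fun y => F y k) -> msm A x (fun y => flag_minor rho (F y) k).
Proof.
move=> mF; apply: msmD (msm_cst _ _ _).
exact: msmM (msmM (msm_cst _ _ _) mF) (msm_cst _ _ _).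
Qed.

Lemma msm_diag m (A : set 'rV[R]_m) x p (f : 'rV[R]_m -> 'I_p -> C) :
  (forall k, csm A x (fun y => f y k)) -> msm A x (fun y => diag_mx (\row_k f y k)).
Proof.
move=> mf i j; have [ij|ij] := eqVneq i j.
  apply: csm_ext (mf i) => y _.
  exact: (esym (etrans (diag_mx_rowE (f y) i j) (congr1 (fun b : bool => f y i *+ b) (introT eqP ij)))).
apply: csm_ext (csm_cst A x 0) => y _.
exact: (esym (etrans (diag_mx_rowE (f y) i j) (congr1 (fun b : bool => f y i *+ b) (negPf ij)))).
Qed.

Lemma msm_chart_mx m (A : set 'rV[R]_m) x (F : 'rV[R]_m -> nat -> 'M[C]_n) : A x ->
  (forall k, msm A x (fun y => F y k)) ->
  (forall y j, A y -> flag_minor rho (F y) (rho j).+1 \in unitmx) ->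
  msm A x (fun y => chart_mx rho (F y)).
Proof.
move=> Ax mF uF i j.
have mM := msm_flag_minor (mF (rho j).+1).
have mV := msm_invmx Ax (fun y Ay => uF y j Ay) mM.
apply: csm_ext (msmM (mF (rho j).+1) mV i j) => y _.
exact: (esym (chart_mxE rho (F y) i j)).
Qed.

(** All minors on one diagonal, so that the chart domain is the nonvanishing of a single determinant
    and [open_det_neq0] applies. *)
Definition minors (y : 'M[C]_n) : 'M[C]_q :=
  diag_mx (\row_(k < q) \det (flag_minor rho (spectral_flag q rho c y) k.+1)).

Lemma minorsP y : \det (minors y) != 0 <->
  forall k, (0 < k <= q)%N -> flag_minor rho (spectral_flag q rho c y) k \in unitmx.
Proof.
rewrite /minors det_diag; split=> [h [|k] // kq|h].
  rewrite unitmxE unitfE; have /prodf_neq0/(_ (Ordinal kq) isT) := h.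
  by rewrite mxE.
by apply/prodf_neq0 => k _; rewrite mxE -unitfE -unitmxE h//= ltn_ord.
Qed.

Lemma msm_minors m (A : set 'rV[R]_m) x F : msm A x F -> msm A x (fun y => minors (F y)).
Proof.
by move=> mF; apply: msm_diag => k; apply: csm_det; apply: msm_flag_minor; exact: msm_spectral_flag.
Qed.

(** Conjugation by a diagonalizing unitary moves the given point to the diagonal matrix, the centre
    of the cell, so one chart formula serves all points. The cell is parametrized by a whole
    Euclidean space, whence [setT]. *)
Lemma emanifold_orbit :
  emanifold (@mx_coord R n @` [set x | has_spectrum s x]).
Proof.
exists (N + N)%N => v; rewrite mx_coord_image /preimage /= => sx0.
have [Q uQ x0E] := spectrum_diag sx0.
have QQ : Q *m Q^t* = 1%:M by exact/unitarymxP.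
have Q'Q := unitary_adjl uQ.
pose rot (x : 'M[C]_n) := Q *m x *m Q^t*.
pose unrot (y : 'M[C]_n) := Q^t* *m y *m Q.
have rotK y : rot (unrot y) = y.
  by rewrite /rot /unrot !mulmxA QQ mul1mx -mulmxA QQ mulmx1.
have unrotK x : unrot (rot x) = x.
  by rewrite /rot /unrot !mulmxA Q'Q mul1mx -mulmxA Q'Q mulmx1.
have srot x : has_spectrum s x -> has_spectrum s (rot x) by exact: has_spectrum_conj.
have sunrot y : has_spectrum s y -> has_spectrum s (unrot y).
  move=> sy; have uQ' : Q^t* \is unitarymx by apply/unitarymxP; rewrite trmxCK.
  by have := has_spectrum_conj uQ' sy; rewrite trmxCK.
have mrot A x : msm A x (fun v : 'rV[R]_(n * n + n * n) => rot (mx_of v)).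
  exact: msmM (msmM (msm_cst _ _ _) (msm_mx_of _ _)) (msm_cst _ _ _).
pose U : set 'rV[R]_(n * n + n * n) := [set v | \det (minors (rot (mx_of v))) != 0].
exists U, setT, (fun v => unitri_coord (chart_mx rho (spectral_flag q rho c (rot (mx_of v))))).
exists (fun w => mx_coord (unrot (flag_sum q c (flag_of rho (unitri_of w))))).
split.
- by apply: open_det_neq0 => x; exact: msm_minors.
- apply/minorsP => k /andP[_ kq].
  have -> : rot (mx_of v) = diag_mx (\row_i c (rho i)).
    rewrite x0E -[LHS]/(rot (unrot _)) rotK; congr diag_mx; apply/rowP => i.
    by rewrite !mxE (nth_map i) ?size_enum_ord// nth_ord_enum.
  exact: flag_idx_minor.
- exact: openT.
set S := _ `&` U.
have US x : S x -> forall k, (0 < k <= q)%N ->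
    flag_minor rho (spectral_flag q rho c (rot (mx_of x))) k \in unitmx.
  by case=> _ /minorsP.
split.
- apply: emap_unitri_coord => x Sx; apply: msm_chart_mx => //.
    by move=> k; exact: msm_spectral_flag.
  by move=> y j Sy; exact: (US y Sy (rho j).+1 (rho_lt j)).
- apply: emap_mx_coord => w _; apply: msmM (msm_cst _ _ _).
  apply: msmM (msm_cst _ _ _) _; apply: msm_sum => j _; apply: msmZ; first exact: csm_cst.
  have mL := msm_unitri_of setT w.
  have mJ k : msm setT w (fun=> flag_idx C rho k) := msm_cst _ _ _.
  have mG k : msm setT w (fun w => gram rho (unitri_of w) k).
    apply: msmD (msm_cst _ _ _).
    exact: msmM (msmM (mJ k) (msmM (msm_adj mL) mL)) (mJ k).
  have mV k := msm_invmx I (fun y _ => gram_unit (unitri_ofP y) k) (mG k).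
  have mF k : msm setT w (fun w => flag_of rho (unitri_of w) k).
    apply: msm_ext (msmM (msmM (msmM (msmM mL (mJ k)) (mV k)) (mJ k)) (msm_adj mL)) => y _.
    by rewrite flag_ofE !mulmxA.
  exact: msmB.
- move=> x Sx; split=> //.
  have [uL xE] := chart_forward rho_lt c_inj (srot _ Sx.1) (US x Sx).
  by rewrite unitri_coordK// xE unrotK mx_ofK.
move=> w _.
have [sy uM LE] := chart_backward rho_lt c_real c_inj (unitri_ofP w).
rewrite mx_coordK rotK LE unitri_ofK; split; [split|by []].
  by rewrite /= mx_coordK; exact: sunrot.
by rewrite /U /= mx_coordK rotK; apply/minorsP.
Qed.

End OrbitManifold.

Section OrbitCoordinates.
Variables (R : realType) (n : nat) (lam : 'I_n -> R).

Let vals := undup [seq lam i | i <- enum 'I_n].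
Let rank i := index (lam i) vals.
Let val_at j : R[i] := (nth 0 vals j)%:C%C.

Lemma emanifold_coadjoint_orbit : emanifold (@mx_coord R n @` coadjoint_orbit lam).
Proof.
have rank_lt i : (rank i < size vals)%N.
  by rewrite index_mem mem_undup map_f// mem_enum.
have rankE i : val_at (rank i) = (lam i)%:C%C.
  by rewrite /val_at nth_index// mem_undup map_f// mem_enum.
have val_inj_at i j : (i < size vals)%N -> (j < size vals)%N -> val_at i = val_at j -> i = j.
  by move=> il jl /complexI/eqP; rewrite nth_uniq ?undup_uniq// => /eqP.
have -> : coadjoint_orbit lam = [set x | has_spectrum (flag_spectrum rank val_at) x].
  have e : \prod_(z <- flag_spectrum rank val_at) ('X - z%:P) =
      \prod_(i < n) ('X - ((lam i)%:C%C)%:P).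
    rewrite big_map big_enum; apply: eq_bigr => i _.
    by congr ('X - _%:P); exact: rankE.
  apply/seteqP; split=> x [hx cx]; split.
  - exact/hermsymmxP.
  - exact: etrans cx (esym e).
  - exact/hermsymmxP.
  - exact: etrans cx e.
exact: (emanifold_orbit rank_lt (fun j => conjc_real (nth 0 vals j)) val_inj_at).
Qed.

End OrbitCoordinates.

Lemma gc_fiber_structure (R : realType) l (lam : 'I_(sz l) -> R) u : gc_polytope lam u ->
  [/\ submanifold (@mx_coord R _ @` gc_fiber lam u) (@mx_coord R _ @` coadjoint_orbit lam),
      isotropic (gc_fiber lam u)
    & iterated_odd_sphere_bundle l (EuclSet (@mx_coord R _ @` gc_fiber lam u))].
Proof.
move=> [x0 O0 <-].
have sub : gc_fiber lam (gc_system lam x0) `<=` coadjoint_orbit lam by move=> x [].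
have ne : tower (fun k => [seq r%:C%C | r <- levels x0 k]) l !=set0.
  by exists x0; exact: (tower_levels O0).
rewrite (gc_fiber_tower O0) in sub *; split.
- split; [|exact/emanifold_manifold/emanifold_coadjoint_orbit|exact: image_subset].
  exact: emanifold_manifold (emanifold_tower ne).
- exact: isotropic_tower.
- exact: tower_iterated_bundle.
Qed.

Theorem theoremA (R : realType) (r n : nat) (ns : nat -> nat) (lam : 'I_n -> R)
    (r_ge1 : (1 <= r)%N)
    (ns_first : ns 0%N = 0%N)
    (ns_incr : forall k, (k <= r)%N -> (ns k < ns k.+1)%N)
    (ns_last : ns r.+1 = n)
    (lam_const : forall k (a b : 'I_n), (k <= r)%N ->
       (ns k <= a < ns k.+1)%N -> (ns k <= b < ns k.+1)%N -> lam a = lam b)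
    (lam_jump : forall k (a b : 'I_n), (1 <= k <= r)%N ->
       (a.+1 = ns k)%N -> (b = ns k :> nat) -> lam b < lam a) :
  (forall u, gc_polytope lam u ->
     [/\ submanifold (@mx_coord R n @` gc_fiber lam u)
                     (@mx_coord R n @` coadjoint_orbit lam),
         isotropic (gc_fiber lam u)
       & iterated_odd_sphere_bundle n.-1
           (EuclSet (@mx_coord R n @` gc_fiber lam u))]) /\
  (forall F u1 u2, is_face (gc_polytope lam) F ->
     relative_interior F u1 -> relative_interior F u2 ->
     diffeomorphic (@mx_coord R n @` gc_fiber lam u1)
                   (@mx_coord R n @` gc_fiber lam u2)).
Proof.
have n_gt1 : (1 < n)%N.
  rewrite -ns_last; apply: leq_trans (ns_incr r (leqnn r)); rewrite ltnS.
  by case: r r_ge1 ns_incr {ns_last lam_const lam_jump} => // p _ h; apply: leq_ltn_trans (h p (leqnSn p)).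
(* Sizes of the form [sz l] let [ulsubmx] remove one row and column at a time; [l] is the number of
   stages, positive because [r] is at least 1. *)
have [l l_gt0 nE] : exists2 l, (0 < l)%N & n = sz l.
  by case: n n_gt1 {ns_last lam lam_const lam_jump} => // m m1; exists m; rewrite ?szE.
clear ns_last lam_const lam_jump n_gt1; subst n.
have -> : (sz l).-1 = l by rewrite szE.
split=> [u|F u1 u2 [c FE]]; first exact: gc_fiber_structure.
by apply: gc_fiber_diffeo => // x; rewrite FE => -[].
Qed.
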